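(* Let $\Phi\in H^2_{M_n}$ be such that $\Phi^*$ is of bounded type. If $$\Phi=\Theta_rA_r^*\ \ (\text{right coprime})\ =\ A_l^*\Theta_l\ \ (\text{left coprime}),$$ then $\dim\mathcal H(\Theta_r)=\dim\mathcal H(\Theta_l)$.
   Context: $H^2_{M_n}$, $H^\infty_{M_n}$: $n\times n$ matrix functions with entries in the Hardy spaces $H^2,H^\infty$ of the unit disk; $H^2_{\mathbb C^n}$ is the $\mathbb C^n$-valued Hardy space. A matrix function on the unit circle $\mathbb T$ is of bounded type if each entry equals a.e. on $\mathbb T$ a quotient of two $H^\infty$ functions. $\Theta\in H^\infty_{M_{n\times m}}$ is inner if $\Theta^*\Theta=I_m$ a.e. on $\mathbb T$. For $\Phi\in H^2_{M_{n\times r}}$, an inner $\Delta\in H^\infty_{M_{n\times m}}$ is a left inner divisor of $\Phi$ if $\Phi=\Delta F$ with $F\in H^2_{M_{m\times r}}$. Two functions are left coprime if their only common left inner divisors are unitary constants; $\Phi,\Psi$ are right coprime if $\widetilde\Phi,\widetilde\Psi$ are left coprime, where $\widetilde\Phi(z)=\Phi(\overline z)^*$. ''$\Phi=\Theta_rA_r^*$ (right coprime)'' means $\Theta_r\in H^\infty_{M_n}$ is inner, $A_r\in H^2_{M_n}$, and $\Theta_r,A_r$ are right coprime; ''$\Phi=A_l^*\Theta_l$ (left coprime)'' means $\Theta_l\in H^\infty_{M_n}$ is inner, $A_l\in H^2_{M_n}$, and $\Theta_l,A_l$ are left coprime. $\mathcal H(\Theta):=H^2_{\mathbb C^n}\ominus\Theta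 H^2_{\mathbb C^n}$. *)

(* Defs.v *)
From HB Require Import structures.
From mathcomp Require Import all_boot all_order all_algebra.
From mathcomp Require Import sesquilinear.
From mathcomp Require Import all_classical all_reals all_analysis.
From mathcomp Require Import complex.

Set Implicit Arguments.
Unset Strict Implicit.
Unset Printing Implicit Defensive.

Import Order.TTheory GRing.Theory Num.Theory.
Import numFieldNormedType.Exports.

Local Open Scope classical_set_scope.
Local Open Scope ring_scope.
Local Open Scope complex_scope.
Local Open Scope sesquilinear_scope.
Local Open Scope card_scope.

(* Functions on the unit circle T are represented by total functions on the
   complex plane R[i], of which only the values on T are ever used; T carries
   the normalized arc length dt / (2 pi), parametrized by t |-> e^(it) on
   [-pi, pi].  Elements of L^2, L^oo, H^2, H^oo are thus representatives, and
   equality of such functions is equality almost everywhere on T. *)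

Section CircleMeasure.
Variable R : realType.
Local Notation C := R[i].
Local Notation mu := (@lebesgue_measure R).

Definition expi (t : R) : C := cos t +i* sin t.

Definition angles : set R := `[- pi, pi]%classic.

Definition aeT (P : C -> Prop) : Prop :=
  {ae mu, forall t, angles t -> P (expi t)}.

Definition measurable_circle (f : C -> C) : Prop :=
  measurable_fun angles (fun t => complex.Re (f (expi t))) /\
  measurable_fun angles (fun t => complex.Im (f (expi t))).

Definition intT (f : C -> C) : C :=
  (Rintegral mu angles (fun t => complex.Re (f (expi t))) / (2 * pi)) +i*
  (Rintegral mu angles (fun t => complex.Im (f (expi t))) / (2 * pi)).

Definition L2 (f : C -> C) : Prop :=
  measurable_circle f /\
  mu.-integrable angles (fun t => (complex.Re (`|f (expi t)| ^+ 2))%:E).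

Definition Linfty (f : C -> C) : Prop :=
  measurable_circle f /\ exists M : R, aeT (fun z => `|f z| <= M%:C).

Definition fourier (f : C -> C) (k : int) : C := intT (fun z => f z * z ^ (- k)).

Definition H2 (f : C -> C) : Prop :=
  L2 f /\ forall k : int, k < 0 -> fourier f k = 0.

Definition Hinfty (f : C -> C) : Prop := Linfty f /\ H2 f.

End CircleMeasure.

Section MatrixFunctions.
Variable R : realType.
Local Notation C := R[i].

Definition H2mx m n (F : C -> 'M[C]_(m, n)) : Prop :=
  forall i j, H2 (fun z => F z i j).

Definition Hinftymx m n (F : C -> 'M[C]_(m, n)) : Prop :=
  forall i j, Hinfty (fun z => F z i j).

Definition adjT m n (F : C -> 'M[C]_(m, n)) : C -> 'M[C]_(n, m) :=
  fun z => (F z)^t*.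

Definition tildeT m n (F : C -> 'M[C]_(m, n)) : C -> 'M[C]_(n, m) :=
  fun z => (F (Num.conj z))^t*.

Definition bounded_type m n (F : C -> 'M[C]_(m, n)) : Prop :=
  forall i j, exists a b : C -> C,
    [/\ Hinfty a, Hinfty b & aeT (fun z => b z != 0 /\ F z i j = a z / b z)].

Definition inner_fun n m (D : C -> 'M[C]_(n, m)) : Prop :=
  Hinftymx D /\ aeT (fun z => (D z)^t* *m D z = 1%:M).

Definition left_inner_divisor n m r
    (D : C -> 'M[C]_(n, m)) (F : C -> 'M[C]_(n, r)) : Prop :=
  inner_fun D /\
  exists2 G : C -> 'M[C]_(m, r), H2mx G & aeT (fun z => F z = D z *m G z).

(* The two equations on U force m = n. *)
Definition unitary_constant n m (D : C -> 'M[C]_(n, m)) : Prop :=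
  exists U : 'M[C]_(n, m),
    [/\ U^t* *m U = 1%:M, U *m U^t* = 1%:M & aeT (fun z => D z = U)].

Definition left_coprime n r s
    (F : C -> 'M[C]_(n, r)) (G : C -> 'M[C]_(n, s)) : Prop :=
  forall m (D : C -> 'M[C]_(n, m)),
    left_inner_divisor D F -> left_inner_divisor D G -> unitary_constant D.

Definition right_coprime n r s
    (F : C -> 'M[C]_(r, n)) (G : C -> 'M[C]_(s, n)) : Prop :=
  left_coprime (tildeT F) (tildeT G).

Definition right_coprime_factorization n (F Theta A : C -> 'M[C]_n) : Prop :=
  [/\ inner_fun Theta, H2mx A, aeT (fun z => F z = Theta z *m (A z)^t*)
    & right_coprime Theta A].

Definition left_coprime_factorization n (F A Theta : C -> 'M[C]_n) : Prop :=
  [/\ inner_fun Theta, H2mx A, aeT (fun z => F z = (A z)^t* *m Theta z)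
    & left_coprime Theta A].

End MatrixFunctions.

Section HilbertDimension.
Variable R : realType.
Local Notation C := R[i].

Definition dotT n (f g : C -> 'cV[C]_n) : C :=
  intT (fun z => \sum_(i < n) f z i 0 * Num.conj (g z i 0)).

(* H(Theta) = H^2 (-) Theta H^2 *)
Definition model_space n (Theta : C -> 'M[C]_n) : set (C -> 'cV[C]_n) :=
  [set f | H2mx f /\
    forall g : C -> 'cV[C]_n, H2mx g -> dotT f (fun z => Theta z *m g z) = 0].

(* Two representatives of the same class have inner product 1 when one of them
   has norm 1, so distinct elements of B belong to distinct classes. *)
Definition orthonormal_set n (B : set (C -> 'cV[C]_n)) : Prop :=
  (forall f, B f -> dotT f f = 1) /\
  (forall f g, B f -> B g -> f <> g -> dotT f g = 0).

Definition orthonormal_basis n (X B : set (C -> 'cV[C]_n)) : Prop :=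
  [/\ B `<=` X, orthonormal_set B &
    forall f, X f -> (forall b, B b -> dotT f b = 0) -> aeT (fun z => f z = 0)].

(* The Hilbert space dimension is the cardinality of an orthonormal basis. *)
Definition same_dim m n
    (X : set (C -> 'cV[C]_m)) (Y : set (C -> 'cV[C]_n)) : Prop :=
  exists B D, [/\ orthonormal_basis X B, orthonormal_basis Y D & B #= D].

End HilbertDimension.

(* Main.v *)
Require Import Defs.
From mathcomp Require Import all_boot all_order all_algebra.
From mathcomp Require Import sesquilinear spectral.
From mathcomp Require Import all_classical all_reals all_analysis.
From mathcomp Require Import measurable_realfun simple_functions.
From mathcomp Require Import complex.
From mathcomp Require Import ring lra.

(* The symbol [Phi] yields the block Hankel matrix with entries
   [conj (Phi_(j+k+1))]; that of [tilde Phi] is its conjugate transpose, so both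
   have the same rank.  Write [Phi = A^* Theta] with [Theta], [A] left coprime.
   The projections [Theta P_-(Phi^* z^j e_i)] of the vectors [z^j A e_i] to
   [H(Theta)] span a space [E] whose dimension is this rank.  If [E] is finite
   dimensional, put [W = Theta C^n + E]; then [z E] is contained in [W] with
   codimension [n], and an orthonormal basis of the complement of [z E] in [W]
   gives the columns of an inner function [Delta] that divides both [Theta] and
   [A].  By coprimeness [Delta] is a unitary constant, which forces
   [E = H(Theta)].  Hence [dim H(Theta)] is finite exactly when the rank is, and
   then equals it; otherwise it is countably infinite.  Applied to [Theta_l] and,
   through [tilde Phi], to [tilde Theta_r], this leaves the unitary map
   [f |-> conj z Theta(z) f(conj z)] from [H(tilde Theta)] onto [H(Theta)].

   Neither completeness of [L^2] nor the Beurling-Lax theorem is needed: all the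
   projections involved are explicit, because [Theta^*] and [Phi^*] are
   antianalytic. *)

Set Implicit Arguments.
Unset Strict Implicit.
Unset Printing Implicit Defensive.

Import Order.TTheory GRing.Theory Num.Theory.
Import numFieldNormedType.Exports.
Import HBNNSimple.

Local Open Scope classical_set_scope.
Local Open Scope ring_scope.
Local Open Scope complex_scope.

(** * Integration on the circle *)

(** For finite dimensional [E], put [M = Theta H^2 + E], the shift-invariant space generated by the
    columns of [Theta] and [A]. The complement of [z E] in [W] is [M] minus [z M], the wandering
    subspace of [M], so [Delta] is its Beurling-Lax function; finite dimension reduces the
    construction to completing [s] orthonormal rows of length [n + s].

    No rank is ever defined. Two families live in [H(Theta)]: the backward shifts of the columns of
    [Theta], which are always total, and the Hankel vectors. Their mutual inner products are the
    Hankel entries, which depend on [Phi] alone, so a bound [d] on one model space passes through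
    the matrix to the other. Dimension occurs only as the length of Gram-Schmidt lists, and the set
    of all [m] exceeded by some length covers the finite and the infinite case at once.

    Vectors are representatives and not classes, hence membership in a span is expressed by inner
    products with all [y]. Two facts carry the analysis: an [L1] function with zero Fourier
    coefficients vanishes a.e., and the product of an [H2] function with an [H2] function of mean 0
    has mean 0. *)

Section CircleIntegral.
Variable R : realType.
Local Notation C := R[i].
Local Notation mu := (@lebesgue_measure R).
Local Notation I := (@angles R).
Local Notation reT f := (fun t : R => complex.Re (f (expi t))).
Local Notation imT f := (fun t : R => complex.Im (f (expi t))).
Implicit Types f g : C -> C.

Let aeF : Filter (almost_everywhere mu) := ae_filter_ringOfSetsType mu.

(** Componentwise, because [intT] integrates the real and imaginary parts separately. *)
Definition L1 f : Prop :=
  mu.-integrable I (EFin \o reT f) /\ mu.-integrable I (EFin \o imT f).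

Lemma measurable_angles : measurable I.
Proof. exact: measurable_itv. Qed.

Lemma angles_lty : (mu I < +oo)%E.
Proof. by rewrite /angles lebesgue_measure_itv /=; case: ifP => // _; rewrite ltry. Qed.

Lemma complexReD (x y : C) : complex.Re (x + y) = complex.Re x + complex.Re y.
Proof. by case: x y => a b [c d]. Qed.

Lemma complexImD (x y : C) : complex.Im (x + y) = complex.Im x + complex.Im y.
Proof. by case: x y => a b [c d]. Qed.

Lemma complexReM (x y : C) : complex.Re (x * y) =
  complex.Re x * complex.Re y - complex.Im x * complex.Im y.
Proof. by case: x y => a b [c d]. Qed.

Lemma complexImM (x y : C) : complex.Im (x * y) =
  complex.Re x * complex.Im y + complex.Im x * complex.Re y.
Proof. by case: x y => a b [c d]. Qed.

Lemma complexReJ (x : C) : complex.Re (Num.conj x) = complex.Re x.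
Proof. by case: x. Qed.

Lemma complexImJ (x : C) : complex.Im (Num.conj x) = - complex.Im x.
Proof. by case: x. Qed.

Lemma Re_sqr_norm (x : C) :
  complex.Re (`|x| ^+ 2) = complex.Re x ^+ 2 + complex.Im x ^+ 2.
Proof. by rewrite -add_Re2_Im2. Qed.

Lemma normrJ (x : C) : `|Num.conj x| = `|x|.
Proof. exact: normcJ. Qed.

Lemma expi_neq0 (t : R) : expi t != 0 :> C.
Proof.
rewrite eq_complex /=; apply/negP => /andP[/eqP c0 /eqP s0].
by have := cos2Dsin2 t; rewrite c0 s0 expr0n addr0 => /eqP; rewrite eq_sym oner_eq0.
Qed.

Lemma conj_expi (t : R) : Num.conj (expi t) = (expi t)^-1 :> C.
Proof.
apply: (mulfI (expi_neq0 t)); rewrite divff ?expi_neq0//.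
apply/eqP; rewrite eq_complex /= mulrN opprK -!expr2 cos2Dsin2.
by rewrite eqxx /= mulrN mulrC addNr.
Qed.

Lemma norm_expi (t : R) : `|expi t| = 1 :> C.
Proof. by rewrite normc_def /= cos2Dsin2 sqrtr1. Qed.

Lemma conj_expiX (t : R) (k : int) :
  Num.conj (expi t ^ k) = (expi t ^ (- k) : C).
Proof. by rewrite fmorphXz -exprz_inv; congr (_ ^ _); exact: conj_expi. Qed.

Lemma expiN (t : R) : expi (- t) = Num.conj (expi t) :> C.
Proof. by apply/eqP; rewrite eq_complex /= cosN sinN !eqxx. Qed.

Lemma eq_intT f g : (forall t, f (expi t) = g (expi t)) -> intT f = intT g.
Proof. by move=> fg; congr (_ +i* _); congr (_ / _); apply: eq_Rintegral => t _ /=;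
  rewrite fg. Qed.

Lemma integrable_ext (u v : R -> R) : (forall t, u t = v t) ->
  mu.-integrable I (EFin \o u) -> mu.-integrable I (EFin \o v).
Proof. by move=> /funext ->. Qed.

Lemma eq_L1 f g : (forall t, f (expi t) = g (expi t)) -> L1 f -> L1 g.
Proof.
by move=> fg []; split; [apply: integrable_ext a|apply: integrable_ext b] => t; rewrite fg.
Qed.

Lemma L1_measurable f : L1 f -> measurable_circle f.
Proof.
by case=> /(@measurable_int _ _ _ _ _)/measurable_EFinP ?
  /(@measurable_int _ _ _ _ _)/measurable_EFinP.
Qed.

Lemma integrable_scale (k : R) (u : R -> R) : mu.-integrable I (EFin \o u) ->
  mu.-integrable I (EFin \o (fun t => k * u t)).
Proof. exact: (@integrableZl _ _ _ mu _ measurable_angles k). Qed.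

Lemma integrable_add (u v : R -> R) : mu.-integrable I (EFin \o u) ->
  mu.-integrable I (EFin \o v) -> mu.-integrable I (EFin \o (fun t => u t + v t)).
Proof. exact: (@integrableD _ _ _ mu _ measurable_angles). Qed.

Lemma L1D f g : L1 f -> L1 g -> L1 (fun z => f z + g z).
Proof.
case=> f1 f2 [g1 g2]; split.
- by apply: integrable_ext (integrable_add f1 g1) => t; rewrite complexReD.
- by apply: integrable_ext (integrable_add f2 g2) => t; rewrite complexImD.
Qed.

Lemma intTD f g : L1 f -> L1 g -> intT (fun z => f z + g z) = intT f + intT g.
Proof.
case=> f1 f2 [g1 g2]; rewrite /intT.
under eq_Rintegral do rewrite complexReD.
under [X in _ +i* (X / _) = _]eq_Rintegral do rewrite complexImD.
rewrite !RintegralD ?mulrDl //; exact: measurable_angles.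
Qed.

Lemma L1Z c f : L1 f -> L1 (fun z => c * f z).
Proof.
case: c => a b [f1 f2]; split.
- apply: integrable_ext (integrable_add (integrable_scale a f1) (integrable_scale (- b) f2)) => t.
  by rewrite complexReM mulNr.
- apply: integrable_ext (integrable_add (integrable_scale a f2) (integrable_scale b f1)) => t.
  by rewrite complexImM.
Qed.

Lemma intTZ c f : L1 f -> intT (fun z => c * f z) = c * intT f.
Proof.
case: c => a b [f1 f2]; have mI := measurable_angles; rewrite /intT.
under eq_Rintegral do rewrite complexReM.
under [X in _ +i* (X / _) = _]eq_Rintegral do rewrite complexImM.
rewrite RintegralB ?RintegralD ?RintegralZl //; try exact: integrable_scale.
by apply/eqP; rewrite eq_complex /=; apply/andP; split; apply/eqP; ring.
Qed.

Lemma L1_conj f : L1 f -> L1 (fun z => Num.conj (f z)).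
Proof.
case=> f1 f2; split.
- by apply: integrable_ext f1 => t /=; rewrite complexReJ.
- by apply: integrable_ext (integrable_scale (-1) f2) => t /=; rewrite complexImJ mulN1r.
Qed.

Lemma intT_conj f : L1 f -> intT (fun z => Num.conj (f z)) = Num.conj (intT f).
Proof.
case=> f1 f2; have mI := measurable_angles; rewrite /intT.
under eq_Rintegral do rewrite complexReJ.
under [X in _ +i* (X / _) = _]eq_Rintegral do rewrite complexImJ -mulN1r.
rewrite RintegralZl //.
by apply/eqP; rewrite eq_complex /= eqxx /= mulN1r mulNr.
Qed.

Lemma integrable_bounded (u : R -> R) (M : R) : measurable_fun I u ->
  (forall t, I t -> `|u t| <= M) -> mu.-integrable I (EFin \o u).
Proof.
move=> mf uM; apply: measurable_bounded_integrable => //.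
- exact: measurable_angles.
- exact: angles_lty.
- exists M; split; first exact: num_real.
  by move=> x Mx t It; apply: le_trans (ltW Mx); exact: uM.
Qed.

Lemma L1_0 : L1 (fun=> 0).
Proof.
have h : mu.-integrable I (EFin \o (fun=> 0 : R)).
  by apply: (@integrable_bounded _ 0) => // t _; rewrite normr0.
by split; apply: integrable_ext h.
Qed.

Lemma intT0 : intT (fun=> 0 : C) = 0.
Proof.
rewrite -[RHS](mul0r (intT (fun=> 0))) -intTZ; last exact: L1_0.
by apply: eq_intT => t; rewrite mul0r.
Qed.

Lemma L1_sum (J : Type) (s : seq J) (F : J -> C -> C) :
  (forall j, L1 (F j)) -> L1 (fun z => \sum_(j <- s) F j z).
Proof.
move=> h; elim: s => [|j s ih].
  by apply: eq_L1 L1_0 => t; rewrite big_nil.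
by apply: eq_L1 (L1D (h j) ih) => t; rewrite /= big_cons.
Qed.

Lemma intT_sum (J : Type) (s : seq J) (F : J -> C -> C) :
  (forall j, L1 (F j)) ->
  intT (fun z => \sum_(j <- s) F j z) = \sum_(j <- s) intT (F j).
Proof.
move=> h; elim: s => [|j s ih].
  by rewrite big_nil -[RHS]intT0; apply: eq_intT => t; rewrite big_nil.
rewrite big_cons -ih -intTD //; last exact: L1_sum.
by apply: eq_intT => t; rewrite big_cons.
Qed.

Lemma aeT_intT f g : measurable_circle f -> measurable_circle g ->
  aeT (fun z => f z = g z) -> intT f = intT g.
Proof.
case=> mf1 mf2 [mg1 mg2] fg; congr (_ +i* _); congr (_ / _); congr fine;
  apply: ae_eq_integral; try exact: measurable_angles; try exact/measurable_EFinP.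
- by apply: (@filterS _ _ aeF _ _ _ fg) => t h It /=; rewrite h.
- by apply: (@filterS _ _ aeF _ _ _ fg) => t h It /=; rewrite h.
Qed.

Lemma aeT_and (P Q : C -> Prop) : aeT P -> aeT Q -> aeT (fun z => P z /\ Q z).
Proof.
move=> p q; rewrite /aeT; apply: (@filterS2 _ _ aeF _ _ _ _ p q) => t hp hq It.
by split; [exact: hp|exact: hq].
Qed.

Lemma aeTS (P Q : C -> Prop) : (forall t, P (expi t) -> Q (expi t)) -> aeT P -> aeT Q.
Proof. by move=> h; rewrite /aeT; apply: (@filterS _ _ aeF) => t /[apply]; exact: h. Qed.

Lemma aeTT (P : C -> Prop) : (forall t, P (expi t)) -> aeT P.
Proof. by move=> h; apply: aeW => t _. Qed.

Lemma aeT_forall (J : finType) (P : J -> C -> Prop) :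
  (forall j, aeT (P j)) -> aeT (fun z => forall j, P j z).
Proof.
move=> h.
have : aeT (fun z => forall j, j \in enum J -> P j z).
  elim: (enum J) => [|j s ih]; first by apply: aeTT.
  apply: aeTS (aeT_and (h j) ih) => t [pj ps] k.
  by rewrite inE => /orP[/eqP ->|/ps].
by apply: aeTS => t H j; apply: H; rewrite mem_enum.
Qed.

End CircleIntegral.

(** * Bounded and square integrable functions on the circle *)

Section CircleSpaces.
Variable R : realType.
Local Notation C := R[i].
Local Notation mu := (@lebesgue_measure R).
Local Notation I := (@angles R).
Implicit Types f g : C -> C.

Let aeF : Filter (almost_everywhere mu) := ae_filter_ringOfSetsType mu.

Lemma normC_le_Re (x : C) (r : R) : `|x| <= r%:C ->
  `|complex.Re x| <= r /\ `|complex.Im x| <= r.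
Proof.
move=> xr; split.
- by have := le_trans (normc_ge_Re x) xr; rewrite lecR.
- have := normc_ge_Re (x * 'i); rewrite ReiNIm normrN normrM normCi mulr1.
  by move=> /le_trans/(_ xr); rewrite lecR.
Qed.

Lemma normC_real (x : C) : `|x| = (complex.Re `|x|)%:C.
Proof. by rewrite RRe_real // normr_real. Qed.

Lemma Re_norm_sqr (x : C) : complex.Re (`|x| ^+ 2) = complex.Re `|x| ^+ 2.
Proof. by rewrite [in LHS]normC_real -rmorphXn. Qed.

Lemma Re_norm_ge0 (x : C) : 0 <= complex.Re `|x|.
Proof. by rewrite -ler0c -normC_real. Qed.

Lemma Re_normM (x y : C) : complex.Re `|x * y| = complex.Re `|x| * complex.Re `|y|.
Proof. by apply: (@complexI R); rewrite rmorphM -!normC_real normrM. Qed.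

Lemma integrable_ae_dom (u v : R -> R) : measurable_fun I u ->
  {ae mu, forall t, I t -> `|u t| <= v t} ->
  mu.-integrable I (EFin \o v) -> mu.-integrable I (EFin \o u).
Proof.
move=> mf uv iv; apply/integrableP; split; first exact/measurable_EFinP.
have /integrableP[mv] := iv; apply: le_lt_trans.
apply: ae_ge0_le_integral => //.
- exact: measurable_angles.
- by apply: measurableT_comp => //; exact/measurable_EFinP.
- exact: measurableT_comp.
- apply: (@filterS _ _ aeF _ _ _ uv) => t h It /=; rewrite lee_fin.
  exact: le_trans (h It) (ler_norm _).
Qed.

Lemma L1_dom f (v : R -> R) : measurable_circle f ->
  mu.-integrable I (EFin \o v) ->
  {ae mu, forall t, I t -> `|f (expi t)| <= (v t)%:C} -> L1 f.
Proof.
move=> [m1 m2] iv h; split; apply: integrable_ae_dom iv => //.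
- by apply: (@filterS _ _ aeF _ _ _ h) => t /[apply] /normC_le_Re[].
- by apply: (@filterS _ _ aeF _ _ _ h) => t /[apply] /normC_le_Re[].
Qed.

Lemma measurable_circleD f g : measurable_circle f -> measurable_circle g ->
  measurable_circle (fun z => f z + g z).
Proof.
case=> f1 f2 [g1 g2]; split.
- by under eq_fun do rewrite complexReD; exact: measurable_funD.
- by under eq_fun do rewrite complexImD; exact: measurable_funD.
Qed.

Lemma measurable_circleM f g : measurable_circle f -> measurable_circle g ->
  measurable_circle (fun z => f z * g z).
Proof.
case=> f1 f2 [g1 g2]; split.
- by under eq_fun do rewrite complexReM; apply: measurable_funB; exact: measurable_funM.
- by under eq_fun do rewrite complexImM; apply: measurable_funD; exact: measurable_funM.
Qed.

Lemma measurable_circle_cst (c : C) : measurable_circle (fun=> c).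
Proof. by split; exact: measurable_cst. Qed.

Lemma measurable_circle_conj f : measurable_circle f ->
  measurable_circle (fun z => Num.conj (f z)).
Proof.
case=> f1 f2; split.
- by under eq_fun do rewrite complexReJ.
- by under eq_fun do rewrite complexImJ; exact: measurableT_comp.
Qed.

Lemma expiD (s t : R) : expi (s + t) = expi s * expi t :> C.
Proof.
by apply/eqP; rewrite eq_complex /= cosD sinD eqxx /= addrC [X in X + _]mulrC mulrC.
Qed.

Lemma expiX (t : R) (k : int) : expi t ^ k = expi (k%:~R * t) :> C.
Proof.
have nat_case (n : nat) s : expi s ^ n = expi (n%:R * s) :> C.
  elim: n => [|n ih].
    by rewrite expr0z mul0r /expi cos0 sin0.
  by rewrite exprSz ih -expiD -[in RHS]natr1 mulrDl mul1r addrC.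
case: k => n; first exact: nat_case.
rewrite NegzE -exprz_inv -conj_expi -expiN nat_case.
by rewrite mulrNz mulNr mulrN.
Qed.

Lemma measurable_circle_pow (k : int) : measurable_circle (fun z : C => z ^ k).
Proof.
have mk : measurable_fun I (fun t : R => k%:~R * t).
  by apply: measurable_funTS; exact: mulrl_measurable.
split.
- under eq_fun do rewrite expiX /=.
  by apply: (measurableT_comp _ mk); apply: continuous_measurable_fun; exact: continuous_cos.
- under eq_fun do rewrite expiX /=.
  by apply: (measurableT_comp _ mk); apply: continuous_measurable_fun; exact: continuous_sin.
Qed.

Lemma Linfty_pow (k : int) : Linfty (fun z : C => z ^ k).
Proof.
split; first exact: measurable_circle_pow.
by exists 1; apply: aeTT => t; rewrite expiX norm_expi.
Qed.

Lemma Linfty_cst (c : C) : Linfty (fun=> c).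
Proof.
split; first exact: measurable_circle_cst.
by exists (complex.Re `|c|); apply: aeTT => t; rewrite -normC_real.
Qed.

Lemma Linfty_conj f : Linfty f -> Linfty (fun z => Num.conj (f z)).
Proof.
case=> mf [M fM]; split; first exact: measurable_circle_conj.
by exists M; apply: aeTS fM => t; rewrite normrJ.
Qed.

Lemma LinftyM f g : Linfty f -> Linfty g -> Linfty (fun z => f z * g z).
Proof.
case=> mf [M fM] [mg [N gN]]; split; first exact: measurable_circleM.
exists (M * N); apply: aeTS (aeT_and fM gN) => t [h1 h2].
by rewrite normrM rmorphM ler_pM.
Qed.

Lemma LinftyD f g : Linfty f -> Linfty g -> Linfty (fun z => f z + g z).
Proof.
case=> mf [M fM] [mg [N gN]]; split; first exact: measurable_circleD.
exists (M + N); apply: aeTS (aeT_and fM gN) => t [h1 h2].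
by rewrite rmorphD; apply: le_trans (ler_normD _ _) _; exact: lerD.
Qed.

Lemma L1M_Linfty f g : L1 f -> Linfty g -> L1 (fun z => f z * g z).
Proof.
move=> lf [mg [M gM]]; have [f1 f2] := lf.
apply: (@L1_dom _ (fun t => M * (`|complex.Re (f (expi t))| + `|complex.Im (f (expi t))|))).
- by apply: measurable_circleM => //; exact: L1_measurable.
- apply: integrable_scale; apply: integrable_add; exact: (@integrable_norm _ _ _ mu).
- apply: (@filterS _ _ aeF _ _ _ gM) => t h It; rewrite normrM mulrC rmorphM ler_pM //.
  + exact: h.
  + rewrite [X in `|X| <= _]complexE rmorphD; apply: le_trans (ler_normD _ _) _.
    by rewrite normrM complexiE normCi mul1r !normc_def /= !expr0n !addr0 !sqrtr_sqr.
Qed.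

Lemma L2_measurable f : L2 f -> measurable_circle f.
Proof. by case. Qed.

Lemma L2_dom f (v : R -> R) : measurable_circle f ->
  mu.-integrable I (EFin \o v) ->
  {ae mu, forall t, I t -> complex.Re (`|f (expi t)| ^+ 2) <= v t} -> L2 f.
Proof.
move=> mf iv h; split => //.
have [m1 m2] := mf.
have ms : measurable_fun I (fun t : R => complex.Re (`|f (expi t)| ^+ 2)).
  by under eq_fun do rewrite Re_sqr_norm; apply: measurable_funD; exact: measurable_funX.
apply: (integrable_ae_dom ms _ iv).
apply: (@filterS _ _ aeF _ _ _ h) => t /[apply] ht.
have h0 : 0 <= complex.Re (`|f (expi t)| ^+ 2) by rewrite Re_norm_sqr sqr_ge0.
by rewrite (ger0_norm h0).
Qed.

Lemma L2M f g : L2 f -> L2 g -> L1 (fun z => f z * g z).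
Proof.
move=> [mf lf] [mg lg].
apply: (@L1_dom _ (fun t => 2^-1 * (complex.Re (`|f (expi t)| ^+ 2)
                                   + complex.Re (`|g (expi t)| ^+ 2)))).
- exact: measurable_circleM.
- by apply: integrable_scale; exact: integrable_add.
- apply: aeW => t _; rewrite !Re_norm_sqr normrM (normC_real (f _)) (normC_real (g _)).
  rewrite -rmorphM lecR.
  have := sqr_ge0 (complex.Re `|f (expi t)| - complex.Re `|g (expi t)|).
  by move: (complex.Re _) (complex.Re _) => a b; nra.
Qed.

Lemma L2D f g : L2 f -> L2 g -> L2 (fun z => f z + g z).
Proof.
move=> [mf lf] [mg lg].
apply: (@L2_dom _ (fun t => 2 * (complex.Re (`|f (expi t)| ^+ 2)
                                   + complex.Re (`|g (expi t)| ^+ 2)))).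
- exact: measurable_circleD.
- by apply: integrable_scale; exact: integrable_add.
- apply: aeW => t _; rewrite !Re_sqr_norm complexReD complexImD.
  set a := complex.Re _; set b := complex.Re _; set c := complex.Im _; set d := complex.Im _.
  have := sqr_ge0 (a - b); have := sqr_ge0 (c - d); nra.
Qed.

Lemma L2_conj f : L2 f -> L2 (fun z => Num.conj (f z)).
Proof.
case=> mf lf; split; first exact: measurable_circle_conj.
by apply: integrable_ext lf => t; rewrite normrJ.
Qed.

Lemma L2M_Linfty f g : L2 f -> Linfty g -> L2 (fun z => f z * g z).
Proof.
move=> [mf lf] [mg [M gM]].
apply: (@L2_dom _ (fun t => M ^+ 2 * complex.Re (`|f (expi t)| ^+ 2))).
- exact: measurable_circleM.
- exact: integrable_scale.
- apply: (@filterS _ _ aeF _ _ _ gM) => t /[apply] h.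
  rewrite !Re_norm_sqr Re_normM; move: h; rewrite (normC_real (g _)) lecR => h.
  by rewrite exprMn mulrC ler_wpM2r ?sqr_ge0 // lerXn2r ?nnegrE ?Re_norm_ge0 // (le_trans
    (Re_norm_ge0 _) h).
Qed.

Lemma Linfty_L2 f : Linfty f -> L2 f.
Proof.
case=> mf [M fM]; apply: (@L2_dom _ (fun=> M ^+ 2)) => //.
  by apply: (@integrable_bounded _ _ `|M ^+ 2|).
apply: (@filterS _ _ aeF _ _ _ fM) => t /[apply] h.
move: h; rewrite (normC_real (f _)) lecR Re_norm_sqr => h.
by rewrite lerXn2r ?nnegrE ?Re_norm_ge0 // (le_trans (Re_norm_ge0 _) h).
Qed.

Lemma L2_cst (c : C) : L2 (fun=> c).
Proof. exact/Linfty_L2/Linfty_cst. Qed.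

Lemma L2_pow (k : int) : L2 (fun z : C => z ^ k).
Proof. exact/Linfty_L2/Linfty_pow. Qed.

Lemma L2Z c f : L2 f -> L2 (fun z => c * f z).
Proof.
move=> lf; under eq_fun do rewrite mulrC.
by apply: L2M_Linfty => //; exact: Linfty_cst.
Qed.

Lemma L2_L1 f : L2 f -> L1 f.
Proof. by move=> lf; apply: eq_L1 (L2M lf (L2_cst 1)) => t; rewrite mulr1. Qed.

Lemma L2_sum (J : Type) (s : seq J) (F : J -> C -> C) :
  (forall j, L2 (F j)) -> L2 (fun z => \sum_(j <- s) F j z).
Proof.
move=> h; elim: s => [|j s ih].
  by under eq_fun do rewrite big_nil; exact: L2_cst.
by under eq_fun do rewrite big_cons; exact: L2D.
Qed.

Lemma intT_sqr_ge0 f : L2 f -> 0 <= intT (fun z => f z * Num.conj (f z)).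
Proof.
move=> lf; rewrite lecE /=; apply/andP; split.
  rewrite (@eq_Rintegral _ _ _ _ _ (cst 0)); last first.
    by move=> t _ /=; case: (f _) => a b /=; rewrite mulrN mulrC addNr.
  by rewrite Rintegral_cst ?mul0r ?mul0r //; exact: measurable_angles.
rewrite divr_ge0 ?mulr_ge0 ?pi_ge0 // Rintegral_ge0 // => t _.
by case: (f _) => a b /=; rewrite mulrN opprK -!expr2 addr_ge0 ?sqr_ge0.
Qed.

Lemma intT_sqr_eq0 f : L2 f -> intT (fun z => f z * Num.conj (f z)) = 0 ->
  aeT (fun z => f z = 0).
Proof.
move=> [mf lf] /(congr1 (@complex.Re R)) /= /eqP.
rewrite mulf_eq0 invr_eq0 mulf_eq0 pnatr_eq0 /= (gt_eqF (pi_gt0 R)) orbF => /eqP.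
under eq_Rintegral do rewrite -sqr_normc.
move=> h0; have mI := @measurable_angles R.
have h1 : (\int[mu]_(t in I) `|(complex.Re (`|f (expi t)| ^+ 2))%:E| = 0)%E.
  under eq_integral do rewrite Re_norm_sqr gee0_abs ?lee_fin ?sqr_ge0 //.
  move: h0; rewrite /Rintegral; under eq_integral do rewrite Re_norm_sqr.
  move=> h0; rewrite -[LHS]fineK ?h0 //.
  have /integrable_fin_num := lf; under eq_integral do rewrite Re_norm_sqr.
  exact.
move/(ae_eq_integral_abs mu mI) : h1 => h1.
have /measurable_int mlf := lf.
apply: (@filterS _ _ aeF _ _ _ (h1 mlf)) => t h It.
have /eqP : complex.Re (`|f (expi t)| ^+ 2) = 0 by case: (h It).
rewrite Re_norm_sqr sqrf_eq0 => /eqP n0.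
by apply/eqP; rewrite -normr_eq0 normC_real n0.
Qed.

End CircleSpaces.

(** * Trigonometric polynomials and the monotone class theorem *)

Section TrigPoly.
Variable R : realType.
Local Notation C := R[i].
Local Notation mu := (@lebesgue_measure R).
Local Notation I := (@angles R).

Lemma angles_mu : mu I = (2 * pi)%:E.
Proof.
rewrite /angles lebesgue_measure_itv /= lte_fin ifT.
  by rewrite -EFinB opprK -mulr2n mulr_natl.
by have := pi_gt0 R; lra.
Qed.

Lemma real_complexD (x y : R) : (x + y)%:C = x%:C + y%:C :> C.
Proof. exact: rmorphD. Qed.

Lemma real_complexM (x y : R) : (x * y)%:C = x%:C * y%:C :> C.
Proof. exact: rmorphM. Qed.

Lemma real_complexX (x : R) n : (x ^+ n)%:C = x%:C ^+ n :> C.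
Proof. exact: rmorphXn. Qed.

Lemma FTC2 (f F : R -> R) (a b : R) : a < b ->
  (forall x : R, is_derive x 1 F (f x)) -> continuous f ->
  \int[mu]_(t in `[a, b]) f t = F b - F a.
Proof.
move=> ab dF cf; rewrite /Rintegral (continuous_FTC2 (F := F) ab) //.
- exact: continuous_subspaceT.
- have cF : continuous F.
    by move=> x; apply: differentiable_continuous; apply/derivable1_diffP; case: (dF x).
  split.
  + by move=> x _; case: (dF x).
  + exact: cvg_at_right_filter (cF a).
  + exact: cvg_at_left_filter (cF b).
- by move=> x _; rewrite derive1E; case: (dF x).
Qed.

Lemma expi_pi : expi pi = -1 :> C.
Proof. by apply/eqP; rewrite eq_complex /= cospi sinpi oppr0 !eqxx. Qed.

(** Periodicity at the two ends of [angles]: its imaginary and real parts cancel the boundary terms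
    in the integrals of [cos (k t)] and [sin (k t)]. *)
Lemma expi_pi_int (k : int) : expi (k%:~R * pi) = expi (k%:~R * - pi) :> C.
Proof.
by rewrite -!expiX expiN expi_pi rmorphN rmorph1.
Qed.

Lemma Rintegral_cos_int (k : int) : k != 0 ->
  \int[mu]_(t in I) cos (k%:~R * t) = 0 :> R.
Proof.
move=> k0; have kR : (k%:~R : R) != 0 by rewrite intr_eq0.
have cf : continuous (fun t : R => cos (k%:~R * t)).
  by move=> x; apply: continuous_comp; [exact: mulrl_continuous|exact: continuous_cos].
have dF (x : R) : is_derive x 1 (fun t : R => k%:~R^-1 * sin (k%:~R * t)) (cos (k%:~R * x)).
  apply: is_derive_eq.
  by rewrite /GRing.scale /= mulr1; field.
rewrite (FTC2 _ dF cf).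
- have := congr1 (@complex.Im R) (expi_pi_int k); rewrite /= => ->.
  by rewrite subrr.
- by have := pi_gt0 R; lra.
Qed.

Lemma Rintegral_sin_int (k : int) :
  \int[mu]_(t in I) sin (k%:~R * t) = 0 :> R.
Proof.
have [->|k0] := eqVneq k 0.
  under eq_Rintegral do rewrite mul0r sin0.
  by rewrite Rintegral_cst ?mul0r //; exact: measurable_angles.
have kR : (k%:~R : R) != 0 by rewrite intr_eq0.
have cf : continuous (fun t : R => sin (k%:~R * t)).
  by move=> x; apply: continuous_comp; [exact: mulrl_continuous|exact: continuous_sin].
have dF (x : R) : is_derive x 1 (fun t : R => - (k%:~R^-1 * cos (k%:~R * t))) (sin (k%:~R * x)).
  apply: is_derive_eq.
  by rewrite /GRing.scale /= mulr1; field.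
rewrite (FTC2 _ dF cf).
- have := congr1 (@complex.Re R) (expi_pi_int k); rewrite /= => ->.
  by rewrite subrr.
- by have := pi_gt0 R; lra.
Qed.

Lemma intT_cst (c : C) : intT (fun=> c) = c.
Proof.
have ci (a : R) : \int[mu]_(t in I) a = a * (2 * pi).
  rewrite Rintegral_cst; last exact: measurable_angles.
  by congr (_ * _); exact: (congr1 fine angles_mu).
rewrite /intT !ci; have p0 := pi_gt0 R.
have q0 : 2 * pi != 0 :> R by rewrite gt_eqF // mulr_gt0.
by case: c => a b /=; congr (_ +i* _); rewrite mulfK.
Qed.

Lemma intT_pow (k : int) : intT (fun z : C => z ^ k) = (k == 0)%:R.
Proof.
have [->|k0] := eqVneq k 0.
  by rewrite -[RHS](intT_cst 1); apply: eq_intT => t; rewrite expr0z.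
rewrite /intT; under eq_Rintegral do rewrite expiX /=.
under [X in _ +i* (X / _) = _]eq_Rintegral do rewrite expiX /=.
by rewrite Rintegral_cos_int // Rintegral_sin_int mul0r.
Qed.

(** The form [z^-N p(z)] with a single polynomial reduces closure under sums and products to
    polynomial algebra. *)
Definition laurent (f : C -> C) := exists (N : nat) (p : {poly C}),
  forall t, f (expi t) = (expi t) ^- N * p.[expi t].

Lemma laurent_cst (c : C) : laurent (fun=> c).
Proof. by exists 0%N, c%:P => t; rewrite expr0 invr1 mul1r hornerC. Qed.

Lemma laurentD f g : laurent f -> laurent g -> laurent (fun z => f z + g z).
Proof.
move=> [N [p hp]] [M [q hq]]; exists (N + M)%N, ('X^M * p + 'X^N * q) => t.
have z0 := expf_neq0 _ (expi_neq0 t).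
rewrite hp hq hornerD !hornerM !hornerXn exprD invfM.
by rewrite mulrDr; congr (_ + _); field; rewrite !z0.
Qed.

Lemma laurentM f g : laurent f -> laurent g -> laurent (fun z => f z * g z).
Proof.
move=> [N [p hp]] [M [q hq]]; exists (N + M)%N, (p * q) => t.
by rewrite hp hq hornerM exprD invfM mulrACA.
Qed.

Lemma laurentX f n : laurent f -> laurent (fun z => f z ^+ n).
Proof.
move=> lf; elim: n => [|n ih]; first exact: laurent_cst.
by under eq_fun do rewrite exprS; exact: laurentM.
Qed.

Lemma laurent_pow (k : int) : laurent (fun z => z ^ k).
Proof.
case: k => n; first by exists 0%N, 'X^n => t; rewrite expr0 invr1 mul1r hornerXn.
by exists n.+1, 1 => t; rewrite hornerC mulr1.
Qed.

Lemma laurent_sum f : laurent f -> exists (N : nat) (p : {poly C}),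
  forall t, f (expi t) = \sum_(i < size p) p`_i * expi t ^ (i%:Z - N%:Z).
Proof.
move=> [N [p hp]]; exists N, p => t; rewrite hp horner_coef mulr_sumr.
apply: eq_bigr => i _; rewrite mulrCA; congr (_ * _).
by rewrite expfzDr ?expi_neq0 // mulrC -exprnN.
Qed.

(** Real trigonometric polynomials, seen as the Laurent polynomials that are real on the circle, so
    that they inherit the closure properties of [laurent]. *)
Definition trig (u : R -> R) := exists2 f, laurent f & forall t, (u t)%:C = f (expi t).

Lemma trig_cst (c : R) : trig (fun=> c).
Proof. by exists (fun=> c%:C) => //; exact: laurent_cst. Qed.

Lemma trigD u v : trig u -> trig v -> trig (fun t => u t + v t).
Proof.
move=> [f lf uf] [g lg vg]; exists (fun z => f z + g z); first exact: laurentD.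
by move=> t; rewrite real_complexD uf vg.
Qed.

Lemma trigM u v : trig u -> trig v -> trig (fun t => u t * v t).
Proof.
move=> [f lf uf] [g lg vg]; exists (fun z => f z * g z); first exact: laurentM.
by move=> t; rewrite real_complexM uf vg.
Qed.

Lemma trigX u n : trig u -> trig (fun t => u t ^+ n).
Proof.
move=> [f lf uf]; exists (fun z => f z ^+ n); first exact: laurentX.
by move=> t; rewrite real_complexX uf.
Qed.

Lemma trig_cosB s : trig (fun t => cos (t - s)).
Proof.
exists (fun z => (expi (- s) * z + expi s * z^-1) / 2).
  apply: laurentM; last exact: laurent_cst.
  apply: laurentD; apply: laurentM; try exact: laurent_cst.
    exact: (laurent_pow 1).
  exact: (laurent_pow (-1)).
move=> t; rewrite -conj_expi -[X in _ + X * _]conjCK -expiN -rmorphM -expiD.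
rewrite -[LHS]/((complex.Re (expi (t - s)))%:C) addrC ReJ_add.
by rewrite addrC.
Qed.

Lemma laurent_Linfty f : laurent f -> Linfty f.
Proof.
move=> lf.
have [N [p hp]] := laurent_sum lf.
have h (s : seq 'I_(size p)) : Linfty (fun z : C => \sum_(i <- s) p`_i * z ^ (i%:Z - N%:Z)).
  elim: s => [|i s ih].
    by under eq_fun do rewrite big_nil; exact: Linfty_cst.
  under eq_fun do rewrite big_cons; apply: LinftyD => //.
  by apply: LinftyM; [exact: Linfty_cst|exact: Linfty_pow].
have [hm [M hM]] := h (index_enum _); split; last first.
  by exists M; apply: aeTS hM => t; rewrite -hp.
by case: hm => hm1 hm2; split; [move: hm1|move: hm2]; apply: eq_measurable_fun => t _;
  rewrite -hp.
Qed.

Lemma trig_measurable u : trig u -> measurable_fun I u.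
Proof.
move=> [f lf uf]; have [[m _] _] := laurent_Linfty lf.
by move: m; apply: eq_measurable_fun => t _; rewrite -uf.
Qed.

Lemma laurent_bounded f : laurent f -> exists M : R, forall t, `|f (expi t)| <= M%:C.
Proof.
move=> /laurent_sum[N [p hp]].
exists (complex.Re (\sum_(i < size p) `|p`_i|)) => t.
have -> : (complex.Re (\sum_(i < size p) `|p`_i|))%:C = \sum_(i < size p) `|p`_i|.
  by rewrite RRe_real // ger0_real // sumr_ge0.
rewrite hp; apply: le_trans (ler_norm_sum _ _ _) _.
by apply: ler_sum => i _; rewrite normrM expiX norm_expi mulr1.
Qed.

Lemma trig_bounded u : trig u -> exists M : R, forall t, I t -> `|u t| <= M.
Proof.
move=> [f lf uf]; have [M hM] := laurent_bounded lf; exists M => t _.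
by have := hM t; rewrite -uf => /normC_le_Re[].
Qed.

(** Bernoulli's inequality; the next lemma is its companion from above, by iterating
    [(1 - a) (1 + (n + 1) a) <= 1 + n a]. *)
Lemma oneBX_ge (a : R) n : 0 <= a <= 1 -> 1 - n%:R * a <= (1 - a) ^+ n.
Proof.
move=> /andP[a0 a1]; elim: n => [|n ih]; first by rewrite mul0r subr0 expr0.
rewrite exprS; apply: le_trans (ler_wpM2l _ ih); last by rewrite subr_ge0.
have : 0 <= n%:R :> R by []. rewrite -natr1; nra.
Qed.

Lemma oneBX_le (a : R) n : 0 <= a <= 1 -> (1 - a) ^+ n * (1 + n%:R * a) <= 1.
Proof.
move=> /andP[a0 a1]; elim: n => [|n ih]; first by rewrite mul0r addr0 expr0 mulr1.
apply: le_trans ih; rewrite exprSr -mulrA ler_wpM2l ?exprn_ge0 ?subr_ge0 //.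
have : 0 <= n%:R :> R by []. rewrite -natr1; nra.
Qed.

Lemma geom0 (q : R) : 0 <= q < 1 -> q ^+ n @[n --> \oo] --> 0.
Proof. by move=> /andP[q0 q1]; apply: cvg_expr; rewrite ger0_norm. Qed.

(** The exponent [2^n] puts the threshold at [1/2], since Bernoulli compares the power with
    [1 - (2 y)^n]. With the next lemma this is the Brosowski-Deutsch approximation of a step
    function by polynomials in [y]. *)
Lemma step_cvg1 (y : R) : 0 <= y < 2^-1 -> (1 - y ^+ n) ^+ (2 ^ n) @[n --> \oo] --> (1 : R).
Proof.
move=> /andP[y0 y1].
have yn n : 0 <= y ^+ n <= 1.
  by rewrite exprn_ge0 //= exprn_ile1 //; lra.
apply: (@squeeze_cvgr _ _ _ _ (fun n => 1 - (2 * y) ^+ n) (fun=> 1)).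
- near=> n; apply/andP; split.
    by apply: le_trans (oneBX_ge (2 ^ n) (yn n)); rewrite exprMn natrX.
  have /andP[a b] := yn n.
  by apply: exprn_ile1; lra.
- rewrite -[X in _ --> X]subr0; apply: cvgB; first exact: cvg_cst.
  by apply: geom0; lra.
- exact: cvg_cst.
Unshelve. all: by end_near.
Qed.

Lemma step_cvg0 (y : R) : 2^-1 < y <= 1 -> (1 - y ^+ n) ^+ (2 ^ n) @[n --> \oo] --> (0 : R).
Proof.
move=> /andP[y0 y1].
have yn n : 0 <= y ^+ n <= 1.
  by rewrite exprn_ge0 /= ?exprn_ile1 //; lra.
have y2 : 0 < 2 * y by lra.
apply: (@squeeze_cvgr _ _ _ _ (fun=> 0) (fun n => ((2 * y)^-1) ^+ n)).
- near=> n; apply/andP; split.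
    by have /andP[a b] := yn n; rewrite exprn_ge0 // subr_ge0.
  have := oneBX_le (2 ^ n) (yn n); rewrite natrX -exprMn => h.
  rewrite exprVn -[leRHS]mul1r ler_pdivlMr ?exprn_gt0 //.
  apply: le_trans h; rewrite ler_wpM2l ?lerDr //.
  by have /andP[a b] := yn n; rewrite exprn_ge0 // subr_ge0.
- exact: cvg_cst.
- apply: geom0; rewrite invr_ge0 ltW //= invf_lt1 //; lra.
Unshelve. all: by end_near.
Qed.

Lemma cos_lt_arc (d s : R) : 0 <= d -> d <= pi -> d < `|s| -> `|s| < 2 * pi - d -> cos s < cos d.
Proof.
move=> d0 dpi ds sd; rewrite -[cos s]cos_norm.
have [sp|sp] := leP `|s| pi.
  by rewrite ltr_cos ?in_itv /=; lra.
(* Beyond [pi], the angle [|s|] is reflected to [2 pi - |s|], which lies between [d] and [pi], where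
   [cos] decreases. *)
have e : pi *+ 2 = 2 * pi :> R by rewrite mulr_natl.
by rewrite -cosN -(cosD2pi (- `|s|)) e ltr_cos ?in_itv /=; lra.
Qed.

Lemma cos_gt_arc (d s : R) : d <= pi -> `|s| < d -> cos d < cos s.
Proof.
move=> dpi ds; rewrite -[cos s]cos_norm ltr_cos ?in_itv //= ?normr_ge0 /=; have := normr_ge0 s;
  lra.
Qed.

Let aeF : Filter (almost_everywhere mu) := ae_filter_ringOfSetsType mu.

Lemma ae_neq (a : R) : {ae mu, forall t, t <> a}.
Proof.
exists [set a]; split => //; first exact: lebesgue_measure_set1.
by move=> t /= /contrapT.
Qed.

(* The functions [(1 - y^n)^(2^n)], with [y] an affine function of
   [cos (t - s)], are uniformly bounded trigonometric polynomials converging to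
   the indicator of an arc centred at [s]. *)
Lemma monotone_class (H : (R -> R) -> Prop) :
  (forall u, trig u -> H u) ->
  (forall (c : R) u v, H u -> H v -> H (fun t => u t + c * v t)) ->
  (forall (h : nat -> R -> R) (u : R -> R) (M : R), (forall n, H (h n)) ->
     measurable_fun I u -> (forall t, I t -> `|u t| <= M) ->
     (forall n t, I t -> `|h n t| <= M) ->
     {ae mu, forall t, I t -> h n t @[n --> \oo] --> u t} -> H u) ->
  forall A : set R, measurable A -> H (\1_A).
Proof.
move=> Ht HD Hlim.
have mI := @measurable_angles R.
have H0 : H (fun=> 0) by apply: Ht; exact: trig_cst.
have H1 : H (fun=> 1) by apply: Ht; exact: trig_cst.
have ind1 (A : set R) t : `|\1_A t| <= 1 :> R.
  by rewrite /indic; case: (_ \in _); rewrite ?normr1 ?normr0.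
have mind (A : set R) : measurable A -> measurable_fun I (\1_A : R -> R).
  by move=> mA; apply: measurable_funTS; exact: measurable_indic.
have HU (A B : set R) : A `&` B = set0 -> H \1_A -> H \1_B -> H \1_(A `|` B).
  move=> AB hA hB; have := HD 1 _ _ hA hB; congr (H _); apply/funext => t.
  rewrite mul1r /indic in_setU; have : ~ (A t /\ B t) by move=> ?; have : (A `&` B) t by [];
    rewrite AB.
  have [a|a] := boolP (t \in A); have [b|b] := boolP (t \in B); rewrite ?addr0 ?add0r //.
  by move: a b; rewrite !inE => a b; case.
have rayE : (measurable : set (set R)) = <<s @RGenOInfty.G R >>.
  exact: RGenOInfty.measurableE.
move=> A; rewrite [X in X A -> _]rayE.
apply: (dynkin_induction (P := fun A => H \1_A)).
- exact: RGenOInfty.measurableE.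
- move=> _ _ [x ->] [y ->]; exists (Num.max x y).
  by apply/seteqP; split=> t /=; rewrite !in_itv /= !andbT gt_max => /andP.
- by rewrite indicT.
- move=> _ [x ->].
  have mx : measurable (`]x, +oo[ : set R) by exact: measurable_itv.
  have [xp|xp] := leP pi x.
    apply: (Hlim (fun _ _ => 0) _ 1 _ (mind _ mx)) => // [_ t _|].
      by rewrite normr0.
    apply: aeW => t; rewrite /angles /= in_itv /= => /andP[_ tp].
    rewrite (_ : \1_ _ t = 0); first exact: cvg_cst.
    by rewrite /indic memNset //= in_itv /= andbT; apply/negP; rewrite -leNgt; lra.
  have [xm|xm] := ltP x (- pi).
    apply: (Hlim (fun _ _ => 1) _ 1 _ (mind _ mx)) => // [_ t _|].
      by rewrite normr1.
    apply: aeW => t; rewrite /angles /= in_itv /= => /andP[tm _].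
    rewrite (_ : \1_ _ t = 1); first exact: cvg_cst.
    by rewrite /indic mem_set //= in_itv /= andbT; lra.
  (* The ray meets [angles] in the arc from [x] to [pi], with midpoint [s] and half-length [d]. The
     divisor 4 keeps [y] in [[0, 1]]; inside the arc [y < 1/2], outside [y > 1/2]. *)
  pose d := (pi - x) / 2; pose s := (pi + x) / 2.
  pose y (t : R) := 2^-1 + (cos d - cos (t - s)) / 4.
  have y01 t : 0 <= y t <= 1.
    rewrite /y; have := cos_le1 d; have := cos_geN1 d; have := cos_le1 (t - s);
      have := cos_geN1 (t - s).
    by move=> *; lra.
  have ty : trig y.
    rewrite (_ : y = fun t => (2^-1 + cos d / 4) + - 4^-1 * cos (t - s)); last first.
      by apply/funext => t; rewrite /y; lra.
    apply: trigD (trig_cst _) _; apply: trigM (trig_cst _) (trig_cosB _).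
  apply: (Hlim (fun n t => (1 - y t ^+ n) ^+ (2 ^ n)) _ 1 _ (mind _ mx)) => [n|//|n t _|].
  + apply: Ht; apply: trigX; apply: trigD (trig_cst _) _.
    have := trigM (trig_cst (-1)) (trigX n ty); congr trig; apply/funext => t.
    by rewrite mulN1r.
  + have /andP[a b] := y01 t.
    have h : 0 <= 1 - y t ^+ n <= 1.
      by rewrite subr_ge0 exprn_ile1 //= gerBl exprn_ge0.
    by case/andP: h => h0 h1; rewrite ger0_norm ?exprn_ge0 ?exprn_ile1.
  (* At these three angles [y = 1/2], where the limit is neither 0 nor 1. *)
  + apply: (@filterS3 _ _ aeF _ _ _ _ _ (ae_neq x) (ae_neq pi) (ae_neq (- pi))) => t.
    move=> /eqP tx /eqP tp /eqP tm; rewrite /angles /= in_itv /= => /andP[t1 t2].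
    have [xt|xt] := ltP x t.
      rewrite (_ : \1_ _ t = 1); last by rewrite /indic mem_set //= in_itv /= andbT.
      apply: step_cvg1; have /andP[-> _] := y01 t; rewrite /= /y.
      have : cos d < cos (t - s); last by lra.
      apply: cos_gt_arc; first by rewrite /d; lra.
      by rewrite /s /d ltr_norml; apply/andP; split; lra.
    rewrite (_ : \1_ _ t = 0); last first.
      by rewrite /indic memNset //= in_itv /= andbT; apply/negP; rewrite -leNgt.
    apply: step_cvg0; have /andP[_ ->] := y01 t; rewrite andbT /y.
    have : cos (t - s) < cos d; last by lra.
    have xt' : t < x by lra.
    have e : `|t - s| = s - t by rewrite distrC ger0_norm // /s; lra.
    by apply: cos_lt_arc; rewrite ?e /d /s; lra.
- move=> S mS hS.
  have := HD (-1) _ _ H1 hS; congr H; apply/funext => t.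
  by rewrite mulN1r /indic in_setC; case: (t \in S); rewrite ?subrr ?subr0.
- move=> F mF tF hF.
  pose G n := \bigcup_(i < n) F i.
  have mG n : measurable (G n) by apply: bigcup_measurable.
  have hG n : H \1_(G n).
    elim: n => [|n ih].
      by rewrite /G (_ : \bigcup_(i < 0) F i = set0) ?indic0 //; apply/seteqP; split=> t // [].
    rewrite (_ : G n.+1 = G n `|` F n); last first.
      apply/seteqP; split=> t.
      - case=> i /=; rewrite ltnS leq_eqVlt => /orP[/eqP ->|ltin] Fi; first by right.
        by left; exists i.
      - by case=> [[i /= ltin Fi]|Fn]; [exists i => //=; rewrite ltnW|exists n => /=].
    apply: HU => //.
    apply/seteqP; split=> t // [[i /= ltin Fi] Fn].
    by rewrite (_ : i = n) ?ltnn // in ltin; apply: tF => //; exists t.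
  apply: (Hlim (fun n => \1_(G n)) _ 1) => //.
    by apply: mind; exact: bigcup_measurable.
  apply: aeW => t _; apply: cvg_near_cst.
  have [[k _ Fk]|nF] := pselect ((\bigcup_k F k) t).
    exists k.+1 => // n /= kn.
    by rewrite /indic !mem_set //; [exists k|exists k].
  apply: nearW => n; rewrite /indic !memNset // => -[i _ Fi].
  by apply: nF; exists i.
Qed.

End TrigPoly.

(** * Uniqueness of Fourier coefficients and density of Laurent polynomials *)

Section FourierUniqueness.
Variable R : realType.
Local Notation C := R[i].
Local Notation mu := (@lebesgue_measure R).
Local Notation I := (@angles R).

Implicit Types u v w : R -> R.

Let aeF : Filter (almost_everywhere mu) := ae_filter_ringOfSetsType mu.

Lemma Rdominated_convergence (h : nat -> R -> R) (u g : R -> R) :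
  (forall n, measurable_fun I (h n)) -> measurable_fun I u ->
  mu.-integrable I (EFin \o g) -> (forall n t, I t -> `|h n t| <= g t) ->
  {ae mu, forall t, I t -> h n t @[n --> \oo] --> u t} ->
  mu.-integrable I (EFin \o u) /\
  \int[mu]_(t in I) h n t @[n --> \oo] --> \int[mu]_(t in I) u t.
Proof.
move=> mh mv ig hg cv.
have [||||||iu _ cvi] := @dominated_convergence _ _ _ mu I _ (fun n =>
  EFin \o h n) (EFin \o u) (EFin \o g).
- exact: measurable_angles.
- by move=> n; apply/measurable_EFinP; exact: mh.
- by apply/measurable_EFinP.
- apply: (@filterS _ _ aeF _ _ _ cv) => t /[apply] ht.
  by apply: cvg_EFin => //; exact: nearW.
- exact: ig.
- by apply: aeW => t n It; rewrite lee_fin; exact: hg.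
split=> //; apply: fine_cvg; rewrite fineK; first exact: cvi.
by apply: integrable_fin_num iu; exact: measurable_angles.
Qed.

(** The bounded [u] with [u v] of integral 0 form a class to which [monotone_class] applies, by
    dominated convergence; hence [v] has integral 0 over every measurable subset of [angles]. *)
Lemma ae_eq0_trig (v : R -> R) : mu.-integrable I (EFin \o v) ->
  (forall u, trig u -> \int[mu]_(t in I) (u t * v t) = 0) ->
  {ae mu, forall t, I t -> v t = 0}.
Proof.
move=> iv h; have mI := @measurable_angles R.
have /measurable_int/measurable_EFinP mv := iv.
have iuv (u : R -> R) (M : R) : measurable_fun I u -> (forall t, I t -> `|u t| <= M) ->
    mu.-integrable I (EFin \o (fun t => u t * v t)).
  move=> mu_ uM; apply: (@integrable_ae_dom _ _ (fun t => M * `|v t|)).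
  - exact: measurable_funM.
  - by apply: aeW => t It; rewrite normrM ler_wpM2r // uM.
  - by apply: integrable_scale; exact: (@integrable_norm _ _ _ mu).
pose H u := [/\ measurable_fun I u, (exists M, forall t, I t -> `|u t| <= M)
   & \int[mu]_(t in I) (u t * v t) = 0].
have key A : measurable A -> H \1_A.
  apply: monotone_class => {A}.
  - move=> u tu; split; [exact: trig_measurable| |exact: h].
    exact: trig_bounded.
  - move=> c u w [mu_ [M uM] u0] [mw [N wN] w0]; split.
    + by apply: measurable_funD => //; exact: measurable_funM.
    + exists (M + `|c| * N) => t It; apply: le_trans (ler_normD _ _) _.
      by rewrite normrM lerD ?ler_wpM2l ?uM ?wN.
    + under eq_Rintegral do rewrite mulrDl -mulrA.
      rewrite RintegralD ?RintegralZl ?u0 ?w0 ?mulr0 ?addr0 //.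
      * exact: iuv wN.
      * exact: iuv uM.
      * by apply: integrable_scale; exact: iuv wN.
  - move=> k u M hk mu_ uM kM cv; split => //; first by exists M.
    have [|||||_ cvi] := @Rdominated_convergence (fun n t => k n t * v t) (fun t =>
      u t * v t) (fun t => M * `|v t|).
    + by move=> n; apply: measurable_funM => //; case: (hk n).
    + exact: measurable_funM.
    + by apply: integrable_scale; exact: (@integrable_norm _ _ _ mu).
    + by move=> n t It; rewrite normrM ler_wpM2r // kM.
    + by apply: (@filterS _ _ aeF _ _ _ cv) => t /[apply] ?; exact: cvgMl.
    + apply: (cvg_unique _ cvi) => //.
      rewrite (_ : (fun n => _) = fun=> 0); first exact: cvg_cst.
      by apply/funext => n; case: (hk n).
have h0 E : E `<=` I -> measurable E ->
    (\int[mu]_(t in E) (EFin \o v) t = \int[mu]_(t in E) cst 0 t)%E.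
  move=> EI mE; rewrite [RHS]integral0_eq //.
  have [_ _] := key E mE.
  rewrite -(_ : \int[mu]_(t in I `&` E) v t = \int[mu]_(t in I) (\1_E t * v t)); last first.
    rewrite Rintegral_mkcondr; apply: eq_Rintegral => t _.
    by rewrite patchE /indic; case: ifP => _; rewrite ?mul1r ?mul0r.
  rewrite setIidr // /Rintegral => e0; rewrite -[LHS]fineK ?e0 //.
  by apply: integrable_fin_num => //; apply: integrableS iv.
have := @integral_ae_eq _ _ _ mu I mI (cst 0%E) (EFin \o v) iv (measurable_cst _) h0.
by apply: (@filterS _ _ aeF) => t /[apply] -[].
Qed.

Lemma fourier_uniqueness (f : C -> C) : L1 f -> (forall k, fourier f k = 0) ->
  aeT (fun z => f z = 0).
Proof.
move=> lf f0.
have key p : laurent p -> intT (fun z => p z * f z) = 0.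
  move=> /laurent_sum[N [q hq]].
  rewrite (eq_intT (g := fun z => \sum_(i < size q) q`_i * (f z * z ^ (i%:Z - N%:Z))));
    last first.
    by move=> t; rewrite hq mulr_suml; apply: eq_bigr => i _; ring.
  have l i : L1 (fun z => f z * z ^ (i%:Z - N%:Z)).
    by apply: L1M_Linfty => //; exact: Linfty_pow.
  rewrite intT_sum => [|i]; last by apply: L1Z; exact: l.
  apply: big1 => i _; rewrite intTZ ?l //.
  have := f0 (N%:Z - i%:Z); rewrite /fourier.
  by rewrite opprB => ->; rewrite mulr0.
have [f1 f2] := lf.
have pi2 : 2 * pi != 0 :> R by rewrite gt_eqF // mulr_gt0 // pi_gt0.
(* As [u] is real on the circle, the real part of [intT (p f)] sees only the real part of [f];
   likewise for the imaginary part. *)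
have re u : trig u -> \int[mu]_(t in I) (u t * complex.Re (f (expi t))) = 0.
  move=> [p lp up]; have /(congr1 (@complex.Re R)) /= /eqP := key p lp.
  rewrite mulf_eq0 invr_eq0 (negPf pi2) orbF => /eqP <-.
  by apply: eq_Rintegral => t _; rewrite -up complexReM /= mul0r subr0.
have im u : trig u -> \int[mu]_(t in I) (u t * complex.Im (f (expi t))) = 0.
  move=> [p lp up]; have /(congr1 (@complex.Im R)) /= /eqP := key p lp.
  rewrite mulf_eq0 invr_eq0 (negPf pi2) orbF => /eqP <-.
  by apply: eq_Rintegral => t _; rewrite -up complexImM /= mul0r addr0.
have := ae_eq0_trig f2 im; have := ae_eq0_trig f1 re.
apply: (@filterS2 _ _ aeF) => t h1 h2 It.
by apply/eqP; rewrite eq_complex h1 // h2 // !eqxx.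
Qed.

Definition square_integrable (u : R -> R) := measurable_fun I u /\
  mu.-integrable I (EFin \o (fun t => u t ^+ 2)).

Local Notation N u := (\int[mu]_(t in I) (u t ^+ 2)).

Lemma square_integrable_dom u v : measurable_fun I u -> square_integrable v ->
  (forall t, I t -> `|u t| <= `|v t|) -> square_integrable u.
Proof.
move=> mu_ [mv iv] uv; split=> //; apply: integrable_ae_dom iv.
  exact: measurable_funX.
apply: aeW => t It; rewrite ger0_norm ?sqr_ge0 // -[leLHS]real_normK ?num_real //.
by rewrite -[leRHS]real_normK ?num_real // lerXn2r ?nnegrE // uv.
Qed.

Lemma square_integrable_bounded u (M : R) : measurable_fun I u ->
  (forall t, I t -> `|u t| <= M) -> square_integrable u.
Proof.
move=> mu_ uM; apply: (@square_integrable_dom _ (fun=> M)) => //; last first.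
  by move=> t It; apply: le_trans (ler_norm _); exact: uM.
by split=> //; apply: (@integrable_bounded _ _ `|M ^+ 2|).
Qed.

Lemma square_integrableD c u v : square_integrable u -> square_integrable v ->
  square_integrable (fun t => u t + c * v t).
Proof.
move=> [mu_ iu] [mv iv].
have m : measurable_fun I (fun t => u t + c * v t).
  by apply: measurable_funD => //; exact: measurable_funM.
split=> //.
apply: (integrable_ae_dom (measurable_funX _ m) _
  (integrable_add (integrable_scale 2 iu) (integrable_scale (2 * c ^+ 2) iv))).
apply: aeW => t _; rewrite ger0_norm ?sqr_ge0 //.
by have := sqr_ge0 (u t - c * v t); nra.
Qed.

Lemma sqnormD u v : square_integrable u -> square_integrable v ->
  N (u \+ v) <= 2 * N u + 2 * N v.
Proof.
move=> su sv; have [_ i] := square_integrableD 1 su sv.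
have [_ iu] := su; have [_ iv] := sv; have mI := @measurable_angles R.
rewrite -!RintegralZl // -RintegralD //; try exact: integrable_scale.
apply: le_Rintegral => //.
- by apply: integrable_ext i => t /=; rewrite mul1r.
- by apply: integrable_add; exact: integrable_scale.
- by move=> t _ /=; have := sqr_ge0 (u t - v t); nra.
Qed.

Lemma trig_square_integrable u : trig u -> square_integrable u.
Proof.
move=> tu; have [M uM] := trig_bounded tu.
by apply: square_integrable_bounded uM; exact: trig_measurable.
Qed.

Definition trig_approx u := square_integrable u /\
  forall e, 0 < e -> exists2 w, trig w & N (fun t => u t - w t) < e.

Lemma trig_approxD c u v : trig_approx u -> trig_approx v ->
  trig_approx (fun t => u t + c * v t).
Proof.
move=> [su au] [sv av]; split; first exact: square_integrableD.
move=> e e0.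
(* [sqnormD] doubles both errors, so each may cost [e / 4]. The [+ 1] in the tolerance for [v]
   covers [c = 0]. *)
have [w tw hw] := au (e / 4) ltac:(lra).
have d0 : 0 < e / (4 * (c ^+ 2 + 1)).
  by rewrite divr_gt0 // mulr_gt0 // ltr_pwDr // sqr_ge0.
have [x tx hx] := av _ d0.
exists (fun t => w t + c * x t).
  by apply: trigD => //; apply: trigM => //; exact: trig_cst.
have sw := square_integrableD (-1) su (trig_square_integrable tw).
have sx := square_integrableD (-1) sv (trig_square_integrable tx).
have sx' : square_integrable (fun t => c * (v t - x t)).
  have := square_integrableD c (trig_square_integrable (trig_cst 0)) sx.
  by congr square_integrable; apply/funext => t; rewrite add0r mulN1r.
have sw' : square_integrable (fun t => u t - w t).
  by move: sw; congr square_integrable; apply/funext => t; rewrite mulN1r.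
have := sqnormD sw' sx'.
have -> : N ((fun t => u t - w t) \+ (fun t => c * (v t - x t))) =
    N (fun t => u t + c * v t - (w t + c * x t)).
  by apply: eq_Rintegral => t _ /=; congr (_ ^+ 2); ring.
move=> /le_lt_trans; apply.
have -> : N (fun t => c * (v t - x t)) = c ^+ 2 * N (fun t => v t - x t).
  under eq_Rintegral do rewrite exprMn.
  rewrite RintegralZl //; first exact: measurable_angles.
  case: sx => _; apply: integrable_ext => t /=; by rewrite mulN1r.
have : c ^+ 2 * N (fun t => v t - x t) <= e / 4.
  apply: (@le_trans _ _ (c ^+ 2 * (e / (4 * (c ^+ 2 + 1))))).
    by rewrite ler_wpM2l ?sqr_ge0 // ltW.
  rewrite mulrCA ler_pM2l // invfM mulrCA ler_piMr // ler_pdivrMr ?mul1r ?lerDl //.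
  by rewrite ltr_pwDr // sqr_ge0.
by move: hw; lra.
Qed.

(** Dominated convergence with [(u - h n)^2 <= 4 g^2] gives convergence in mean square. The bound
    [g] is a function because the lemma serves twice: with a constant for indicators, then with [u]
    itself for the simple functions below an unbounded [u]. *)
Lemma trig_approx_lim (h : nat -> R -> R) (u g : R -> R) :
  (forall n, trig_approx (h n)) -> measurable_fun I u -> square_integrable g ->
  (forall t, I t -> `|u t| <= g t) -> (forall n t, I t -> `|h n t| <= g t) ->
  {ae mu, forall t, I t -> h n t @[n --> \oo] --> u t} -> trig_approx u.
Proof.
move=> ah mu_ sg ug hg cv.
have su : square_integrable u.
  apply: square_integrable_dom mu_ sg _ => t It.
  by rewrite (le_trans (ug _ It)) // ler_norm.
split=> // e e0.
have mh n : measurable_fun I (h n) by case: (ah n) => -[].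
have [|||||_ cvi] := @Rdominated_convergence (fun n t =>
  (u t - h n t) ^+ 2) (fun=> 0) (fun t => 4 * g t ^+ 2).
- by move=> n; apply: measurable_funX; exact: measurable_funB.
- exact: measurable_cst.
- by apply: integrable_scale; case: sg.
- move=> n t It; rewrite ger0_norm ?sqr_ge0 //.
  have := ug t It; have := hg n t It; rewrite !ler_norml => /andP[? ?] /andP[? ?].
  nra.
- apply: (@filterS _ _ aeF _ _ _ cv) => t /[apply] ct.
  rewrite (_ : 0 = (u t - u t) ^+ 2); last by rewrite subrr expr0n.
  by rewrite expr2; under eq_fun do rewrite expr2; apply: cvgM; apply: cvgB => //; exact: cvg_cst.
move: cvi; rewrite Rintegral_cst ?mul0r; last exact: measurable_angles.
move=> /cvgrPdist_lt /(_ (e / 4)) [|n0 _ hn]; first by lra.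
have := hn n0 (leqnn _); rewrite sub0r normrN ger0_norm; last first.
  by apply: Rintegral_ge0 => t _; exact: sqr_ge0.
move=> h1; have [w tw hw] := (ah n0).2 (e / 4) ltac:(lra).
exists w => //.
have s1 : square_integrable (fun t => u t - h n0 t).
  have := square_integrableD (-1) su (ah n0).1.
  by congr square_integrable; apply/funext => t; rewrite mulN1r.
have s2 : square_integrable (fun t => h n0 t - w t).
  have := square_integrableD (-1) (ah n0).1 (trig_square_integrable tw).
  by congr square_integrable; apply/funext => t; rewrite mulN1r.
have := sqnormD s1 s2.
have -> : N ((fun t => u t - h n0 t) \+ (fun t => h n0 t - w t)) = N (fun t => u t - w t).
  by apply: eq_Rintegral => t _ /=; congr (_ ^+ 2); ring.
by move=> /le_lt_trans; apply; lra.
Qed.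

Lemma trig_approx_indic A : measurable A -> trig_approx \1_A.
Proof.
apply: monotone_class => {A}.
- move=> u tu; split; first exact: trig_square_integrable.
  move=> e e0; exists u => //.
  under eq_Rintegral do rewrite subrr expr0n.
  by rewrite Rintegral_cst ?mul0r //; exact: measurable_angles.
- by move=> c u v; exact: trig_approxD.
- move=> h u M ah mu_ uM hM cv.
  apply: (trig_approx_lim ah mu_ _ uM hM cv).
  exact: (@square_integrable_bounded _ `|M|).
Qed.

Lemma trig_approx_ge0 u : square_integrable u -> (forall t, I t -> 0 <= u t) ->
  trig_approx u.
Proof.
move=> su u0; have [mu_ _] := su.
have meu : measurable_fun I (EFin \o u) by exact/measurable_EFinP.
have mI := @measurable_angles R.
have eu0 t : I t -> (0 <= (EFin \o u) t)%E by move=> It; rewrite lee_fin u0.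
pose h n (t : R) : R := nnsfun_approx mI meu n t.
apply: (@trig_approx_lim h u u) => //.
- move=> n; rewrite /h; set g := nnsfun_approx _ _ _.
  have -> : (fun t : R => g t) = fun t =>
    \sum_(y <- finmap.enum_fset (fset_set (range g))) y * \1_(g @^-1` [set y]) t.
    by apply/funext => t; rewrite {1}fimfunE fsbig_finite.
  elim: (finmap.enum_fset _) => [|y s ih].
    under eq_fun do rewrite big_nil.
    have := trig_approx_indic measurable0; congr trig_approx; apply/funext => t.
    by rewrite indic0.
  under eq_fun do rewrite big_cons addrC.
  by apply: trig_approxD => //; apply: trig_approx_indic; exact: measurable_sfunP.
- by move=> t It; rewrite ger0_norm ?u0.
- move=> n t It; rewrite ger0_norm // /h nnsfun_approxE.
  by have := le_approx n eu0 It; rewrite lee_fin.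
- apply: aeW => t It.
  by have /fine_cvg := cvg_nnsfun_approx mI meu eu0 It.
Qed.

Lemma trig_dense u : square_integrable u -> trig_approx u.
Proof.
move=> su; have [mu_ _] := su.
have mn : measurable_fun I (fun t => `|u t|) by exact: measurableT_comp.
(* For [c = 1/2] and [c = -1/2] these are the positive and negative parts of [u], whose difference
   is [u]. *)
have h c : `|c| = 2^-1 -> trig_approx (fun t => 2^-1 * `|u t| + c * u t).
  move=> hc; apply: trig_approx_ge0.
    apply: square_integrable_dom (su) _.
      by apply: measurable_funD; exact: measurable_funM.
    move=> t _; apply: le_trans (ler_normD _ _) _; rewrite !normrM hc normr_id ger0_norm //; lra.
  move=> t _; have : `|c * u t| = 2^-1 * `|u t| by rewrite normrM hc.
  by have := ler_norm (- (c * u t)); rewrite normrN; lra.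
have h1 := h 2^-1 ltac:(by rewrite ger0_norm).
have h2 := h (- 2^-1) ltac:(by rewrite normrN ger0_norm).
have := trig_approxD (-1) h1 h2; congr trig_approx; apply/funext => t; lra.
Qed.

Lemma laurent_dense (f : C -> C) (e : R) : L2 f -> 0 < e ->
  exists2 p, laurent p & complex.Re (intT (fun z => (f z - p z) * Num.conj (f z - p z))) < e.
Proof.
move=> [[m1 m2] lf] e0; have mI := @measurable_angles R.
have s1 : square_integrable (fun t => complex.Re (f (expi t))).
  split=> //; apply: integrable_ae_dom lf; first exact: measurable_funX.
  by apply: aeW => t _; rewrite Re_sqr_norm ger0_norm ?sqr_ge0 // lerDl sqr_ge0.
have s2 : square_integrable (fun t => complex.Im (f (expi t))).
  split=> //; apply: integrable_ae_dom lf; first exact: measurable_funX.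
  by apply: aeW => t _; rewrite Re_sqr_norm ger0_norm ?sqr_ge0 // lerDr sqr_ge0.
have [w1 t1 h1] := (trig_dense s1).2 e e0; have [w2 t2 h2] := (trig_dense s2).2 e e0.
have [p1 l1 e1] := t1; have [p2 l2 e2] := t2.
exists (fun z => p1 z + 'i * p2 z).
  by apply: laurentD => //; apply: laurentM => //; exact: laurent_cst.
rewrite /= -[X in X / _]/(\int[mu]_(t in I) complex.Re _).
have -> : \int[mu]_(t in I) complex.Re ((f (expi t) - (p1 (expi t) + 'i * p2
  (expi t))) * Num.conj (f (expi t) - (p1 (expi t) + 'i * p2 (expi t)))) =
   \int[mu]_(t in I) ((complex.Re (f (expi t)) - w1 t) ^+ 2 + (complex.Im (f
     (expi t)) - w2 t) ^+ 2).
  apply: eq_Rintegral => t _; rewrite -e1 -e2; case: (f _) => a b /=.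
  by rewrite mulrN opprK -!expr2; congr (_ ^+ 2 + _ ^+ 2); ring.
have s1' := square_integrableD (-1) s1 (trig_square_integrable t1).
have s2' := square_integrableD (-1) s2 (trig_square_integrable t2).
rewrite RintegralD //; last 2 first.
- by case: s1' => _; apply: integrable_ext => t; rewrite mulN1r.
- by case: s2' => _; apply: integrable_ext => t; rewrite mulN1r.
(* Each part costs [e]; the normalization by [2 pi] absorbs the sum [2 e]. *)
rewrite ltr_pdivrMr; last by rewrite mulr_gt0 // pi_gt0.
have := pi_ge2 R; nra.
Qed.

End FourierUniqueness.

(** * The Hardy space *)

Section HardySpace.
Variable R : realType.
Local Notation C := R[i].
Local Notation mu := (@lebesgue_measure R).
Local Notation I := (@angles R).
Implicit Types f g a b : C -> C.

Let aeF : Filter (almost_everywhere mu) := ae_filter_ringOfSetsType mu.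

Lemma conjcD (x y : C) : Num.conj (x + y) = Num.conj x + Num.conj y.
Proof. exact: rmorphD. Qed.

Lemma conjcB (x y : C) : Num.conj (x - y) = Num.conj x - Num.conj y.
Proof. exact: rmorphB. Qed.

Lemma conjcN (x : C) : Num.conj (- x) = - Num.conj x.
Proof. exact: rmorphN. Qed.

Lemma conjcM (x y : C) : Num.conj (x * y) = Num.conj x * Num.conj y.
Proof. exact: rmorphM. Qed.

Lemma conjc_sum (J : Type) (s : seq J) (P : pred J) (F : J -> C) :
  Num.conj (\sum_(j <- s | P j) F j) = \sum_(j <- s | P j) Num.conj (F j).
Proof. exact: rmorph_sum. Qed.

Lemma eq_fourier f g k : (forall t, f (expi t) = g (expi t)) -> fourier f k = fourier g k.
Proof. by move=> fg; apply: eq_intT => t; rewrite fg. Qed.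

Lemma L1_pow f k : L1 f -> L1 (fun z => f z * z ^ k).
Proof. by move=> lf; apply: L1M_Linfty => //; exact: Linfty_pow. Qed.

Lemma fourierD f g k : L1 f -> L1 g ->
  fourier (fun z => f z + g z) k = fourier f k + fourier g k.
Proof.
move=> lf lg; rewrite /fourier -intTD; try exact: L1_pow.
by apply: eq_intT => t; rewrite mulrDl.
Qed.

Lemma fourierZ c f k : L1 f -> fourier (fun z => c * f z) k = c * fourier f k.
Proof.
move=> lf; rewrite /fourier -intTZ; last exact: L1_pow.
by apply: eq_intT => t; rewrite mulrA.
Qed.

Lemma fourier_sum (J : Type) (s : seq J) (F : J -> C -> C) k :
  (forall j, L1 (F j)) ->
  fourier (fun z => \sum_(j <- s) F j z) k = \sum_(j <- s) fourier (F j) k.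
Proof.
move=> lF; rewrite /fourier -intT_sum => [|j]; last exact: L1_pow.
by apply: eq_intT => t; rewrite mulr_suml.
Qed.

Lemma fourier_shift f m k : fourier (fun z => f z * z ^ m) k = fourier f (k - m).
Proof.
apply: eq_intT => t; rewrite -mulrA -expfzDr ?expi_neq0 //.
by congr (_ * _ ^ _); rewrite opprB addrC.
Qed.

Lemma fourier_conj f k : L1 f ->
  fourier (fun z => Num.conj (f z)) k = Num.conj (fourier f (- k)).
Proof.
move=> lf; rewrite /fourier -intT_conj; last exact: L1_pow.
by apply: eq_intT => t; rewrite conjcM conj_expiX opprK.
Qed.

Lemma fourier_cst c k : fourier (fun=> c : C) k = (k == 0)%:R * c.
Proof.
rewrite /fourier intTZ; last by apply: L2_L1; exact: L2_pow.
by rewrite intT_pow oppr_eq0 mulrC.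
Qed.

Lemma aeT_fourier f g k : measurable_circle f -> measurable_circle g ->
  aeT (fun z => f z = g z) -> fourier f k = fourier g k.
Proof.
move=> mf mg fg; apply: aeT_intT.
- by apply: measurable_circleM => //; exact: measurable_circle_pow.
- by apply: measurable_circleM => //; exact: measurable_circle_pow.
- by apply: aeTS fg => t ->.
Qed.

Lemma intT_CS f g : L2 f -> L2 g ->
  `|intT (fun z => f z * g z)| ^+ 2 <=
  intT (fun z => f z * Num.conj (f z)) * intT (fun z => g z * Num.conj (g z)).
Proof.
move=> lf lg; set Z := intT (fun z => f z * g z).
set X := intT (fun z => f z * _); set Y := intT (fun z => g z * _).
have X0 : 0 <= X by exact: intT_sqr_ge0.
have Y0 : 0 <= Y by exact: intT_sqr_ge0.
have lcf := L2_conj lf; have lcg := L2_conj lg.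
(* This is the squared norm of [conj f - c g], expanded. *)
have key c : 0 <= X - c * Z - Num.conj (c * Z) + c * Num.conj c * Y.
  have l : L2 (fun z => Num.conj (f z) + (- c) * g z) by apply: L2D => //; exact: L2Z.
  have := intT_sqr_ge0 l; congr (0 <= _).
  rewrite (eq_intT (g := fun z => f z * Num.conj (f z) + ((- c) * (f z * g z) +
     (Num.conj (- c) * Num.conj (f z * g z) + (c * Num.conj c) * (g z * Num.conj (g z))))));
       last first.
    by move=> t; rewrite conjcD !conjcM !conjcN !conjCK; ring.
  have l1 := L2M lf lcf; have l2 := L2M lf lg; have l3 := L2M lg lcg.
  have l4 := L1_conj l2.
  rewrite !intTD ?intTZ ?intT_conj //; try by repeat first [apply: L1Z | apply: L1D].
  by rewrite -/X -/Y -/Z conjcM !conjcN; ring.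
have [Y1|Y1] := eqVneq Y 0.
  have /aeT_intT g0 := intT_sqr_eq0 lg Y1.
  have -> : Z = 0.
    rewrite /Z -[RHS]intT0; apply: aeT_intT.
    - by apply: measurable_circleM; [case: lf|case: lg].
    - exact: measurable_circle_cst.
    - by apply: aeTS (intT_sqr_eq0 lg Y1) => t ->; rewrite mulr0.
  by rewrite normr0 expr0n /= mulr_ge0.
have Yp : 0 < Y by rewrite lt_def Y1.
(* The minimizer of the quadratic form in [key]. *)
have := key (Num.conj Z / Y).
have cY : Num.conj Y = Y by apply/CrealP; rewrite ger0_real.
have e : Num.conj (Num.conj Z / Y) = Z / Y.
  by rewrite conjcM conjCK; congr (_ * _); rewrite [LHS]fmorphV; congr (_^-1); exact: cY.
rewrite conjcM e.
have -> : X - Num.conj Z / Y * Z - Z / Y * Num.conj Z + Num.conj Z / Y * (Z / Y) * Y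
   = (X * Y - Z * Num.conj Z) / Y by field.
by rewrite pmulr_lge0 ?invr_gt0 // subr_ge0 -normCK.
Qed.

Lemma H2_L2 f : H2 f -> L2 f. Proof. by case. Qed.

Lemma H2_L1 f : H2 f -> L1 f. Proof. by case=> /L2_L1. Qed.

Lemma H2D f g : H2 f -> H2 g -> H2 (fun z => f z + g z).
Proof.
move=> [lf hf] [lg hg]; split; first exact: L2D.
by move=> k k0; rewrite fourierD ?hf ?hg ?addr0 //; exact: L2_L1.
Qed.

Lemma H2Z c f : H2 f -> H2 (fun z => c * f z).
Proof.
move=> [lf hf]; split; first exact: L2Z.
by move=> k k0; rewrite fourierZ ?hf ?mulr0 //; exact: L2_L1.
Qed.

Lemma H2_cst c : H2 (fun=> c : C).
Proof.
split; first exact: L2_cst.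
by move=> k k0; rewrite fourier_cst (lt_eqF k0) mul0r.
Qed.

Lemma H2_sum (J : Type) (s : seq J) (F : J -> C -> C) :
  (forall j, H2 (F j)) -> H2 (fun z => \sum_(j <- s) F j z).
Proof.
move=> h; elim: s => [|j s ih].
  by under eq_fun do rewrite big_nil; exact: H2_cst.
by under eq_fun do rewrite big_cons; exact: H2D.
Qed.

Lemma H2_shift f (m : nat) : H2 f -> H2 (fun z => f z * z ^ m).
Proof.
move=> [lf hf]; split.
  by apply: L2M_Linfty => //; exact: Linfty_pow.
move=> k k0; rewrite fourier_shift hf //.
by rewrite subr_lt0 (lt_le_trans k0).
Qed.

Lemma eq_H2 f g : (forall t, f (expi t) = g (expi t)) -> H2 f -> H2 g.
Proof.
move=> fg [[[m1 m2] lf] hf]; split; last by move=> k k0; rewrite -(eq_fourier k fg) hf.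
split; last by apply: integrable_ext lf => t; rewrite fg.
by split; [move: m1|move: m2]; apply: eq_measurable_fun => t _; rewrite fg.
Qed.

(* Parseval in the only form needed below: a Laurent polynomial close to [b]
   can be replaced by its part of positive degree, because [b] minus that part
   is orthogonal to the rest. *)
Lemma H2_orthogonal a b : H2 a -> H2 b -> fourier b 0 = 0 ->
  intT (fun z => a z * b z) = 0.
Proof.
move=> [la ha] [lb hb] b0.
set X := intT (fun z => a z * Num.conj (a z)).
have X0 : 0 <= X by exact: intT_sqr_ge0.
have key (e : R) : 0 < e -> `|intT (fun z => a z * b z)| ^+ 2 <= X * e%:C.
  move=> e0; have [p /laurent_sum[N [q hq]] pe] := laurent_dense lb e0.
  pose m (i : 'I_(size q)) : int := i%:Z - N%:Z.
  pose pp (z : C) := \sum_(i < size q | 0 < m i) q`_i * z ^ m i.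
  pose pn (z : C) := \sum_(i < size q | ~~ (0 < m i)) q`_i * z ^ m i.
  have lmon (i : 'I_(size q)) : L2 (fun z : C => q`_i * z ^ m i) by apply: L2Z; exact: L2_pow.
  have lpp : L2 pp.
    rewrite /pp; under eq_fun do rewrite -big_filter; exact: L2_sum.
  have lpn : L2 pn.
    rewrite /pn; under eq_fun do rewrite -big_filter; exact: L2_sum.
  have pE t : p (expi t) = pp (expi t) + pn (expi t).
    by rewrite hq (bigID (fun i => 0 < m i)).
  have mulpp f : L2 f -> (forall k : int, 0 < k -> fourier f (- k) = 0) ->
      intT (fun z => f z * pp z) = 0.
    move=> lf hf.
    rewrite (eq_intT (g := fun z =>
      \sum_(i <- [seq i <- index_enum _ | 0 < m i]) q`_i * (f z * z ^ m i))); last first.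
      by move=> t; rewrite /pp mulr_sumr big_filter; apply: eq_bigr => i _; ring.
    rewrite intT_sum => [|i]; last by apply: L1Z; apply: L1_pow; exact: L2_L1.
    rewrite big_filter; apply: big1 => i mi; rewrite intTZ; last by apply: L1_pow; exact: L2_L1.
    by have := hf _ mi; rewrite /fourier opprK => ->; rewrite mulr0.
  have lr : L2 (fun z => b z + (-1) * pp z) by apply: L2D => //; exact: L2Z.
  have rneg (k : int) : k <= 0 -> fourier (fun z => b z + (-1) * pp z) k = 0.
    move=> k0; rewrite fourierD ?fourierZ; try by [exact: L2_L1|apply: L2_L1; exact: L2Z].
    have -> : fourier b k = 0.
      by move: k0; rewrite le_eqVlt => /orP[/eqP ->|/hb].
    rewrite (eq_fourier (g := fun z =>
      \sum_(i <- [seq i <- index_enum _ | 0 < m i]) q`_i * z ^ m i)); last first.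
      by move=> t; rewrite /pp big_filter.
    rewrite fourier_sum => [|i]; last exact: L2_L1.
    rewrite big_filter big1 ?mulr0 ?addr0 // => i mi.
    rewrite fourierZ; last by apply: L2_L1; exact: L2_pow.
    have := fourier_shift (fun=> 1) (m i) k; rewrite fourier_cst subr_eq0.
    rewrite (eq_fourier (g := fun z => z ^ m i)) => [->|t]; last by rewrite mul1r.
    by rewrite (lt_eqF (le_lt_trans k0 mi)) mul0r mulr0.
  have orth : intT (fun z => (b z + (-1) * pp z) * Num.conj (pn z)) = 0.
    rewrite (eq_intT (g := fun z => \sum_(i <- [seq i <- index_enum _ | ~~ (0 < m i)])
        Num.conj q`_i * ((b z + (-1) * pp z) * z ^ (- m i)))); last first.
      move=> t; rewrite /pn conjc_sum mulr_sumr big_filter; apply: eq_bigr => i _.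
      by rewrite conjcM conj_expiX; ring.
    rewrite intT_sum => [|i]; last by apply: L1Z; apply: L1_pow; exact: L2_L1.
    rewrite big_filter; apply: big1 => i mi; rewrite intTZ; last by apply: L1_pow; exact: L2_L1.
    by have := rneg (m i); rewrite /fourier => ->; rewrite ?mulr0 // leNgt.
  (* [a] has no negative frequencies and [pp] only positive ones, so [a pp] has mean 0 and [b] may
     be replaced by [b - pp]. *)
  have -> : intT (fun z => a z * b z) = intT (fun z => a z * (b z + (-1) * pp z)).
    have m0 : intT (fun z => a z * pp z) = 0.
      by apply: mulpp => // k k0; rewrite ha // oppr_lt0.
    transitivity (intT (fun z => a z * b z) + (-1) * intT (fun z => a z * pp z)).
      by rewrite m0 mulr0 addr0.
    rewrite -intTZ -?intTD; try by [exact: L2M|apply: L1Z; exact: L2M].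
    by apply: eq_intT => t; ring.
  apply: le_trans (intT_CS la lr) _; rewrite ler_wpM2l //.
  have lrn : L2 (fun z => (b z + (-1) * pp z) + (-1) * pn z).
    by apply: L2D => //; exact: L2Z.
  (* Pythagoras for [b - p = (b - pp) - pn]: dropping [pn] can only decrease the error, so
     Cauchy-Schwarz still gives the bound [X e]. *)
  have pyth : intT (fun z => (b z - p z) * Num.conj (b z - p z)) =
     intT (fun z => (b z + (-1) * pp z) * Num.conj (b z + (-1) * pp z)) +
     intT (fun z => pn z * Num.conj (pn z)).
    pose r (z : C) := b z + (-1) * pp z.
    rewrite (eq_intT (g := fun z => r z * Num.conj (r z) + (pn z * Num.conj (pn z) +
       ((-1) * (r z * Num.conj (pn z)) + (-1) * Num.conj (r z * Num.conj (pn z)))))); last first.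
      move=> t; rewrite pE.
      have -> : b (expi t) - (pp (expi t) + pn (expi t)) = r (expi t) - pn
        (expi t) by rewrite /r; ring.
      rewrite conjcB conjcM conjCK; ring.
    have l1 := L2M lr (L2_conj lr); have l2 := L2M lpn (L2_conj lpn).
    have l3 := L2M lr (L2_conj lpn); have l4 := L1_conj l3.
    rewrite !intTD ?intTZ ?intT_conj //; try by repeat first [apply: L1Z | apply: L1D].
    by rewrite orth rmorph0 !mulr0 !addr0.
  have pn0 := intT_sqr_ge0 lpn.
  apply: (@le_trans _ _ (intT (fun z => (b z - p z) * Num.conj (b z - p z)))).
    by rewrite pyth lerDl.
  have : 0 <= intT (fun z => (b z - p z) * Num.conj (b z - p z)).
    by rewrite pyth addr_ge0 // intT_sqr_ge0.
  move: pe; set W := intT _; case: W => w1 w2 /= w1e; rewrite !lecE /= => /andP[/eqP -> _].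
  by rewrite eqxx ltW.
apply/eqP; rewrite -normr_eq0 -sqrf_eq0; apply/eqP.
move: key; set Z := intT _ => key.
have [Xr X1] : exists x : R, X = x%:C.
  by exists (complex.Re X); rewrite RRe_real // ger0_real.
have X0' : 0 <= Xr by rewrite X1 ler0c in X0.
have := key; rewrite normC_real -real_complexX X1 => key'.
have key2 (e : R) : 0 < e -> complex.Re `|Z| ^+ 2 <= Xr * e.
  by move=> /key'; rewrite -real_complexM lecR.
suff -> : complex.Re `|Z| ^+ 2 = 0 by [].
apply/eqP; rewrite eq_le sqr_ge0 andbT; apply/ler_addgt0Pl => e e0; rewrite addr0.
(* The divisor is [Xr + 1] because [Xr] may be 0. *)
apply: le_trans (key2 (e / (Xr + 1)) _) _.
  by rewrite divr_gt0 // ltr_wpDl.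
have le1 : Xr / (Xr + 1) <= 1 by rewrite ler_pdivrMr ?mul1r ?lerDl ?ltr_wpDl.
by rewrite mulrCA ler_piMr // ltW.
Qed.

(** The coefficient of [f g] at [-(n + 1)] is the mean of [f] times [g z^(n+1)]; the latter is in
    [H2] with mean 0, so [H2_orthogonal] applies and no Cauchy product of series is needed. *)
Lemma H2M f g : H2 f -> Hinfty g -> H2 (fun z => f z * g z).
Proof.
move=> hf [ig hg]; split; first by apply: L2M_Linfty => //; exact: H2_L2.
move=> k k0; rewrite /fourier.
have [n kn] : exists n : nat, - k = n.+1%:Z.
  by case: k k0 => // n _; exists n; rewrite NegzE opprK.
rewrite (eq_intT (g := fun z => f z * (g z * z ^ n.+1))); last by move=> t; rewrite -mulrA kn.
apply: H2_orthogonal => //; first exact: H2_shift.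
by rewrite fourier_shift; case: hg => _; apply.
Qed.

End HardySpace.

(** * The reflection [z -> conj z] of the circle *)

Section Reflection.
Variable R : realType.
Local Notation C := R[i].
Local Notation mu := (@lebesgue_measure R).
Local Notation I := (@angles R).
Implicit Types f g : C -> C.

Lemma anglesN (t : R) : I t -> I (- t).
Proof. by rewrite /angles /= !in_itv /= => /andP[a b]; rewrite lerN2 b lerNl a. Qed.

Lemma measurable_funN_angles (u : R -> R) : measurable_fun I u ->
  measurable_fun I (fun t => u (- t)).
Proof.
move=> mu_; apply: (measurable_comp (F := I) _ _ mu_) => //; try exact: measurable_angles;
  try exact: oppr_measurable.
by move=> _ [t It <-]; exact: anglesN.
Qed.

Lemma measurable_circle_refl f : measurable_circle f ->
  measurable_circle (fun z => f (Num.conj z)).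
Proof.
case=> m1 m2; split.
- by under eq_fun do rewrite -expiN; exact: measurable_funN_angles m1.
- by under eq_fun do rewrite -expiN; exact: measurable_funN_angles m2.
Qed.

Lemma aeT_refl (P : C -> Prop) : aeT P -> aeT (fun z => P (Num.conj z)).
Proof.
move=> [B [mB B0 PB]]; exists (-%R @^-1` B); split.
- by rewrite -[X in measurable X]setTI; exact: oppr_measurable.
- by rewrite -B0 -[RHS]lebesgue_measureN.
- move=> t /= nP; apply: PB => /= h; apply: nP => It; rewrite -expiN; apply: h.
  exact: anglesN.
Qed.

Lemma integral_refl (u : R -> \bar R) : measurable_fun I u ->
  (\int[mu]_(t in I) u (- t)%R = \int[mu]_(t in I) u t)%E.
Proof.
move=> mu_.
have ge0 (v : R -> \bar R) : measurable_fun I v -> (forall t, 0 <= v t)%E ->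
    (\int[mu]_(t in I) v (- t)%R = \int[mu]_(t in I) v t)%E.
  move=> mv v0.
  have eI : -%R @^-1` I = I.
    by apply/seteqP; split=> t; [move/anglesN; rewrite opprK|exact: anglesN].
  have mN : measurable_fun setT (-%R : R -> R) by exact: oppr_measurable.
  transitivity (\int[pushforward mu (-%R : R -> measurableTypeR R)]_(t in I) v t)%E.
    by rewrite ge0_integral_pushforward ?eI //; exact: measurable_angles.
  by apply: eq_measure_integral => A mA _; exact: lebesgue_measureN.
rewrite integralE [RHS]integralE; congr (_ - _)%E.
- rewrite -(ge0 u^\+%E (measurable_funepos mu_) (funepos_ge0 _)).
  by apply: eq_integral => t _; rewrite !funeposE.
- rewrite -(ge0 u^\-%E (measurable_funeneg mu_) (funeneg_ge0 _)).
  by apply: eq_integral => t _; rewrite !funenegE.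
Qed.

Lemma Rintegral_refl (u : R -> R) : measurable_fun I u ->
  \int[mu]_(t in I) u (- t) = \int[mu]_(t in I) u t.
Proof.
by move=> mu_; rewrite /Rintegral -(integral_refl (u := EFin \o u)) //; exact/measurable_EFinP.
Qed.

Lemma intT_refl f : measurable_circle f -> intT (fun z => f (Num.conj z)) = intT f.
Proof.
case=> m1 m2; rewrite /intT -(Rintegral_refl m1) -(Rintegral_refl m2).
by congr (_ +i* _); congr (_ / _); apply: eq_Rintegral => t _; rewrite expiN.
Qed.

Lemma L2_refl f : L2 f -> L2 (fun z => f (Num.conj z)).
Proof.
case=> mf lf; split; first exact: measurable_circle_refl.
have /measurable_int ms := lf.
apply/integrableP; split.
  have /measurable_EFinP/measurable_funN_angles/measurable_EFinP := ms.
  by apply: eq_measurable_fun => t _ /=; rewrite expiN.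
case/integrableP: lf => _;
  rewrite -(integral_refl (u := fun t => `|(complex.Re (`|f (expi t)| ^+ 2))%:E|%E)).
  by under eq_integral do rewrite expiN.
exact: measurableT_comp.
Qed.

Lemma Linfty_refl f : Linfty f -> Linfty (fun z => f (Num.conj z)).
Proof.
case=> mf [M fM]; split; first exact: measurable_circle_refl.
by exists M; exact: (aeT_refl fM).
Qed.

Lemma fourier_refl f k : measurable_circle f ->
  fourier (fun z => f (Num.conj z)) k = fourier f (- k).
Proof.
move=> mf; rewrite /fourier -[RHS]intT_refl; last first.
  by apply: measurable_circleM => //; exact: measurable_circle_pow.
by apply: eq_intT => t; rewrite conj_expi exprz_inv !opprK.
Qed.

End Reflection.

(** * Gram-Schmidt sequences in a semi-inner product space *)

Section GramSchmidt.
Variables (C : numClosedFieldType) (V : lmodType C).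

(** [D] singles out the [L2] representatives among all functions, on which alone [dotT] is linear.
    The field [semi_inner_null] stands in for the quotient by functions vanishing a.e. *)
Record semi_inner (D : V -> Prop) (dot : V -> V -> C) : Prop := SemiInner {
  semi_inner0 : D 0;
  semi_innerP : forall a x y, D x -> D y -> D (a *: x + y);
  semi_innerDl : forall a x y z, D x -> D y -> D z ->
    dot (a *: x + y) z = a * dot x z + dot y z;
  semi_innerC : forall x y, D x -> D y -> dot y x = Num.conj (dot x y);
  semi_inner_ge0 : forall x, D x -> 0 <= dot x x;
  semi_inner_null : forall x y, D x -> D y -> dot x x = 0 -> dot x y = 0 }.

Definition linear_closed_set (P : V -> Prop) :=
  P 0 /\ forall a x y, P x -> P y -> P (a *: x + y).

Variables (D : V -> Prop) (dot : V -> V -> C) (hD : semi_inner D dot).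
Implicit Types (L : seq V) (x y u : V) (v : nat -> V).

Let D0 : D 0 := semi_inner0 hD.
Let DP := semi_innerP hD.
Let dotDl := semi_innerDl hD.
Let dotC := semi_innerC hD.

Lemma semi_innerZ a x : D x -> D (a *: x).
Proof. by move=> dx; rewrite -[_ *: _]addr0; exact: DP. Qed.

Lemma semi_innerD x y : D x -> D y -> D (x + y).
Proof. by move=> dx dy; rewrite -[x]scale1r; exact: DP. Qed.

Lemma semi_innerB x y : D x -> D y -> D (x - y).
Proof. by move=> dx dy; rewrite addrC -scaleN1r; exact: DP. Qed.

Lemma dot0l z : D z -> dot 0 z = 0.
Proof.
move=> dz; have := dotDl 1 D0 D0 dz; rewrite scaler0 addr0 mul1r => /eqP.
by rewrite -subr_eq0 opprD addNKr oppr_eq0 => /eqP.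
Qed.

Lemma dot0r z : D z -> dot z 0 = 0.
Proof. by move=> dz; rewrite (dotC D0 dz) dot0l // rmorph0. Qed.

Lemma dotZl a x z : D x -> D z -> dot (a *: x) z = a * dot x z.
Proof. by move=> dx dz; rewrite -[_ *: x]addr0 dotDl // dot0l // addr0. Qed.

Lemma dotDl1 x y z : D x -> D y -> D z -> dot (x + y) z = dot x z + dot y z.
Proof. by move=> dx dy dz; rewrite -[in LHS](scale1r x) dotDl // mul1r. Qed.

Lemma dotBl x y z : D x -> D y -> D z -> dot (x - y) z = dot x z - dot y z.
Proof. by move=> dx dy dz; rewrite addrC -scaleN1r dotDl // mulN1r addrC. Qed.

Lemma dotZr a x z : D x -> D z -> dot z (a *: x) = Num.conj a * dot z x.
Proof.
move=> dx dz; rewrite (dotC (semi_innerZ a dx) dz) dotZl //.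
by rewrite (dotC dx dz) [LHS]rmorphM.
Qed.

Lemma semi_inner_sum (J : Type) (s : seq J) (F : J -> V) :
  (forall j, D (F j)) -> D (\sum_(j <- s) F j).
Proof. by move=> h; elim/big_ind: _ => //; exact: semi_innerD. Qed.

Lemma dot_suml (J : Type) (s : seq J) (F : J -> V) z : (forall j, D (F j)) -> D z ->
  dot (\sum_(j <- s) F j) z = \sum_(j <- s) dot (F j) z.
Proof.
move=> h dz; elim: s => [|j s ih]; first by rewrite !big_nil dot0l.
by rewrite !big_cons dotDl1 ?ih //; exact: semi_inner_sum.
Qed.

Lemma dotBr x y z : D x -> D y -> D z -> dot z (x - y) = dot z x - dot z y.
Proof.
move=> dx dy dz; rewrite (dotC (semi_innerB dx dy) dz) dotBl // [LHS]rmorphB.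
by rewrite (dotC dx dz) (dotC dy dz).
Qed.

Lemma dot_sumr (J : Type) (s : seq J) (F : J -> V) z : (forall j, D (F j)) -> D z ->
  dot z (\sum_(j <- s) F j) = \sum_(j <- s) dot z (F j).
Proof.
move=> h dz; rewrite (dotC (semi_inner_sum s h) dz) dot_suml // [LHS]rmorph_sum.
by apply: eq_bigr => j _; rewrite (dotC (h j) dz).
Qed.

Definition orthonormal_seq L := (forall u, u \in L -> D u) /\
  forall i j, (i < size L)%N -> (j < size L)%N -> dot L`_i L`_j = (i == j)%:R.

Definition proj_seq L x := \sum_(i < size L) dot x L`_i *: L`_i.

(* [x] agrees with its orthogonal projection on [L] up to a vector of norm 0. *)
Definition spanned L x := forall y, D y ->
  dot x y = \sum_(i < size L) dot x L`_i * dot L`_i y.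

Lemma ons_D L (i : nat) : orthonormal_seq L -> D L`_i.
Proof.
move=> [dL _]; have [iL|iL] := ltnP i (size L); first by apply: dL; exact: mem_nth.
by rewrite nth_default.
Qed.

Lemma D_proj_seq L x : orthonormal_seq L -> D (proj_seq L x).
Proof. by move=> oL; apply: semi_inner_sum => i; apply: semi_innerZ; exact: ons_D. Qed.

Lemma dot_proj_seq L x y : orthonormal_seq L -> D y ->
  dot (proj_seq L x) y = \sum_(i < size L) dot x L`_i * dot L`_i y.
Proof.
move=> oL dy; rewrite dot_suml // => [|i]; last by apply: semi_innerZ; exact: ons_D.
by apply: eq_bigr => i _; rewrite dotZl //; exact: ons_D.
Qed.

Lemma dot_residual L x (j : nat) : orthonormal_seq L -> D x -> (j < size L)%N ->
  dot (x - proj_seq L x) L`_j = 0.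
Proof.
move=> oL dx jL; rewrite dotBl ?dot_proj_seq //; try exact: ons_D; try exact: D_proj_seq.
rewrite (bigD1 (Ordinal jL)) //= big1 ?addr0.
  by case: oL => _ -> //; rewrite eqxx mulr1 subrr.
move=> i /eqP ij; case: oL => _ -> //; rewrite (_ : _ == _ = false) ?mulr0 //.
by apply/eqP => e; apply: ij; exact: val_inj.
Qed.

Lemma spanned_residual L x : orthonormal_seq L -> D x ->
  dot (x - proj_seq L x) (x - proj_seq L x) = 0 -> spanned L x.
Proof.
move=> oL dx r0 y dy; rewrite -dot_proj_seq //.
have dp := D_proj_seq x oL.
have := semi_inner_null hD (semi_innerB dx dp) dy r0.
by rewrite dotBl // => /eqP; rewrite subr_eq0 => /eqP.
Qed.

(* Since [phi] separates points, the coefficient rows [c] of distinct elements of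
   [L] are linearly independent in [C^d]. *)
Lemma orthonormal_size_le L (d : nat) (P : V -> Prop) (phi : nat -> V) (y : nat -> 'I_d -> C) :
  orthonormal_seq L -> linear_closed_set P -> (forall x, P x -> D x) ->
  (forall b, D (phi b)) ->
  (forall x, P x -> (forall b, dot x (phi b) = 0) -> dot x x = 0) ->
  (forall u, u \in L -> P u /\
     exists c : 'I_d -> C, forall b, dot u (phi b) = \sum_(q < d) c q * y b q) ->
  (size L <= d)%N.
Proof.
move=> oL [P0 PP] PD dphi sep hL; rewrite leqNgt; apply/negP => dL.
have mL (i : 'I_(size L)) : L`_i \in L by apply: mem_nth.
have /choice[c hc] : forall i : 'I_(size L), exists c : 'I_d -> C,
    forall b, dot L`_i (phi b) = \sum_(q < d) c q * y b q.
  by move=> i; case: (hL _ (mL i)).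
pose M : 'M[C]_(size L, d) := \matrix_(i, q) c i q.
have : kermx M != 0.
  rewrite -mxrank_eq0 mxrank_ker subn_eq0 -ltnNge.
  by apply: leq_ltn_trans dL; exact: rank_leq_col.
move=> /rowV0Pn[x /sub_kermxP xM x0].
(* A linear relation between more than [d] rows of coefficients. The combination [xi] pairs to 0
   with every [phi b], hence is null, and pairing it with the elements of [L] gives [x = 0]. *)
pose xi := \sum_(i < size L) x 0 i *: L`_i.
have Pxi : P xi.
  apply: (big_ind P) => // [u w Pu Pw|i _].
    by rewrite -[u]scale1r; exact: PP.
  by rewrite -[_ *: _]addr0; apply: PP => //; case: (hL _ (mL i)).
have dxi z : D z -> dot xi z = \sum_(i < size L) x 0 i * dot L`_i z.
  move=> dz; rewrite /xi dot_suml // => [|i]; last by apply: semi_innerZ; exact: ons_D.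
  by apply: eq_bigr => i _; rewrite dotZl //; exact: ons_D.
have xi0 : dot xi xi = 0.
  apply: sep => // b; rewrite dxi //.
  under eq_bigr do rewrite hc mulr_sumr.
  rewrite exchange_big /=; apply: big1 => q _.
  transitivity ((x *m M) 0 q * y b q); last by rewrite xM mxE mul0r.
  by rewrite mxE mulr_suml; apply: eq_bigr => i _; rewrite mxE mulrA.
move/eqP: x0; apply; apply/rowP => j; rewrite mxE.
have := semi_inner_null hD (PD _ Pxi) (ons_D j oL) xi0.
rewrite dxi; last exact: ons_D.
rewrite (bigD1 j) //= big1 ?addr0.
  by case: oL => _ -> //; rewrite eqxx mulr1.
move=> i ij; case: oL => _ -> //; rewrite (_ : _ == _ = false) ?mulr0 //.
exact: negPf ij.
Qed.

(** Residuals of norm 0 are dropped, so the length of the list is the dimension of the span of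
    [v 0, ..., v (k - 1)] modulo null vectors. *)
Fixpoint gram_schmidt v (k : nat) : seq V :=
  if k is k'.+1 then
    let L := gram_schmidt v k' in let w := v k' - proj_seq L (v k') in
    if dot w w == 0 then L else rcons L ((sqrtC (dot w w))^-1 *: w)
  else [::].

Lemma gram_schmidt_ind v (P : V -> Prop) : linear_closed_set P -> (forall k, P (v k)) ->
  forall k u, u \in gram_schmidt v k -> P u.
Proof.
move=> [P0 PP] Pv; have PZ a x : P x -> P (a *: x).
  by move=> px; rewrite -[_ *: _]addr0; exact: PP.
have PD x y : P x -> P y -> P (x + y) by move=> px py; rewrite -[x]scale1r; exact: PP.
elim=> [//|k ih] u /=; case: ifP => _; first exact: ih.
rewrite mem_rcons inE => /orP[/eqP ->|]; last exact: ih.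
apply: (PZ); rewrite -scaleN1r; apply: (PD) => //; apply: (PZ).
by apply: (big_ind P) => // i _; apply: (PZ); apply: ih; exact: mem_nth.
Qed.

(** Lists only grow at the end: each is a prefix of the later ones, so the [i]-th vector does not
    depend on the stage at which it is read. *)
Lemma gram_schmidt_nth v k k' i : (k <= k')%N -> (i < size (gram_schmidt v k))%N ->
  (i < size (gram_schmidt v k'))%N /\ (gram_schmidt v k')`_i = (gram_schmidt v k)`_i.
Proof.
elim: k' => [|k' ih]; first by rewrite leqn0 => /eqP ->.
rewrite leq_eqVlt => /orP[/eqP -> //|]; rewrite ltnS => kk' ik.
have [i1 i2] := ih kk' ik; rewrite /=; case: ifP => // _.
by rewrite size_rcons nth_rcons i1 (ltn_trans i1).
Qed.

Lemma gram_schmidt_size v k k' : (k <= k')%N ->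
  (size (gram_schmidt v k) <= size (gram_schmidt v k'))%N.
Proof.
elim: k' => [|k' ih]; first by rewrite leqn0 => /eqP ->.
rewrite leq_eqVlt => /orP[/eqP -> //|]; rewrite ltnS => /ih /leq_trans; apply.
by rewrite /=; case: ifP => // _; rewrite size_rcons.
Qed.

Lemma gram_schmidt_ons v k : (forall k, D (v k)) -> orthonormal_seq (gram_schmidt v k).
Proof.
move=> dv; elim: k => [|k ih]; first by split.
rewrite /=; set L := gram_schmidt v k; set w := v k - proj_seq L (v k).
have dw : D w by apply: semi_innerB => //; exact: D_proj_seq.
case: ifPn => // w0; set s := sqrtC (dot w w).
have w_ge0 := semi_inner_ge0 hD dw.
have s_ge0 : 0 <= s by rewrite sqrtC_ge0.
have s0 : s != 0 by rewrite sqrtC_eq0.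
have sJ : Num.conj s^-1 = s^-1 by apply/CrealP; rewrite ger0_real // invr_ge0.
have wL j : (j < size L)%N -> dot w L`_j = 0 by move=> jL; exact: dot_residual.
have Lw j : (j < size L)%N -> dot L`_j w = 0.
  by move=> jL; rewrite (dotC dw) ?wL ?rmorph0 //; exact: ons_D.
split=> [u|i j].
  rewrite mem_rcons inE => /orP[/eqP ->|]; first exact: semi_innerZ.
  by case: ih => + _; apply.
rewrite size_rcons !ltnS !nth_rcons.
rewrite (leq_eqVlt i) (leq_eqVlt j) => /orP[/eqP ->|iL] /orP[/eqP ->|jL].
- rewrite ltnn eqxx dotZl ?dotZr //; last exact: semi_innerZ.
  by rewrite sJ mulrA -invfM -expr2 sqrtCK mulVf.
- rewrite ltnn eqxx jL dotZl ?wL ?mulr0 // ?(gtn_eqF jL) //; exact: ons_D.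
- rewrite ltnn eqxx iL dotZr ?Lw ?mulr0 // ?(ltn_eqF iL) //; exact: ons_D.
- by rewrite iL jL; case: ih => _; apply.
Qed.

(** [v j] is its projection plus a residual, and the residual is either null or a multiple of the
    vector appended at that stage. *)
Lemma gram_schmidt_orth v k j y : (forall k, D (v k)) -> D y -> (j < k)%N ->
  (forall i, (i < size (gram_schmidt v k))%N -> dot (gram_schmidt v k)`_i y = 0) ->
  dot (v j) y = 0.
Proof.
move=> dv dy; elim: k => // k ih; rewrite ltnS leq_eqVlt => /orP[/eqP ->|jk] h.
  have oL := gram_schmidt_ons k dv.
  have L0 i : (i < size (gram_schmidt v k))%N -> dot (gram_schmidt v k)`_i y = 0.
    move=> ik; have [i1 i2] := gram_schmidt_nth (leqnSn k) ik.
    by rewrite -i2 h.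
  have dp := D_proj_seq (v k) oL; have dw := semi_innerB (dv k) dp.
  rewrite -(subrK (proj_seq (gram_schmidt v k) (v k)) (v k)) dotDl1 //.
  rewrite dot_proj_seq // [X in _ + X]big1 ?addr0; last first.
    by move=> i _; rewrite L0 ?mulr0.
  move: h => /=; case: eqP => [w0 _|/eqP w0 h].
    exact: (semi_inner_null hD dw dy w0).
  have := h (size (gram_schmidt v k)); rewrite size_rcons ltnSn nth_rcons ltnn eqxx.
  move=> /(_ isT); rewrite dotZl // => /eqP.
  by rewrite mulf_eq0 invr_eq0 sqrtC_eq0 (negPf w0) => /eqP.
apply: ih => // i ik; have [i1 i2] := gram_schmidt_nth (leqnSn k) ik.
by rewrite -i2 h.
Qed.

Lemma gram_schmidt_stable v (d : nat) :
  (forall k, (size (gram_schmidt v k) <= d)%N) ->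
  exists k0, forall k, (k0 <= k)%N -> gram_schmidt v k = gram_schmidt v k0.
Proof.
move=> hd; pose Q m := `[< exists k, size (gram_schmidt v k) = m >].
have exQ : exists m, Q m by exists 0%N; apply/asboolP; exists 0%N.
have bQ m : Q m -> (m <= d)%N by move=> /asboolP[k <-].
case: (ex_maxnP exQ bQ) => m /asboolP[k0 mk] hm; exists k0 => k k0k.
have sz : size (gram_schmidt v k) = size (gram_schmidt v k0).
  apply/eqP; rewrite eqn_leq (gram_schmidt_size v k0k) mk hm //.
  by apply/asboolP; exists k.
apply: (@eq_from_nth _ 0) => // i; rewrite sz => ik.
by case: (gram_schmidt_nth k0k ik).
Qed.

Definition gram_schmidt_set v : set V := [set u | exists k, u \in gram_schmidt v k].

Lemma gram_schmidt_set_ons v : (forall k, D (v k)) ->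
  (forall u, gram_schmidt_set v u -> dot u u = 1) /\
  (forall u w, gram_schmidt_set v u -> gram_schmidt_set v w -> u <> w -> dot u w = 0).
Proof.
move=> dv; split=> [u [k uk]|u w [k uk] [l wl] uw].
  have [_ o] := gram_schmidt_ons k dv.
  by rewrite -(nth_index 0 uk) o ?index_mem // eqxx.
have [_ o] := gram_schmidt_ons (maxn k l) dv.
have iu : (index u (gram_schmidt v k) < size (gram_schmidt v k))%N by rewrite index_mem.
have iw : (index w (gram_schmidt v l) < size (gram_schmidt v l))%N by rewrite index_mem.
have [u1 u2] := gram_schmidt_nth (leq_maxl k l) iu.
have [w1 w2] := gram_schmidt_nth (leq_maxr k l) iw.
rewrite -(nth_index 0 uk) -(nth_index 0 wl) -u2 -w2 o //.
case: eqP => // e; case: uw.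
by rewrite -(nth_index 0 uk) -(nth_index 0 wl) -u2 -w2 e.
Qed.

(** The right-hand side is an initial segment of the integers, finite or not. Indexing is injective
    because distinct positions hold orthogonal vectors of norm 1. *)
Lemma gram_schmidt_set_card v : (forall k, D (v k)) ->
  (gram_schmidt_set v #= [set m | exists k, (m < size (gram_schmidt v k))%N])%card.
Proof.
move=> dv; set S := [set m | _].
have /choice[K hK] : forall m, exists k, S m -> (m < size (gram_schmidt v k))%N.
  by move=> m; have [[k km]|nS] := pselect (S m); [exists k|exists 0%N => /nS].
pose G m := (gram_schmidt v (K m))`_m.
have GE m k : (m < size (gram_schmidt v k))%N -> G m = (gram_schmidt v k)`_m.
  move=> mk; have mK : (m < size (gram_schmidt v (K m)))%N by apply: hK; exists k.
  have [_ e1] := gram_schmidt_nth (leq_maxl (K m) k) mK.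
  by have [_ e2] := gram_schmidt_nth (leq_maxr (K m) k) mk; rewrite /G -e1 -e2.
have -> : gram_schmidt_set v = G @` S.
  apply/seteqP; split=> [u [k uk]|u [m [k mk] <-]].
    have iu : (index u (gram_schmidt v k) < size (gram_schmidt v k))%N by rewrite index_mem.
    by exists (index u (gram_schmidt v k)); [exists k|rewrite (GE _ k) // nth_index].
  by exists k; rewrite (GE _ k) //; exact: mem_nth.
apply: inj_card_eq => m m'; rewrite !inE => -[k mk] [k' mk'].
have [m1 m2] := gram_schmidt_nth (leq_maxl k k') mk.
have [m1' m2'] := gram_schmidt_nth (leq_maxr k k') mk'.
rewrite (GE _ _ m1) (GE _ _ m1') => e.
have [_ o] := gram_schmidt_ons (maxn k k') dv.
have := o _ _ m1 m1'; rewrite -e o // eqxx.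
by case: (m =P m') => // _ /eqP; rewrite oner_eq0.
Qed.

(** Bounded lengths freeze the list at some stage; the residual of [x] is then orthogonal to every
    [v k], hence null by totality. *)
Lemma gram_schmidt_spanned v (P : V -> Prop) (d : nat) :
  linear_closed_set P -> (forall x, P x -> D x) -> (forall k, P (v k)) ->
  (forall x, P x -> (forall k, dot (v k) x = 0) -> dot x x = 0) ->
  (forall k, (size (gram_schmidt v k) <= d)%N) ->
  exists k0, forall x, P x -> spanned (gram_schmidt v k0) x.
Proof.
move=> [P0 PP] PD Pv tot hd; have [k0 hk0] := gram_schmidt_stable hd.
have dv k : D (v k) by apply: PD.
exists k0 => x Px; set L := gram_schmidt v k0.
have oL : orthonormal_seq L by exact: gram_schmidt_ons.
have PL u : u \in L -> P u by exact: gram_schmidt_ind.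
have dx := PD _ Px; have dp := D_proj_seq x oL.
apply: spanned_residual => //; set r := x - proj_seq L x.
have Pr : P r.
  rewrite /r addrC -scaleN1r; apply: (PP) => //.
  apply: (big_ind P) => // [u w Pu Pw|i _]; first by rewrite -[u]scale1r; exact: (PP).
  by rewrite -[_ *: _]addr0; apply: (PP) => //; apply: PL; exact: mem_nth.
apply: tot => // k.
apply: (@gram_schmidt_orth v (maxn k0 k.+1)) => //; [exact: PD|exact: leq_maxr|].
rewrite hk0 ?leq_maxl // => i iL.
rewrite (dotC (semi_innerB dx dp)); last exact: ons_D.
by rewrite dot_residual ?rmorph0.
Qed.

End GramSchmidt.

(** * Vector-valued functions and model spaces *)

Section VectorFunctions.
Variable R : realType.
Local Notation C := R[i].
Local Notation adj M := (M ^t*)%sesqui.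

Definition L2mx m n (F : C -> 'M[C]_(m, n)) : Prop := forall i j, L2 (fun z => F z i j).

Definition Linftymx m n (F : C -> 'M[C]_(m, n)) : Prop := forall i j, Linfty (fun z => F z i j).

Lemma adjE m n (M : 'M[C]_(m, n)) i j : adj M i j = Num.conj (M j i).
Proof. by rewrite !mxE. Qed.

Lemma adjK m n (M : 'M[C]_(m, n)) : adj (adj M) = M.
Proof. by apply/matrixP => i j; rewrite !adjE conjCK. Qed.

Lemma adjM m n p (M : 'M[C]_(m, n)) (N : 'M[C]_(n, p)) : adj (M *m N) = adj N *m adj M.
Proof.
apply/matrixP => i j; rewrite adjE !mxE conjc_sum; apply: eq_bigr => k _.
by rewrite conjcM !adjE mulrC.
Qed.

Lemma H2mx_L2mx m n (F : C -> 'M[C]_(m, n)) : H2mx F -> L2mx F.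
Proof. by move=> hF i j; exact: H2_L2. Qed.

Lemma Hinftymx_Linftymx m n (F : C -> 'M[C]_(m, n)) : Hinftymx F -> Linftymx F.
Proof. by move=> hF i j; case: (hF i j). Qed.

Lemma Hinftymx_H2mx m n (F : C -> 'M[C]_(m, n)) : Hinftymx F -> H2mx F.
Proof. by move=> hF i j; case: (hF i j). Qed.

Lemma Linftymx_adj m n (F : C -> 'M[C]_(m, n)) : Linftymx F ->
  Linftymx (fun z => adj (F z)).
Proof. by move=> hF i j; under eq_fun do rewrite adjE; exact: Linfty_conj. Qed.

Lemma L2mx_mull m n p (F : C -> 'M[C]_(m, n)) (G : C -> 'M[C]_(n, p)) :
  Linftymx F -> L2mx G -> L2mx (fun z => F z *m G z).
Proof.
move=> hF hG i j; under eq_fun do rewrite mxE.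
apply: L2_sum => k; under eq_fun do rewrite mulrC; exact: L2M_Linfty.
Qed.

Lemma H2mx_mull m n p (F : C -> 'M[C]_(m, n)) (G : C -> 'M[C]_(n, p)) :
  Hinftymx F -> H2mx G -> H2mx (fun z => F z *m G z).
Proof.
move=> hF hG i j; under eq_fun do rewrite mxE.
apply: H2_sum => k; under eq_fun do rewrite mulrC; exact: H2M.
Qed.

Lemma H2mxZ m n c (F : C -> 'M[C]_(m, n)) : H2mx F -> H2mx (fun z => c *: F z).
Proof. by move=> hF i j; under eq_fun do rewrite mxE; exact: H2Z. Qed.

Lemma H2mx_cst m n (M : 'M[C]_(m, n)) : H2mx (fun=> M).
Proof. by move=> i j; exact: H2_cst. Qed.

Lemma H2mx_shift m n (F : C -> 'M[C]_(m, n)) (k : nat) : H2mx F -> H2mx (fun z => z ^ k *: F z).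
Proof.
move=> hF i j; under eq_fun do rewrite mxE mulrC; exact: H2_shift.
Qed.

Lemma H2mx_sum m n (J : Type) (s : seq J) (F : J -> C -> 'M[C]_(m, n)) :
  (forall j, H2mx (F j)) -> H2mx (fun z => \sum_(j <- s) F j z).
Proof. by move=> hF i j; under eq_fun do rewrite summxE; apply: H2_sum => k; exact: hF. Qed.

Lemma L2mx_shift m n (F : C -> 'M[C]_(m, n)) (k : int) : L2mx F -> L2mx (fun z => z ^ k *: F z).
Proof.
move=> hF i j; under eq_fun do rewrite mxE mulrC; apply: L2M_Linfty => //; exact: Linfty_pow.
Qed.

Lemma aeT_mxP m n (F G : C -> 'M[C]_(m, n)) :
  (forall i j, aeT (fun z => F z i j = G z i j)) -> aeT (fun z => F z = G z).
Proof.
move=> h; have : aeT (fun z => forall i j, F z i j = G z i j).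
  by apply: aeT_forall => i; apply: aeT_forall => j; exact: h.
by apply: aeTS => t e; apply/matrixP.
Qed.

Section Dot.
Variable n : nat.
Local Notation V := (C -> 'cV[C]_n).
Implicit Types f g h : V.

Lemma dotT_sum f g : L2mx f -> L2mx g ->
  dotT f g = \sum_(i < n) intT (fun z => f z i 0 * Num.conj (g z i 0)).
Proof. by move=> hf hg; rewrite /dotT intT_sum // => i; apply: L2M => //; exact: L2_conj. Qed.

Lemma eq_dotT f f' g g' : (forall t, f (expi t) = f' (expi t)) ->
  (forall t, g (expi t) = g' (expi t)) -> dotT f g = dotT f' g'.
Proof. by move=> ff gg; apply: eq_intT => t; rewrite ff gg. Qed.

Lemma aeT_dotT f f' g : L2mx f -> L2mx f' -> L2mx g -> aeT (fun z => f z = f' z) ->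
  dotT f g = dotT f' g.
Proof.
move=> hf hf' hg ff; apply: aeT_intT.
- apply: L1_measurable; apply: L1_sum => i; apply: L2M => //; exact: L2_conj.
- apply: L1_measurable; apply: L1_sum => i; apply: L2M => //; exact: L2_conj.
- by apply: aeTS ff => t ->.
Qed.

Lemma dotT_eq0 f : L2mx f -> dotT f f = 0 -> aeT (fun z => f z = 0).
Proof.
move=> hf; rewrite dotT_sum // => /eqP; rewrite psumr_eq0 => [/allP h|i _]; last first.
  by apply: intT_sqr_ge0.
apply: aeT_mxP => i j; rewrite (ord1 j).
have /eqP := h i (mem_index_enum _) => /(intT_sqr_eq0 (hf i 0)).
by apply: aeTS => t ->; rewrite mxE.
Qed.

Lemma dotT_null f g : L2mx f -> L2mx g -> aeT (fun z => f z = 0) -> dotT f g = 0.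
Proof.
move=> hf hg f0; rewrite (@aeT_dotT f (fun=> 0) g) //; last by move=> i j;
  under eq_fun do rewrite mxE; exact: L2_cst.
by rewrite -[RHS]intT0; apply: eq_intT => t; apply: big1 => i _; rewrite mxE mul0r.
Qed.

Lemma semi_inner_dotT : semi_inner (@L2mx n 1) (@dotT R n).
Proof.
have lP a f g : L2mx f -> L2mx g -> L2mx (a *: f + g).
  move=> hf hg i j; rewrite (_ : (fun z => _) = fun z => a * f z i j + g z i j).
    by apply: L2D => //; exact: L2Z.
  by apply/funext => z; rewrite !mxE.
split=> //.
- move=> i j; rewrite (_ : (fun z => _) = fun=> 0); first exact: L2_cst.
  by apply/funext => z; rewrite mxE.
- move=> a f g h hf hg hh; rewrite !dotT_sum //; last exact: lP.
  rewrite mulr_sumr -big_split /=; apply: eq_bigr => i _.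
  have l1 := L2M (hf i 0) (L2_conj (hh i 0)); have l2 := L2M (hg i 0) (L2_conj (hh i 0)).
  rewrite -intTZ // -intTD //; last exact: L1Z.
  by apply: eq_intT => t; rewrite !mxE; ring.
- move=> f g hf hg; rewrite !dotT_sum // conjc_sum; apply: eq_bigr => i _.
  rewrite -intT_conj; last by apply: L2M => //; exact: L2_conj.
  by apply: eq_intT => t; rewrite conjcM conjCK mulrC.
- by move=> f hf; rewrite dotT_sum // sumr_ge0 // => i _; exact: intT_sqr_ge0.
- by move=> f g hf hg /(dotT_eq0 hf); exact: dotT_null.
Qed.

Lemma dotT_adj m (f : C -> 'cV[C]_m) (T : C -> 'M[C]_(m, n)) g :
  dotT f (fun z => T z *m g z) = dotT (fun z => adj (T z) *m f z) g.
Proof.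
apply: eq_intT => t.
transitivity ((adj (T (expi t) *m g (expi t)) *m f (expi t)) 0 0).
  by rewrite mxE; apply: eq_bigr => i _; rewrite adjE mulrC.
rewrite adjM -mulmxA [LHS]mxE; apply: eq_bigr => i _; by rewrite adjE mulrC.
Qed.

Lemma dotT_shift (k : int) f g :
  dotT (fun z => z ^ k *: f z) g = dotT f (fun z => z ^ (- k) *: g z).
Proof.
apply: eq_intT => t; apply: eq_bigr => i _; rewrite !mxE conjcM conj_expiX opprK; ring.
Qed.

Lemma dotT_fourier f (k : int) i :
  dotT f (fun z => z ^ k *: delta_mx i 0) = fourier (fun z => f z i 0) k.
Proof.
apply: eq_intT => t; rewrite (bigD1 i) //= big1 ?addr0.
  by rewrite !mxE !eqxx mulr1 conj_expiX.
by move=> j ji; rewrite !mxE (negPf ji) mulr0 rmorph0 mulr0.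
Qed.

Lemma fourier0_ae f : L2mx f -> (forall i k, fourier (fun z => f z i 0) k = 0) ->
  aeT (fun z => f z = 0).
Proof.
move=> hf f0; apply: aeT_mxP => i j; rewrite (ord1 j).
have := fourier_uniqueness (L2_L1 (hf i 0)) (f0 i).
by apply: aeTS => t ->; rewrite mxE.
Qed.

Definition H2neg f := L2mx f /\ forall i (k : int), 0 <= k -> fourier (fun z => f z i 0) k = 0.

(** The conjugates of the entries of [f] are in [H2] with mean 0, which is the situation of
    [H2_orthogonal]. *)
Lemma H2neg_orthogonal f g : H2neg f -> H2mx g -> dotT f g = 0.
Proof.
move=> [hf f0] hg; rewrite dotT_sum //; last exact: H2mx_L2mx.
apply: big1 => i _.
have h : intT (fun z => g z i 0 * Num.conj (f z i 0)) = 0.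
  apply: H2_orthogonal => //.
    split; first exact: L2_conj.
    by move=> k k0; rewrite fourier_conj ?f0 ?rmorph0 ?oppr_ge0 ?ltW //; exact: L2_L1.
  by rewrite fourier_conj ?f0 ?rmorph0 //; exact: L2_L1.
rewrite -[RHS]conjC0 -h -intT_conj; last by apply: L2M; [exact: H2_L2|exact: L2_conj].
by apply: eq_intT => t; rewrite conjcM conjCK mulrC.
Qed.

Lemma dotT_H2_neg h (k : nat) (c : 'cV[C]_n) : H2mx h ->
  dotT h (fun z => z ^ (- k.+1%:Z) *: c) = 0.
Proof.
move=> hh; rewrite dotT_sum; last 2 first.
- exact: H2mx_L2mx.
- by apply: L2mx_shift => i j; exact: L2_cst.
apply: big1 => i _.
rewrite (eq_intT (g := fun z => Num.conj (c i 0) * (h z i 0 * z ^ k.+1))); last first.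
  by move=> t; rewrite !mxE conjcM conj_expiX opprK; ring.
rewrite intTZ; last by apply: L1_pow; exact: H2_L1.
have := hh i 0 => -[_ /(_ (- k.+1%:Z))]; rewrite /fourier opprK => ->; rewrite ?mulr0 //.
Qed.

End Dot.
End VectorFunctions.

(** * A total sequence and an orthonormal basis in [H(Theta)] *)

Section ModelSpace.
Variables (R : realType) (n : nat).
Local Notation C := R[i].
Local Notation V := (C -> 'cV[C]_n).
Local Notation adj M := (M ^t*)%sesqui.
Variable Theta : C -> 'M[C]_n.
Hypothesis hTheta : inner_fun Theta.
Implicit Types f g x : V.

Let hinf : Hinftymx Theta. Proof. by case: hTheta. Qed.
Let linf : Linftymx Theta := Hinftymx_Linftymx hinf.

Lemma inner_coisometry : aeT (fun z => Theta z *m adj (Theta z) = 1%:M).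
Proof. by case: hTheta => _; apply: aeTS => t; exact: mulmx1C. Qed.

Lemma model_space_H2 x : model_space Theta x -> H2mx x.
Proof. by case. Qed.

Lemma model_space_L2 x : model_space Theta x -> L2mx x.
Proof. by case=> /H2mx_L2mx. Qed.

Lemma L2mx_adj_inner x : L2mx x -> L2mx (fun z => adj (Theta z) *m x z).
Proof. by apply: L2mx_mull; exact: Linftymx_adj. Qed.

Lemma dotT_inner f g : L2mx f -> L2mx g ->
  dotT (fun z => Theta z *m f z) (fun z => Theta z *m g z) = dotT f g.
Proof.
move=> hf hg; rewrite dotT_adj; apply: aeT_dotT => //.
  by apply: L2mx_adj_inner; exact: L2mx_mull.
by case: hTheta => _; apply: aeTS => t h; rewrite mulmxA h mul1mx.
Qed.

(** Testing against [Theta z^k e_i] reads off the coefficients of [Theta^* x]. Membership thus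
    becomes a condition on frequencies, which is how it is checked for Hankel vectors and under the
    flip. *)
Lemma model_spaceP x :
  model_space Theta x <-> H2mx x /\ H2neg (fun z => adj (Theta z) *m x z).
Proof.
split=> -[hx h]; split=> //; last by move=> g hg; rewrite dotT_adj; exact: H2neg_orthogonal.
split; first by apply: L2mx_adj_inner; exact: H2mx_L2mx.
move=> i [] // k _; rewrite -dotT_fourier -dotT_adj; apply: h.
by apply: H2mx_shift; exact: H2mx_cst.
Qed.

Lemma model_space_linear : linear_closed_set (model_space Theta).
Proof.
have sD := semi_inner_dotT R n.
split; first split.
- by move=> i j; apply: eq_H2 (H2_cst 0) => t; rewrite mxE.
- move=> g hg; apply: (dot0l sD); apply: L2mx_mull => //; exact: H2mx_L2mx.
move=> a x y [hx x0] [hy y0]; split.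
  move=> i j; rewrite (_ : (fun z => _) = fun z => a * x z i j + y z i j).
    by apply: H2D => //; exact: H2Z.
  by apply/funext => z; rewrite !mxE.
move=> g hg; rewrite (semi_innerDl sD) ?x0 ?y0 ?mulr0 ?addr0 //; try exact: H2mx_L2mx.
by apply: L2mx_mull => //; exact: H2mx_L2mx.
Qed.

Definition mfourier m p (F : C -> 'M[C]_(m, p)) (k : int) : 'M[C]_(m, p) :=
  \matrix_(i, j) fourier (fun z => F z i j) k.

(* The backward shift [S^*(k+1) Theta e_i]. *)
Definition bshift (k : nat) (i : 'I_n) : V := fun z => z ^ (- k.+1%:Z) *:
  (col i (Theta z) - \sum_(m < k.+1) z ^ m *: col i (mfourier Theta m)).

Lemma fourier_monomial (m k : int) : fourier (fun z : C => z ^ m) k = (k == m)%:R.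
Proof.
rewrite (eq_fourier (g := fun z => 1 * z ^ m)) => [|t]; last by rewrite mul1r.
by rewrite fourier_shift fourier_cst subr_eq0 mulr1.
Qed.

Lemma bshift_H2 k i : H2mx (bshift k i).
Proof.
move=> r s; rewrite (ord1 s).
pose p (z : C) := \sum_(m < k.+1) fourier (fun z => Theta z r i) m * z ^ m.
have hT : H2 (fun z => Theta z r i) by case: (hinf r i).
have lmon (m : 'I_k.+1) : L2 (fun z : C => fourier (fun z => Theta z r i) m * z ^ m).
  by apply: L2Z; exact: L2_pow.
have lp : L2 p by exact: L2_sum.
have lr : L2 (fun z => Theta z r i + (-1) * p z).
  by apply: L2D; [exact: H2_L2|exact: L2Z].
apply: (@eq_H2 _ (fun z => (Theta z r i + (-1) * p z) * z ^ (- k.+1%:Z))).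
  move=> t; rewrite !mxE summxE mulrC; congr (_ * (_ + _)); rewrite mulN1r; congr (- _).
  by apply: eq_bigr => m _; rewrite !mxE mulrC.
split; first by apply: L2M_Linfty => //; exact: Linfty_pow.
move=> l l0; rewrite fourier_shift opprK fourierD; last 2 first.
- exact: H2_L1.
- by apply: L2_L1; exact: L2Z.
rewrite fourierZ; last exact: L2_L1.
rewrite fourier_sum => [|m]; last exact: L2_L1.
have fm (m : 'I_k.+1) : fourier (fun z => fourier (fun z => Theta z r i) m * z ^ m) (l + k.+1%:Z)
    = fourier (fun z => Theta z r i) m * (l + k.+1%:Z == m)%:R.
  by rewrite fourierZ ?fourier_monomial //; apply: L2_L1; exact: L2_pow.
under eq_bigr do rewrite fm.
(* The index [l + k + 1] is at most [k]: either it is negative and both terms vanish, or the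
   truncation [p] has there the same coefficient as [Theta]. *)
have [lk|lk] := ltP (l + k.+1%:Z) 0.
  case: hT => _ -> //; rewrite big1 ?mulr0 ?addr0 // => m _.
  by rewrite (_ : _ == _ = false) ?mulr0 //; apply/negP => /eqP e; rewrite e in lk.
have [m e] : exists m : nat, l + k.+1%:Z = m%:Z.
  by case: (l + k.+1%:Z) lk => // m _; exists m.
have mk : (m < k.+1)%N by rewrite -ltz_nat -e gtrDr.
rewrite e.
rewrite (bigD1 (Ordinal mk)) //= eqxx mulr1 big1 ?addr0 ?mulN1r ?subrr // => j jm.
rewrite (_ : _ == _ = false) ?mulr0 //; apply/negP => /eqP[ej].
by move/eqP: jm; apply; exact/val_inj.
Qed.

(** [bshift k i] differs from [Theta z^-(k+1) e_i] by a combination of negative powers of [z], to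
    which the analytic [f] is orthogonal. *)
Lemma dot_bshift f k i : H2mx f ->
  dotT f (bshift k i) = fourier (fun z => (adj (Theta z) *m f z) i 0) (- k.+1%:Z).
Proof.
move=> hf; have sD := semi_inner_dotT R n.
rewrite -dotT_fourier -dotT_adj.
pose q (m : 'I_k.+1) : V := fun z => z ^ (m%:Z - k.+1%:Z) *: col i (mfourier Theta m).
have lq m : L2mx (q m) by apply: L2mx_shift => r s; exact: L2_cst.
pose w : V := fun z => Theta z *m (z ^ (- k.+1%:Z) *: delta_mx i 0).
have lw : L2mx w.
  by apply: L2mx_mull => //; apply: L2mx_shift => r s; exact: L2_cst.
have e t : bshift k i (expi t) = (w - \sum_(m < k.+1) q m) (expi t).
  rewrite -[RHS]/(w (expi t) - (\sum_(m < k.+1) q m) (expi t)).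
  rewrite /bshift scalerBr colE scalemxAr; congr (_ - _).
  rewrite fct_sumE scaler_sumr; apply: eq_bigr => m _; rewrite /q scalerA.
  by rewrite expfzDr ?expi_neq0 // mulrC.
rewrite (eq_dotT (f' := f) (g' := w - \sum_(m < k.+1) q m)) //.
have lf := H2mx_L2mx hf.
have ls : L2mx (\sum_(m < k.+1) q m) by exact: (semi_inner_sum sD).
rewrite (dotBr sD) // (dot_sumr sD) // big1 ?subr0 // => m _.
have mk : (m%:Z - k.+1%:Z)%R = - (k - m).+1%:Z.
  have := ltn_ord m; rewrite ltnS => mk; rewrite -subSn // -subzn ?opprB //.
  exact: leqW.
by rewrite /q mk dotT_H2_neg.
Qed.

Lemma bshift_model_space k i : model_space Theta (bshift k i).
Proof.
split; first exact: bshift_H2.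
move=> g hg; have sD := semi_inner_dotT R n.
have hTg : H2mx (fun z => Theta z *m g z) by exact: H2mx_mull.
rewrite (semi_innerC sD); try exact/H2mx_L2mx/bshift_H2; try exact: H2mx_L2mx.
rewrite dot_bshift // -dotT_fourier -dotT_adj dotT_inner; last 2 first.
- exact: H2mx_L2mx.
- by apply: L2mx_shift => r s; exact: L2_cst.
by rewrite dotT_H2_neg // rmorph0.
Qed.

(** The pairings are the negative coefficients of [Theta^* x], and the others vanish because [x] is
    in [H(Theta)]. So [Theta^* x = 0] a.e., and [Theta] is a.e. unitary. *)
Lemma model_space_sep x : model_space Theta x ->
  (forall k i, dotT x (bshift k i) = 0) -> dotT x x = 0.
Proof.
move=> mx h; have lx := model_space_L2 mx.
have [hx [lu u0]] := (model_spaceP x).1 mx.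
apply: dotT_null => //.
have : aeT (fun z => adj (Theta z) *m x z = 0).
  apply: fourier0_ae => // i k; have [k0|k0] := leP 0 k; first exact: u0.
  case: k k0 => // k _; have := h k i; rewrite dot_bshift //.
move=> /(aeT_and inner_coisometry); apply: aeTS => t [e1 e2].
by rewrite -[LHS]mul1mx -e1 -mulmxA e2 mulmx0.
Qed.

(** Codes that name no pair give 0, whose residual is null and which Gram-Schmidt therefore
    skips. *)
Definition bshift_seq (a : nat) : V :=
  if unpickle a is Some (k, i) then bshift k i else 0.

Lemma bshift_seq_model_space a : model_space Theta (bshift_seq a).
Proof.
rewrite /bshift_seq; case: (unpickle a) => [[k i]|]; first exact: bshift_model_space.
by case: model_space_linear.
Qed.

Lemma bshift_seq_sep x : model_space Theta x ->
  (forall a, dotT x (bshift_seq a) = 0) -> dotT x x = 0.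
Proof.
move=> mx h; apply: model_space_sep => // k i.
by have := h (pickle (k, i)); rewrite /bshift_seq pickleK.
Qed.

Lemma orthonormal_basis_gram_schmidt :
  orthonormal_basis (model_space Theta) (gram_schmidt_set (@dotT R n) bshift_seq).
Proof.
have sD := semi_inner_dotT R n.
have lv k : L2mx (bshift_seq k) by apply: model_space_L2; exact: bshift_seq_model_space.
have [ob1 ob2] := gram_schmidt_set_ons sD lv.
split=> //.
- move=> u [k]; apply: gram_schmidt_ind => //; first exact: model_space_linear.
  exact: bshift_seq_model_space.
- move=> f mf h; have lf := model_space_L2 mf.
  apply: dotT_eq0 => //; apply: bshift_seq_sep => // a.
  rewrite (semi_innerC sD) // (gram_schmidt_orth sD (k := a.+1) (j := a)) ?rmorph0 //.
  move=> i ia; rewrite (semi_innerC sD) //; last by apply: (ons_D sD);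
    exact: (gram_schmidt_ons sD).
  rewrite h ?rmorph0 //; exists a.+1; exact: mem_nth.
Qed.

End ModelSpace.

(** * Hankel vectors *)

Section HankelVectors.
Variables (R : realType) (n : nat).
Local Notation C := R[i].
Local Notation V := (C -> 'cV[C]_n).
Local Notation adj M := (M ^t*)%sesqui.
Variables Phi A Theta : C -> 'M[C]_n.
Hypotheses (hPhi : H2mx Phi) (hA : H2mx A) (hTheta : inner_fun Theta).
Hypothesis PhiE : aeT (fun z => Phi z = adj (A z) *m Theta z).

Let hinf : Hinftymx Theta. Proof. by case: hTheta. Qed.
Let linf : Linftymx Theta := Hinftymx_Linftymx hinf.

(** The analytic part of [z^j Phi^* e_i]: coefficient [k] of [Phi] occurs there at frequency
    [j - k], so only [k <= j] survive. *)
Definition hpoly (j : nat) (i : 'I_n) : V := fun z =>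
  \sum_(k < j.+1) z ^ (j - k)%N *: col i (adj (mfourier Phi k)).

(* [Theta] times the antianalytic part of [z^j Phi^* e_i]. *)
Definition hankel_vec (j : nat) (i : 'I_n) : V := fun z =>
  z ^ j *: col i (A z) - Theta z *m hpoly j i z.

Lemma hpoly_H2 j i : H2mx (hpoly j i).
Proof. by apply: H2mx_sum => k; apply: H2mx_shift; exact: H2mx_cst. Qed.

Lemma hankel_vec_H2 j i : H2mx (hankel_vec j i).
Proof.
have hc : H2mx (fun z => col i (A z)).
  by move=> r s; under eq_fun do rewrite mxE; exact: hA.
have h1 := H2mx_shift j hc; have h2 := H2mx_mull hinf (hpoly_H2 j i).
move=> r s; rewrite (_ : (fun z => _) = fun z =>
  (z ^ j *: col i (A z)) r s + (-1) * (Theta z *m hpoly j i z) r s).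
  by apply: H2D => //; exact: H2Z.
by apply/funext => z; rewrite mulN1r !mxE.
Qed.

(** From [Phi = A^* Theta] follows [Theta^* A = Phi^*] a.e., so [Theta^*] turns the Hankel vector
    into [z^j Phi^* e_i] minus its analytic part. *)
Lemma hankel_vec_fourier j i r l :
  fourier (fun z => (adj (Theta z) *m hankel_vec j i z) r 0) l =
  if 0 <= l then 0 else Num.conj (fourier (fun z => Phi z i r) (j%:Z - l)).
Proof.
pose p (z : C) := \sum_(k < j.+1) Num.conj (fourier (fun z => Phi z i r) k) * z ^ (j - k)%N.
have lPhi : H2 (fun z => Phi z i r) by [].
have lmon (k : 'I_j.+1) : L2 (fun z : C => Num.conj (fourier (fun z =>
  Phi z i r) k) * z ^ (j - k)%N).
  by apply: L2Z; exact: L2_pow.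
have lp : L2 p by exact: L2_sum.
have lc : L2 (fun z => Num.conj (Phi z i r)) by apply: L2_conj; exact: H2_L2.
have lg : L2 (fun z => Num.conj (Phi z i r) * z ^ j + (-1) * p z).
  by apply: L2D; [apply: L2M_Linfty => //; exact: Linfty_pow|exact: L2Z].
rewrite (@aeT_fourier _ _ (fun z => Num.conj (Phi z i r) * z ^ j + (-1) * p z)); last 3 first.
- by apply/L2_measurable/L2mx_adj_inner/H2mx_L2mx/hankel_vec_H2.
- exact: L2_measurable.
- move: PhiE => /(aeT_and (proj2 hTheta)); apply: aeTS => t [e1 e2].
  rewrite /hankel_vec mulmxBr mulmxA e1 mul1mx -scalemxAr.
  have -> : adj (Theta (expi t)) *m col i (A (expi t)) = col i (adj (Phi (expi t))).
    by rewrite e2 adjM adjK !colE mulmxA.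
  rewrite !mxE summxE mulrC; congr (_ * _ + _); rewrite mulN1r; congr (- _).
  by apply: eq_bigr => k _; rewrite !mxE mulrC.
rewrite fourierD; last 2 first.
- by apply: L1_pow; exact: L2_L1.
- by apply: L2_L1; exact: L2Z.
rewrite fourierZ; last exact: L2_L1.
rewrite fourier_shift fourier_conj; last exact: H2_L1.
rewrite fourier_sum => [|k]; last exact: L2_L1.
have fm (k : 'I_j.+1) : fourier (fun z => Num.conj (fourier (fun z =>
  Phi z i r) k) * z ^ (j - k)%N) l
    = Num.conj (fourier (fun z => Phi z i r) k) * (l == (j - k)%N)%:R.
  by rewrite fourierZ ?fourier_monomial //; apply: L2_L1; exact: L2_pow.
under eq_bigr do rewrite fm.
rewrite opprB {fm}; case: (leP 0 l) => [|l0]; last first.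
  rewrite big1 ?mulr0 ?addr0 // => k _; rewrite (_ : _ == _ = false) ?mulr0 //.
  by apply/negP => /eqP e; rewrite e in l0.
(* For [m <= j] the term [k = j - m] of [hpoly] cancels the coefficient; for [m > j] the index
   [j - m] is negative and [Phi] is analytic. *)
case: l => // m _; have [mj|jm] := leqP m j.
  have km : (j - m < j.+1)%N by rewrite ltnS leq_subr.
  rewrite (bigD1 (Ordinal km)) //= subKn // eqxx mulr1 big1 ?addr0.
    by rewrite subzn // mulN1r subrr.
  move=> k kE; rewrite (_ : _ == _ = false) ?mulr0 //; apply/negP => /eqP[e].
  move/eqP: kE; apply; apply/val_inj; rewrite /= e subKn //.
  by have := ltn_ord k; rewrite ltnS.
rewrite big1 ?mulr0 ?addr0; last first.
  move=> k _; rewrite (_ : _ == _ = false) ?mulr0 //; apply/negP => /eqP[e].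
  by move: jm; rewrite e ltnNge leq_subr.
by case: lPhi => _ -> //; rewrite ?rmorph0 // subr_lt0 ltz_nat.
Qed.

Lemma hankel_vec_model_space j i : model_space Theta (hankel_vec j i).
Proof.
apply/(model_spaceP hTheta); split; first exact: hankel_vec_H2.
split; first by apply: L2mx_adj_inner => //; exact/H2mx_L2mx/hankel_vec_H2.
by move=> r k k0; rewrite hankel_vec_fourier k0.
Qed.

(** A Hankel entry, depending on [Phi] and [j + k] only: this makes two model spaces comparable. *)
Lemma dot_hankel_bshift j i k r : dotT (hankel_vec j i) (bshift Theta k r) =
  Num.conj (fourier (fun z => Phi z i r) (j + k).+1).
Proof.
rewrite dot_bshift //; last exact: hankel_vec_H2.
by rewrite hankel_vec_fourier /= opprK -PoszD addnS.
Qed.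

(** Multiplication by [z] moves the coefficient at frequency -1 to frequency 0, where it joins the
    analytic part. Hence [z E] lies in [Theta C^n + E]. *)
Lemma hankel_vec_shift j i t :
  expi t *: hankel_vec j i (expi t) = hankel_vec j.+1 i (expi t) +
    Theta (expi t) *m col i (adj (mfourier Phi j.+1)).
Proof.
rewrite /hankel_vec scalerBr scalerA -exprSz -addrA; congr (_ + _).
rewrite -mulmxN -mulmxDr scalemxAr -mulmxN; congr (_ *m _).
rewrite /hpoly [in RHS]big_ord_recr /= subnn expr0z scale1r opprD addrNK.
congr (- _); rewrite scaler_sumr; apply: eq_bigr => k _.
by rewrite scalerA -exprSz subSn // -ltnS ltn_ord.
Qed.

Definition hankel_seq (a : nat) : V :=
  if unpickle a is Some (j, i) then hankel_vec j i else 0.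

Lemma hankel_seq_model_space a : model_space Theta (hankel_seq a).
Proof.
rewrite /hankel_seq; case: (unpickle a) => [[k i]|]; first exact: hankel_vec_model_space.
by case: (model_space_linear hTheta).
Qed.

End HankelVectors.

(** The rows orthogonal to those of [Z] form the kernel of the adjoint, of dimension [(n + s) - s];
    a basis of it is orthonormalized. *)
Lemma orthonormal_completion (C : numClosedFieldType) (s n : nat) (Z : 'M[C]_(s, n + s)) :
  Z *m (Z ^t*)%sesqui = 1%:M ->
  exists Y : 'M[C]_(n, n + s), Y *m (Y ^t*)%sesqui = 1%:M /\ Z *m (Y ^t*)%sesqui = 0.
Proof.
move=> ZZ; pose K := kermx (Z ^t*)%sesqui.
have rZ : \rank (Z ^t*)%sesqui = s.
  apply/eqP; rewrite eqn_leq rank_leq_col /=.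
  by rewrite -{1}(mxrank1 C s) -ZZ mxrankM_maxr.
have rK : \rank K = n by rewrite mxrank_ker rZ addnK.
have rle : (\rank K <= n + s)%N by rewrite rK leq_addr.
(* The row count is abstracted to [m] because the rank of [K] equals [n] only propositionally. *)
have [m [Y [mn YY KY]]] : exists m (Y : 'M[C]_(m, n + s)),
    [/\ m = n, Y *m (Y ^t*)%sesqui = 1%:M & (Y <= K)%MS].
  exists (\rank K), (schmidt (row_base K)); split=> //.
    by apply/unitarymxP; exact: schmidt_unitarymx.
  by rewrite (eqmx_schmidt_free (row_base_free K)) eq_row_base.
move: Y YY KY; rewrite mn => Y YY /sub_kermxP YZ; exists Y; split=> //.
apply/matrixP => i j; have := congr1 (fun M : 'M[C]_(n, s) => M j i) YZ.
rewrite !mxE => /(congr1 Num.conj); rewrite rmorph0 => e; rewrite -[RHS]e [in RHS]rmorph_sum.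
have h (x y : C) : x * Num.conj y = Num.conj (y * Num.conj x) by rewrite rmorphM /= conjCK mulrC.
by apply: eq_bigr => k _; rewrite !mxE; exact: h.
Qed.

(** * Coprimeness makes the Hankel vectors total *)

Section HankelTotal.
Variables (R : realType) (n : nat).
Local Notation C := R[i].
Local Notation V := (C -> 'cV[C]_n).
Local Notation adj M := (M ^t*)%sesqui.
Variables Phi A Theta : C -> 'M[C]_n.
Hypotheses (hPhi : H2mx Phi) (hA : H2mx A) (hTheta : inner_fun Theta).
Hypothesis PhiE : aeT (fun z => Phi z = adj (A z) *m Theta z).

Local Notation dot := (@dotT R n).
Local Notation es := (hankel_seq Phi A Theta).
Variable k0 : nat.
Local Notation L := (gram_schmidt dot es k0).
Hypothesis spanL : forall a, spanned (@L2mx R n 1) dot L (es a).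

Let sD := semi_inner_dotT R n.
Let hinf : Hinftymx Theta. Proof. by case: hTheta. Qed.
Let linf : Linftymx Theta := Hinftymx_Linftymx hinf.
Let s := size L.

Let es_model a : model_space Theta (es a).
Proof. exact: (hankel_seq_model_space hPhi hA hTheta PhiE). Qed.

Let es_L2 a : L2mx (es a).
Proof. exact: model_space_L2 (es_model a). Qed.

Let oL : orthonormal_seq (@L2mx R n 1) dot L.
Proof. exact: gram_schmidt_ons. Qed.

Let L_model (p : 'I_s) : model_space Theta L`_p.
Proof.
have : L`_p \in L by apply: mem_nth.
by apply: gram_schmidt_ind => //; exact: model_space_linear.
Qed.

Let thetaC (c : 'cV[C]_n) : V := fun z => Theta z *m c.

Let thetaC_H2 c : H2mx (thetaC c).
Proof. by apply: H2mx_mull => //; exact: H2mx_cst. Qed.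

(* [w] is an orthonormal basis of the finite-dimensional space
   [Theta C^n + span L]. *)
Let w (r : 'I_(n + s)) : V :=
  match fintype.split r with inl i => thetaC (delta_mx i 0) | inr p => L`_p end.

Let w_H2 r : H2mx (w r).
Proof.
rewrite /w; case: (fintype.split r) => [i|p]; first exact: thetaC_H2.
exact: model_space_H2 (L_model p).
Qed.

Let w_L2 r : L2mx (w r). Proof. exact/H2mx_L2mx. Qed.

Let shiftv (k : int) (f : V) : V := fun z => z ^ k *: f z.

Let shiftv_L2 k f : L2mx f -> L2mx (shiftv k f).
Proof. exact: L2mx_shift. Qed.

Let model_thetaC x (k : nat) c : model_space Theta x -> dot (shiftv k (thetaC c)) x = 0.
Proof.
move=> mx; have lx := model_space_L2 mx.
rewrite (semi_innerC sD lx); last exact/shiftv_L2/H2mx_L2mx.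
case: mx => _ h; have := h (fun z => z ^ k *: c) (H2mx_shift k (H2mx_cst c)).
rewrite (@eq_dotT _ _ _ x _ (shiftv k (thetaC c))) => [->|//|t]; first by rewrite rmorph0.
by rewrite /shiftv /thetaC scalemxAr.
Qed.

Let dot_thetaC (k : nat) c i : dot (shiftv k (thetaC c)) (thetaC (delta_mx i 0)) =
  if k == 0%N then c i 0 else 0.
Proof.
rewrite (@eq_dotT _ _ _ (fun z => Theta z *m (z ^ k *: c)) _ (fun z =>
  Theta z *m delta_mx i 0)) //; last first.
  by move=> t; rewrite /shiftv /thetaC scalemxAr.
have lc (d : 'cV[C]_n) : L2mx (fun=> d : 'cV[C]_n) by move=> a b; exact: L2_cst.
rewrite dotT_inner //; last exact: L2mx_shift.
have := dotT_fourier (fun z => z ^ k *: c) 0 i.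
rewrite (@eq_dotT _ _ _ (fun z => z ^ k *: c) _ (fun=> delta_mx i 0)) => [->|//|t]; last first.
  by rewrite expr0z scale1r.
rewrite (eq_fourier (g := fun z => c i 0 * z ^ k)); last by move=> t; rewrite mxE mulrC.
rewrite fourierZ ?fourier_monomial; last by apply: L2_L1; exact: L2_pow.
by rewrite eqz_nat eq_sym; case: eqP; rewrite ?mulr1 ?mulr0.
Qed.

Let dot_w r r' : dot (w r) (w r') = (r == r')%:R.
Proof.
have sh0 f g : dot f g = dot (shiftv 0%N f) g.
  by apply: eq_dotT => // t; rewrite /shiftv expr0z scale1r.
have wl i : w (lshift s i) = thetaC (delta_mx i 0) by rewrite /w (unsplitK (inl _ i)).
have wr p : w (rshift n p) = L`_p by rewrite /w (unsplitK (inr _ p)).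
have LT (p : 'I_s) c : dot (thetaC c) L`_p = 0.
  by rewrite sh0; apply: model_thetaC; exact: L_model.
have TL (p : 'I_s) c : dot L`_p (thetaC c) = 0.
  by rewrite (semi_innerC sD (H2mx_L2mx (thetaC_H2 c)) (model_space_L2 (L_model p))) LT rmorph0.
rewrite -(splitK r) -(splitK r').
case: (fintype.split r) => a; case: (fintype.split r') => b; rewrite ?wl ?wr.
- by rewrite sh0 dot_thetaC mxE (inj_eq (@lshift_inj _ _)) eqxx andbT eq_sym.
- by rewrite LT /= eq_lrshift.
- by rewrite TL /= eq_rlshift.
- by case: oL => _ ->; rewrite ?ltn_ord //= (inj_eq (@rshift_inj _ _)).
Qed.

Let spanW (x : V) := forall y, L2mx y ->
  dot x y = \sum_(r < n + s) dot x (w r) * dot (w r) y.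

Let spanW_linear : linear_closed_set (fun x => L2mx x /\ spanW x).
Proof.
split.
  split; first exact: semi_inner0 sD.
  move=> y ly; rewrite (dot0l sD) // big1 // => r _.
  by rewrite (dot0l sD) ?mul0r.
move=> a x y [lx sx] [ly sy]; split; first exact: (semi_innerP sD).
move=> z lz; rewrite (semi_innerDl sD) // sx // sy // mulr_sumr -big_split /=.
by apply: eq_bigr => r _; rewrite (semi_innerDl sD) // mulrDl mulrA.
Qed.

Let spanW_w r : spanW (w r).
Proof.
move=> y ly; rewrite (bigD1 r) //= big1 ?addr0; first by rewrite dot_w eqxx mul1r.
by move=> r' rr'; rewrite dot_w eq_sym (negPf rr') mul0r.
Qed.

Let spanW_thetaC c : spanW (thetaC c).
Proof.
have -> : thetaC c = \sum_(i < n) c i 0 *: w (lshift s i).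
  apply/funext => z; rewrite fct_sumE /thetaC.
  have -> : c = \sum_(i < n) c i 0 *: delta_mx i 0.
    by rewrite {1}[c]matrix_sum_delta; apply: eq_bigr => i _; rewrite big_ord1.
  rewrite mulmx_sumr; apply: eq_bigr => i _; rewrite -scalemxAr.
  rewrite summxE (bigD1 i) //= !mxE !eqxx mulr1 big1 ?addr0; last first.
    by move=> j ji; rewrite !mxE eq_sym (negPf ji) mulr0.
  by rewrite /w (unsplitK (inl _ i)).
have [P0 PP] := spanW_linear.
suff [] : (fun x => L2mx x /\ spanW x) (\sum_(i < n) c i 0 *: w (lshift s i)) by [].
apply: (big_ind (fun x => L2mx x /\ spanW x)) => // [x y px py|i _].
  by rewrite -[x]scale1r; exact: PP.
by rewrite -[_ *: _]addr0; apply: (PP) => //; split=> //; exact: spanW_w.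
Qed.

Let spanW_es a : spanW (es a).
Proof.
move=> y ly; rewrite big_split_ord /= [X in X + _]big1 ?add0r; last first.
  move=> i _; rewrite /w (unsplitK (inl _ i)).
  have := model_thetaC 0%N (delta_mx i 0) (es_model a).
  rewrite (@eq_dotT _ _ _ (thetaC (delta_mx i 0)) _ (es a)) // => [h|t]; last first.
    by rewrite /shiftv expr0z scale1r.
  by rewrite (semi_innerC sD (H2mx_L2mx (thetaC_H2 _)) (es_L2 a)) h rmorph0 mul0r.
rewrite (spanL a ly); apply: eq_bigr => p _.
by rewrite /w (unsplitK (inr _ p)).
Qed.

Let eq_spanW x y : (forall t, x (expi t) = y (expi t)) -> spanW x -> spanW y.
Proof.
move=> xy sx z lz; rewrite -(@eq_dotT _ _ x y z z) // sx //.
by apply: eq_bigr => r _; rewrite (@eq_dotT _ _ x y (w r) (w r)).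
Qed.

(** [z E] lies in [W]: checked on Hankel vectors by [hankel_vec_shift], then carried to [L] by
    linearity. *)
Let spanW_shift (p : 'I_s) : spanW (shiftv 1 L`_p).
Proof.
pose P x := L2mx x /\ spanW (shiftv 1 x).
suff : P L`_p by case.
have [Q0 QQ] := spanW_linear.
have shiftD a (x y : V) t : (a *: shiftv 1 x + shiftv 1 y) (expi t) = shiftv 1 (a *: x + y)
  (expi t).
  rewrite -[LHS]/(a *: (expi t ^ 1 *: x (expi t)) + expi t ^ 1 *: y (expi t)).
  by rewrite scalerA mulrC -scalerA -scalerDr.
apply: (@gram_schmidt_ind _ _ dot es P _ _ k0); last exact: mem_nth.
- split.
    split; first exact: semi_inner0 sD.
    apply: (@eq_spanW 0); last by case: Q0.
    by move=> t; rewrite /shiftv [RHS]scaler0.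
  move=> a x y [lx sx] [ly sy]; split; first exact: (semi_innerP sD).
  apply: eq_spanW (shiftD a x y) _.
  by have [] := QQ a _ _ (conj (shiftv_L2 1 lx) sx) (conj (shiftv_L2 1 ly) sy).
- move=> a; split; first exact: es_L2.
  rewrite /hankel_seq; case e : (unpickle a) => [[j i]|]; last first.
    by apply: (@eq_spanW 0) => [t|]; [rewrite /shiftv [RHS]scaler0|case: Q0].
  have h1 : spanW (hankel_vec Phi A Theta j.+1 i).
    have := spanW_es (pickle (j.+1, i)).
    by rewrite /hankel_seq pickleK.
  have l1 : L2mx (hankel_vec Phi A Theta j.+1 i).
    exact/H2mx_L2mx/hankel_vec_H2.
  apply: (@eq_spanW (1 *: hankel_vec Phi A Theta j.+1 i + thetaC (col i (adj
    (mfourier Phi j.+1))))).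
    by move=> t; rewrite scale1r /shiftv expr1z hankel_vec_shift.
  have [] := QQ 1 _ _ (conj l1 h1) (conj (H2mx_L2mx (thetaC_H2 (col i (adj
    (mfourier Phi j.+1))))) (spanW_thetaC _)).
  by [].
Qed.

Let dot_shiftv k (x y : V) : dot (shiftv k x) y = dot x (shiftv (- k) y).
Proof. exact: dotT_shift. Qed.

(** Because [z^(k+1) E] lies in [z^k W], orthogonality of [y] to [z^b E] propagates upwards. It
    serves with [b = 1] for the columns of [Delta] and with [b = 0] for a vector orthogonal to
    [E]. *)
Let shift_orthogonal (b : nat) (y : V) : L2mx y ->
  (forall (k : nat) c, (b <= k)%N -> dot (shiftv k (thetaC c)) y = 0) ->
  (forall p : 'I_s, dot (shiftv b L`_p) y = 0) ->
  forall (k : nat) x, (b <= k)%N -> spanW x -> dot (shiftv k x) y = 0.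
Proof.
move=> ly hT hL k x bk sx.
suff hw r : dot (shiftv k (w r)) y = 0.
  rewrite dot_shiftv sx; last exact: shiftv_L2.
  by apply: big1 => r _; rewrite -dot_shiftv hw mulr0.
elim: k bk r => [|k ih] bk r.
  move: bk; rewrite leqn0 => /eqP b0; rewrite /w; case: (fintype.split r) => p.
    by apply: hT; rewrite b0.
  by have := hL p; rewrite b0.
rewrite /w; case: (fintype.split r) => p; first exact: hT.
move: bk; rewrite leq_eqVlt => /orP[/eqP <- //|bk].
rewrite (@eq_dotT _ _ _ (shiftv k (shiftv 1 L`_p)) y y) // => [|t]; last first.
  by rewrite /shiftv scalerA expr1z mulrC -exprSz.
rewrite dot_shiftv spanW_shift; last exact: shiftv_L2.
by apply: big1 => r' _; rewrite -dot_shiftv ih ?mulr0.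
Qed.

(** An [x] in [H(Theta)] orthogonal to [E] is orthogonal to all shifts of the columns of [Delta];
    coprimeness makes these span everything. *)
Lemma hankel_total : left_coprime Theta A ->
  forall x, model_space Theta x -> (forall a, dot (es a) x = 0) -> dot x x = 0.
Proof.
move=> cop x mx ex.
pose Z : 'M[C]_(s, n + s) := \matrix_(p, r) dot (shiftv 1 L`_p) (w r).
have lLp (p : 'I_s) : L2mx L`_p by exact: model_space_L2 (L_model p).
(* Multiplication by [z] is isometric, so the coordinate rows of the vectors [z L] stay
   orthonormal. *)
have ZZ : Z *m adj Z = 1%:M.
  apply/matrixP => p p'; rewrite !mxE.
  transitivity (dot (shiftv 1 L`_p) (shiftv 1 L`_p')).
    rewrite spanW_shift; last exact: shiftv_L2.
    apply: eq_bigr => r _; rewrite !mxE; congr (_ * _).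
    by rewrite [RHS](semi_innerC sD) //; exact: shiftv_L2.
  rewrite dot_shiftv (@eq_dotT _ _ _ L`_p _ L`_p') // => [|t].
    by case: oL => _ ->; rewrite ?ltn_ord.
  by rewrite /shiftv scalerA -expfzDr ?expi_neq0 // addNr expr0z scale1r.
have [Y [YY ZY]] := orthonormal_completion ZZ.
pose delta (q : 'I_n) : V := \sum_(r < n + s) Y q r *: w r.
have deltaE (q : 'I_n) z : delta q z = \sum_(r < n + s) Y q r *: w r z by rewrite /delta fct_sumE.
have delta_H2 q : H2mx (delta q).
  rewrite (_ : delta q = fun z => \sum_(r < n + s) Y q r *: w r z); last exact/funext.
  by apply: H2mx_sum => r; exact: H2mxZ.
have delta_L2 q : L2mx (delta q) by exact: H2mx_L2mx.
have dot_delta y q : L2mx y -> dot y (delta q) = \sum_(r < n + s) dot y (w r) * Num.conj (Y q r).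
  move=> ly; rewrite /delta (dot_sumr sD) // => [|r]; last exact: (semi_innerZ sD).
  by apply: eq_bigr => r _; rewrite (dotZr sD) // mulrC.
have span_delta q : spanW (delta q).
  have [P0 PP] := spanW_linear.
  suff : L2mx (delta q) /\ spanW (delta q) by case.
  apply: (big_ind (fun x => L2mx x /\ spanW x)) => // [u v pu pv|r _].
    by rewrite -[u]scale1r; exact: PP.
  by rewrite -[_ *: _]addr0; apply: (PP) => //; split=> //; exact: spanW_w.
have orth_delta q (k : nat) y : (0 < k)%N -> spanW y -> dot (shiftv k y) (delta q) = 0.
  apply: shift_orthogonal => // [m c m0|p].
  - rewrite dot_delta; last exact/shiftv_L2/H2mx_L2mx.
    apply: big1 => r _; rewrite /w; case: (fintype.split r) => p.
      by rewrite dot_thetaC; case: m m0 => //= m _; rewrite mul0r.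
    by rewrite model_thetaC ?mul0r //; exact: L_model.
  - rewrite dot_delta; last exact: shiftv_L2.
    transitivity ((Z *m adj Y) p q); last by rewrite ZY mxE.
    by rewrite !mxE; apply: eq_bigr => r _; rewrite !mxE.
have gram_delta q q' : dot (delta q) (delta q') = (q == q')%:R.
  rewrite dot_delta //; transitivity ((Y *m adj Y) q q'); last by rewrite YY mxE.
  rewrite mxE; apply: eq_bigr => r _; rewrite !mxE; congr (_ * _).
  rewrite /delta (dot_suml sD) // => [|r']; last exact: (semi_innerZ sD).
  rewrite (bigD1 r) //= big1 ?addr0; first by rewrite (dotZl sD) // dot_w eqxx mulr1.
  by move=> r' rr'; rewrite (dotZl sD) // dot_w (negPf rr') mulr0.
pose Delta z : 'M[C]_n := \matrix_(a, q) delta q z a 0.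
have Delta_H2 : H2mx Delta by move=> a q; under eq_fun do rewrite mxE; exact: delta_H2.
have Delta_inner : aeT (fun z => adj (Delta z) *m Delta z = 1%:M).
  apply: aeT_mxP => q' q.
  have l1 : L1 (fun z => (adj (Delta z) *m Delta z) q' q).
    under eq_fun do rewrite mxE; apply: L1_sum => a; under eq_fun do rewrite adjE mulrC.
    by apply: L2M; [exact: H2_L2|apply: L2_conj; exact: H2_L2].
  have l2 : L1 (fun z => (adj (Delta z) *m Delta z) q' q + - (1%:M : 'M[C]_n) q' q).
    by apply: L1D => //; apply: L2_L1; exact: L2_cst.
  have : aeT (fun z => (adj (Delta z) *m Delta z) q' q + - (1%:M : 'M[C]_n) q' q = 0).
    apply: fourier_uniqueness => // k; rewrite fourierD //; last by apply: L2_L1; exact: L2_cst.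
    rewrite fourier_cst.
    (* Coefficient [k] of an entry of [Delta^* Delta] pairs a column with a shifted column. It
       vanishes for [k != 0] by [orth_delta], so the entry is constant. *)
    have -> : fourier (fun z =>
      (adj (Delta z) *m Delta z) q' q) k = dot (shiftv (- k) (delta q)) (delta q').
      apply: eq_intT => t; rewrite mxE mulr_suml; apply: eq_bigr => a _.
      by rewrite !mxE; ring.
    have [->|kn0] := eqVneq k 0.
      rewrite oppr0 (@eq_dotT _ _ _ (delta q) _ (delta q')) // => [|t].
        by rewrite gram_delta mxE eq_sym mul1r subrr.
      by rewrite /shiftv expr0z scale1r.
    rewrite mul0r addr0; case: k kn0 => [[|k] // _|k _].
      rewrite (semi_innerC sD (delta_L2 q') (shiftv_L2 _ (delta_L2 q))).
      have := orth_delta q k.+1 _ (ltn0Sn k) (span_delta q').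
      by rewrite dot_shiftv => ->; rewrite rmorph0.
    by rewrite NegzE opprK orth_delta.
  by apply: aeTS => t /eqP; rewrite subr_eq0 => /eqP.
have Delta_inf : Hinftymx Delta.
  move=> a q; split; last exact: Delta_H2.
  split; first exact: (L2_measurable (H2_L2 (Delta_H2 a q))).
  (* So far the columns are only in [H2]; the diagonal of [Delta^* Delta = 1] bounds every entry by
     1. *)
  exists 1; apply: aeTS Delta_inner => t /matrixP/(_ q q).
  rewrite mxE [RHS]mxE eqxx mulr1n => e.
  have : `|Delta (expi t) a q| ^+ 2 <= 1.
    rewrite -e (bigD1 a) //= adjE mulrC -normCK lerDl.
    by apply: sumr_ge0 => b _; rewrite adjE mulrC -normCK exprn_ge0.
  by rewrite expr_le1.
have Delta_inner_fun : inner_fun Delta by [].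
have coiso := inner_coisometry Delta_inner_fun.
(* The quotient must be [Delta^* F]; its coefficients at [-k] are the pairings of [z^k F] with the
   columns of [Delta]. *)
have divP (F : C -> 'M[C]_n) : H2mx F ->
    (forall i q (k : nat), (0 < k)%N -> dot (shiftv k (fun z => col i (F z))) (delta q) = 0) ->
    left_inner_divisor Delta F.
  move=> hF h; split=> //; exists (fun z => adj (Delta z) *m F z).
    move=> q i; split.
      by apply: L2mx_mull; [exact/Linftymx_adj/Hinftymx_Linftymx|exact: H2mx_L2mx].
    case=> // k _; have := h i q k.+1 (ltn0Sn k); congr (_ = 0).
    apply: eq_intT => t; rewrite mxE mulr_suml; apply: eq_bigr => a _.
    by rewrite !mxE NegzE opprK; ring.
  by apply: aeTS coiso => t e; rewrite mulmxA e mul1mx.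
have spanT i : spanW (fun z => col i (Theta z)).
  by apply: eq_spanW (spanW_thetaC (delta_mx i 0)) => t; rewrite /thetaC -colE.
have [||U [UU1 UU2 DU]] := cop n Delta.
- by apply: divP => [|i q k kp]; [exact: Hinftymx_H2mx|exact: orth_delta].
- apply: divP => // i q [//|k] _.
  have hA' : H2mx (fun z => col i (A z)).
    by move=> a b; under eq_fun do rewrite mxE; exact: hA.
  (* By definition of Hankel vectors, [z^(k+1) A e_i] is [z f1] plus terms [z^(k-j+1) Theta c], each
     in a positive shift of [W]. *)
  pose f1 := hankel_vec Phi A Theta k i.
  pose f2 (j : 'I_k.+1) : V := shiftv (k - j)%N (thetaC (col i (adj (mfourier Phi j)))).
  have lf1 : L2mx f1 by exact/H2mx_L2mx/hankel_vec_H2.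
  have lf2 j : L2mx (f2 j) by exact/shiftv_L2/H2mx_L2mx.
  rewrite (@eq_dotT _ _ _ (shiftv 1 f1 + \sum_(j < k.+1) shiftv 1 (f2 j)) _ (delta q)) // =>
    [|t]; last first.
    rewrite -[RHS]/(shiftv 1 f1 (expi t) + (\sum_(j < k.+1) shiftv 1 (f2 j)) (expi t)).
    rewrite fct_sumE /shiftv -scaler_sumr -scalerDr exprSz -scalerA expr1z; congr (_ *: _).
    rewrite /f1 /hankel_vec /hpoly mulmx_sumr -[LHS](subrK (\sum_(j < k.+1) f2 j (expi t))).
    congr (_ - _ + _); apply: eq_bigr => j _; by rewrite -scalemxAr.
  rewrite (dotDl1 sD) //; last 2 first.
  + exact: shiftv_L2.
  + by apply: (semi_inner_sum sD) => j; exact: shiftv_L2.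
  rewrite orth_delta //; last first.
    by have := spanW_es (pickle (k, i)); rewrite /hankel_seq pickleK.
  rewrite add0r (dot_suml sD) // => [|j]; last exact: shiftv_L2.
  apply: big1 => j _.
  rewrite (@eq_dotT _ _ _ (shiftv (k - j).+1 (thetaC (col i (adj (mfourier Phi j))))) _
    (delta q)) // => [|t].
    exact: orth_delta.
  by rewrite /f2 /shiftv scalerA expr1z -exprSz.
have lx := model_space_L2 mx.
have xdelta (k : nat) q : dot (shiftv k (delta q)) x = 0.
  apply: (@shift_orthogonal 0%N) => // [m c _|p]; first exact: model_thetaC.
  rewrite (@eq_dotT _ _ _ L`_p _ x) // => [|t]; last by rewrite /shiftv expr0z scale1r.
  have : L2mx L`_p /\ dot L`_p x = 0.
    apply: (@gram_schmidt_ind _ _ dot es (fun u => L2mx u /\ dot u x = 0) _ _ k0);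
      last exact: mem_nth.
    - split; first by split; [exact: semi_inner0 sD|exact: (dot0l sD)].
      move=> a u v [lu u0] [lv v0]; split; first exact: (semi_innerP sD).
      by rewrite (semi_innerDl sD) // u0 v0 mulr0 addr0.
    - by move=> a; split; [exact: es_L2|exact: ex].
  by case.
(* With [Delta = U] constant, the pairings of [x] with [z^k Delta] are the entries of [U^*] times
   its coefficients, and [U] is invertible. *)
have mul0 (k : nat) : adj U *m mfourier x k = 0.
  apply/matrixP => q b; rewrite (ord1 b) [RHS]mxE.
  have lU : L2mx (fun z => col q U) by move=> a c; exact: L2_cst.
  have h : dot x (shiftv k (fun=> col q U)) = 0.
    rewrite (semi_innerC sD (shiftv_L2 _ lU) lx).
    rewrite (@aeT_dotT _ _ _ (shiftv k (delta q))); [by rewrite xdelta rmorph0| | |exact: lx|].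
    - exact: shiftv_L2.
    - exact: shiftv_L2.
    - apply: aeTS DU => t e; rewrite /shiftv; congr (_ *: _).
      by apply/matrixP => a c; rewrite -e !mxE (ord1 c).
  rewrite -[RHS]h dotT_sum; last 2 first.
  - exact: lx.
  - exact: shiftv_L2.
  rewrite !mxE; apply: eq_bigr => a _; rewrite !mxE /fourier -intTZ; last by apply: L1_pow;
    exact: L2_L1.
  by apply: eq_intT => t; rewrite !mxE conjcM conj_expiX; ring.
apply: dotT_null => //; apply: fourier0_ae => // i k.
case: k => k; last by have := model_space_H2 mx i 0 => -[_]; apply.
have /matrixP/(_ i 0) : mfourier x k = 0.
  by rewrite -[LHS]mul1mx -UU2 -mulmxA mul0 mulmx0.
by rewrite !mxE.
Qed.

End HankelTotal.

(** * The flip between H(Theta) and H(tilde Theta), and the theorem *)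

Section Tilde.
Variable R : realType.
Local Notation C := R[i].
Local Notation adj M := (M ^t*)%sesqui.

Lemma tildeTK m n (F : C -> 'M[C]_(m, n)) : tildeT (tildeT F) = F.
Proof. by apply/funext => z; rewrite /tildeT adjK conjCK. Qed.

Lemma tildeTE m n (F : C -> 'M[C]_(m, n)) z i j :
  tildeT F z i j = Num.conj (F (Num.conj z) j i).
Proof. by rewrite /tildeT adjE. Qed.

Lemma fourier_tildeT m n (F : C -> 'M[C]_(m, n)) i j k : L2mx F ->
  fourier (fun z => tildeT F z i j) k = Num.conj (fourier (fun z => F z j i) k).
Proof.
move=> lF; under eq_fun do rewrite tildeTE.
rewrite fourier_conj; last exact/L2_L1/(L2_refl (lF j i)).
by rewrite (@fourier_refl _ (fun z => F z j i)) ?opprK //; exact: (L2_measurable (lF j i)).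
Qed.

Lemma H2mx_tildeT m n (F : C -> 'M[C]_(m, n)) : H2mx F -> H2mx (tildeT F).
Proof.
move=> hF i j; split.
  under eq_fun do rewrite tildeTE; exact/L2_conj/(L2_refl (H2_L2 (hF j i))).
move=> k k0; rewrite fourier_tildeT; last exact: H2mx_L2mx.
by have := hF j i => -[_ ->] //; rewrite rmorph0.
Qed.

Lemma Hinftymx_tildeT m n (F : C -> 'M[C]_(m, n)) : Hinftymx F -> Hinftymx (tildeT F).
Proof.
move=> hF i j; split; last exact/H2mx_tildeT/Hinftymx_H2mx.
under eq_fun do rewrite tildeTE; apply: Linfty_conj.
exact: (Linfty_refl (Hinftymx_Linftymx hF j i)).
Qed.

Lemma inner_tildeT n (Theta : C -> 'M[C]_n) : inner_fun Theta -> inner_fun (tildeT Theta).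
Proof.
move=> hT; split; first by apply: Hinftymx_tildeT; case: hT.
by have := aeT_refl (inner_coisometry hT); apply: aeTS => t; rewrite /tildeT adjK.
Qed.

Variable n : nat.
Local Notation V := (C -> 'cV[C]_n).

(* The unitary map from [H(tilde Theta)] onto [H(Theta)]. *)
Definition model_flip (Theta : C -> 'M[C]_n) (f : V) : V :=
  fun z => Num.conj z *: (Theta z *m f (Num.conj z)).

Lemma L2mx_refl m p (F : C -> 'M[C]_(m, p)) : L2mx F -> L2mx (fun z => F (Num.conj z)).
Proof. by move=> lF i j; exact: (L2_refl (lF i j)). Qed.

Lemma model_flip_L2 Theta f : inner_fun Theta -> L2mx f -> L2mx (model_flip Theta f).
Proof.
move=> [hT _] lf i j.
have h := L2mx_mull (Hinftymx_Linftymx hT) (L2mx_refl lf).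
rewrite /model_flip; under eq_fun do rewrite mxE mulrC.
by apply: L2M_Linfty => //; apply: Linfty_conj; exact: (Linfty_pow R 1).
Qed.

Lemma dotT_refl (f g : V) : L2mx f -> L2mx g ->
  dotT (fun z => f (Num.conj z)) (fun z => g (Num.conj z)) = dotT f g.
Proof.
move=> lf lg; apply: (@intT_refl _ (fun z => \sum_(i < n) f z i 0 * Num.conj (g z i 0))).
by apply: L1_measurable; apply: L1_sum => i; apply: L2M => //; exact: L2_conj.
Qed.

Lemma dotT_flip Theta f g : inner_fun Theta -> L2mx f -> L2mx g ->
  dotT (model_flip Theta f) (model_flip Theta g) = dotT f g.
Proof.
move=> hT lf lg; rewrite -(dotT_refl lf lg) -(dotT_inner hT (L2mx_refl lf) (L2mx_refl lg)).
apply: eq_intT => t; apply: eq_bigr => i _; rewrite !mxE [in LHS]conjcM conjCK.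
by rewrite mulrACA conj_expi mulVf ?expi_neq0 // mul1r.
Qed.

(** Reflection together with the factor [conj z] sends frequency [m] to [-(m + 1)], exchanging
    negative and nonnegative ones. So the two conditions of [model_spaceP], on [f] and on
    [(tilde Theta)^* f], change places. *)
Lemma model_flip_model_space Theta f : inner_fun Theta ->
  model_space (tildeT Theta) f -> model_space Theta (model_flip Theta f).
Proof.
move=> hT mf; have [hf [lu u0]] := (model_spaceP (inner_tildeT hT) f).1 mf.
have lf := H2mx_L2mx hf; have lJ := model_flip_L2 hT lf.
have fourier_flip (u : V) i k : L2mx u ->
    fourier (fun z => (Num.conj z *: u (Num.conj z)) i 0) k = fourier (fun z =>
      u z i 0) (- (k + 1)).
  move=> lu'; rewrite -(fourier_refl _ (L2_measurable (lu' i 0))).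
  rewrite -[k + 1]/(k - (-1)) -fourier_shift; apply: eq_fourier => t.
  by rewrite mxE mulrC conj_expi.
apply/(model_spaceP hT); split.
  move=> i j; rewrite (ord1 j); split; first exact: lJ.
  move=> k k0; rewrite -[RHS](u0 i (- (k + 1))); last by rewrite oppr_ge0 -ltzD1 ltrD2r.
  rewrite -[RHS](fourier_flip (fun z => adj (tildeT Theta z) *m f z) i k lu).
  by apply: eq_fourier => t; rewrite /model_flip /tildeT adjK conjCK.
split; first exact: L2mx_adj_inner.
move=> i k k0; have := hf i 0 => -[_ /(_ (- (k + 1)))]; rewrite oppr_lt0 => h.
rewrite -[RHS]h; last by rewrite ltzD1.
rewrite -[RHS](fourier_flip f i k lf); apply: aeT_fourier.
- exact/L2_measurable/L2mx_adj_inner.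
- under eq_fun do rewrite mxE mulrC.
  apply: L2_measurable; apply: L2M_Linfty; first exact: (L2_refl (lf i 0)).
  by apply: Linfty_conj; exact: (Linfty_pow R 1).
- case: hT => _; apply: aeTS => t e.
  by rewrite /model_flip -scalemxAr mulmxA e mul1mx.
Qed.

Lemma model_flipK Theta f : inner_fun Theta ->
  aeT (fun z => model_flip Theta (model_flip (tildeT Theta) f) z = f z).
Proof.
move=> hT; apply: aeTS (inner_coisometry hT) => t e.
rewrite /model_flip /tildeT !conjCK -scalemxAr scalerA conj_expi mulVf ?expi_neq0 //.
by rewrite scale1r mulmxA e mul1mx.
Qed.

Lemma orthonormal_basis_flip Theta B : inner_fun Theta ->
  orthonormal_basis (model_space (tildeT Theta)) B ->
  orthonormal_basis (model_space Theta) (model_flip Theta @` B) /\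
  (model_flip Theta @` B #= B)%card.
Proof.
move=> hT [BX [B1 B0] Btot]; have hT' := inner_tildeT hT.
have lB b : B b -> L2mx b by move=> /BX /model_space_L2.
split; last first.
  (* The flip preserves inner products, so distinct elements of [B] with the same image would give
     [0 = 1]. *)
  apply: inj_card_eq => f g; rewrite !inE => Bf Bg e.
  apply: contrapT => fg; have := dotT_flip hT (lB _ Bf) (lB _ Bg).
  rewrite (B0 _ _ Bf Bg fg) -e dotT_flip ?B1 //; try exact: lB.
  by move=> /eqP; rewrite oner_eq0.
split.
- by move=> _ [b Bb <-]; apply: model_flip_model_space => //; exact: BX.
- split=> [_ [b Bb <-]|_ _ [b Bb <-] [c Bc <-] bc].
    by rewrite dotT_flip ?B1 //; exact: lB.
  by rewrite dotT_flip ?B0 //; [move=> e; apply: bc; rewrite e|exact: lB|exact: lB].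
- move=> f mf fB; have lf := model_space_L2 mf.
  have mf' : model_space (tildeT (tildeT Theta)) f by rewrite tildeTK.
  have mJ := model_flip_model_space hT' mf'.
  have lJ := model_space_L2 mJ.
  have lJJ := model_flip_L2 hT lJ.
  have jk := model_flipK f hT.
  have J0 : aeT (fun z => model_flip (tildeT Theta) f z = 0).
    (* Pairing the flip of [f] with [b] equals pairing [f] with the flip of [b], the two flips being
       mutually inverse a.e. *)
    apply: Btot => // b Bb; have lb := lB _ Bb.
    rewrite -[LHS](dotT_flip hT lJ lb) (aeT_dotT lJJ lf (model_flip_L2 hT lb) jk).
    by apply: fB; exists b.
  apply: aeTS (aeT_and jk (aeT_refl J0)) => t [<- e].
  rewrite -[LHS]/(Num.conj (expi t) *: (Theta (expi t) *m model_flip (tildeT Theta) f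
    (Num.conj (expi t)))).
  by rewrite e mulmx0 scaler0.
Qed.

End Tilde.

(** * Passing a dimension bound through the Hankel matrix *)

Section Transfer.
Variables (R : realType) (n : nat).
Local Notation C := R[i].
Local Notation V := (C -> 'cV[C]_n).
Local Notation adj M := (M ^t*)%sesqui.
Local Notation dot := (@dotT R n).

(** If [H(Theta1)] has dimension at most [d], its pairings factor through [d] coordinates. Conjugate
    transposition turns this into a bound on the span of the Hankel vectors of [tilde Phi], which
    are total in [H(Theta2)]. *)
Lemma bshift_size_transfer (Phi Theta1 A1 Theta2 A2 : C -> 'M[C]_n) (d : nat) :
  H2mx Phi -> left_coprime_factorization Phi A1 Theta1 ->
  left_coprime_factorization (tildeT Phi) A2 Theta2 ->
  (forall k, (size (gram_schmidt dot (bshift_seq Theta1) k) <= d)%N) ->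
  forall k, (size (gram_schmidt dot (bshift_seq Theta2) k) <= d)%N.
Proof.
move=> hPhi [hT1 hA1 e1 _] [hT2 hA2 e2 cop] hd.
have sD := semi_inner_dotT R n.
have hPhi2 := H2mx_tildeT hPhi.
set es1 := hankel_seq Phi A1 Theta1; set es2 := hankel_seq (tildeT Phi) A2 Theta2.
set qs1 := bshift_seq Theta1; set qs2 := bshift_seq Theta2.
have mes1 a : model_space Theta1 (es1 a) by exact: (hankel_seq_model_space hPhi hA1 hT1 e1).
have mes2 a : model_space Theta2 (es2 a) by exact: (hankel_seq_model_space hPhi2 hA2 hT2 e2).
have mqs1 a : model_space Theta1 (qs1 a) by exact: bshift_seq_model_space.
have mqs2 a : model_space Theta2 (qs2 a) by exact: bshift_seq_model_space.
have les2 a := model_space_L2 (mes2 a).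
have lqs1 a := model_space_L2 (mqs1 a); have lqs2 a := model_space_L2 (mqs2 a).
have X1 := model_space_linear hT1; have X2 := model_space_linear hT2.
(* Both sides carry the coefficient of index [j + k + 1], which is symmetric in [j] and [k];
   [tildeT] transposes and conjugates it. *)
have sym a b : dot (es2 a) (qs2 b) = Num.conj (dot (es1 b) (qs1 a)).
  have lh2 j i : L2mx (hankel_vec (tildeT Phi) A2 Theta2 j i) by exact/H2mx_L2mx/hankel_vec_H2.
  have lh1 j i : L2mx (hankel_vec Phi A1 Theta1 j i) by exact/H2mx_L2mx/hankel_vec_H2.
  have lb2 j i : L2mx (bshift Theta2 j i) by exact/H2mx_L2mx/bshift_H2.
  have lb1 j i : L2mx (bshift Theta1 j i) by exact/H2mx_L2mx/bshift_H2.
  rewrite /es2 /qs2 /es1 /qs1 /hankel_seq /bshift_seq.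
  case: (unpickle a) => [[j i]|]; case: (unpickle b) => [[k r]|].
  - rewrite (dot_hankel_bshift hPhi2 hA2 hT2 e2) (dot_hankel_bshift hPhi hA1 hT1 e1).
    by rewrite (fourier_tildeT _ _ _ (H2mx_L2mx hPhi)) addnC.
  - by rewrite (dot0r sD (lh2 j i)) (dot0l sD (lb1 j i)) rmorph0.
  - by rewrite (dot0l sD (lb2 k r)) (dot0r sD (lh1 k r)) rmorph0.
  - by rewrite (dot0l sD (semi_inner0 sD)) rmorph0.
have tot Theta x : inner_fun Theta -> model_space Theta x ->
    (forall k, dot (bshift_seq Theta k) x = 0) -> dot x x = 0.
  move=> hT mx h; apply: (bshift_seq_sep hT mx) => a.
  have lb := model_space_L2 (bshift_seq_model_space hT a).
  by rewrite (semi_innerC sD lb (model_space_L2 mx)) h rmorph0.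
have [k1 span1] := gram_schmidt_spanned sD X1 (@model_space_L2 _ _ Theta1) mqs1 (fun x =>
  @tot _ x hT1) hd.
set L1 := gram_schmidt dot qs1 k1 in span1.
have lL1 i : L2mx L1`_i by exact/(ons_D _)/(gram_schmidt_ons sD).
have size_es2 k : (size (gram_schmidt dot es2 k) <= d)%N.
  apply: (@leq_trans (size L1)); last exact: hd.
  (* Expanding [es1 b] in [L1] and using [sym], the pairings of each [es2 a] with all [qs2 b] are
     combinations of these [size L1] functions of [b]. *)
  pose y (b : nat) (q : 'I_(size L1)) := Num.conj (dot (es1 b) L1`_q).
  apply: (orthonormal_size_le (y := y) sD (gram_schmidt_ons sD k les2) X2
    (@model_space_L2 _ _ Theta2) lqs2 (fun x => @bshift_seq_sep _ _ _ hT2 x)).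
    apply: gram_schmidt_ind.
      split; first split; first by case: X2.
        by exists (fun=> 0) => b; rewrite (dot0l sD (lqs2 b)) big1 // => q _; rewrite mul0r.
      move=> a u v [mu [cu hu]] [mv [cv hv]]; split; first by case: X2 => _; apply.
      exists (fun q => a * cu q + cv q) => b.
      rewrite (semi_innerDl sD a (model_space_L2 mu) (model_space_L2 mv) (lqs2 b)) hu hv.
      by rewrite mulr_sumr -big_split /=; apply: eq_bigr => q _; ring.
    move=> a; split=> //; exists (fun q => Num.conj (dot L1`_q (qs1 a))) => b.
    rewrite sym (span1 _ (mes1 b) _ (lqs1 a)) conjc_sum; apply: eq_bigr => q _.
    by rewrite conjcM mulrC.
have [k2 span2] : exists k2, forall a, spanned (@L2mx R n 1) dot (gram_schmidt dot es2 k2)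
  (es2 a).
  (* The double orthogonal of [es2], in which [es2] is total by construction. This provides the
     finite spanning list that [hankel_total] requires. *)
  pose P (x : V) := L2mx x /\ forall y, L2mx y -> (forall j, dot (es2 j) y = 0) -> dot x y = 0.
  have [|x []//|a|x [lx]|k2 h] := @gram_schmidt_spanned _ _ _ _ sD es2 P d _ _ _ _ size_es2.
  - split; first by split; [exact: semi_inner0 sD|move=> y ly _; exact: (dot0l sD)].
    move=> a x y [lx hx] [ly hy]; split; first exact: (semi_innerP sD).
    by move=> z lz hz; rewrite (semi_innerDl sD) // hx // hy // mulr0 addr0.
  - by split=> // y _; apply.
  - by move=> hx h; apply: hx.
  - by exists k2 => a; apply: h; split=> // y _; apply.
have tot2 := hankel_total hPhi2 hA2 hT2 e2 span2 cop.
have [k3 span3] := gram_schmidt_spanned sD X2 (@model_space_L2 _ _ Theta2) mes2 tot2 size_es2.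
set L3 := gram_schmidt dot es2 k3 in span3.
have oL3 : orthonormal_seq (@L2mx R n 1) dot L3 by exact: gram_schmidt_ons.
move=> k; apply: (@leq_trans (size L3)); last exact: size_es2.
(* [L3] spans all of [H(Theta2)], so it can serve as the separating family when counting the
   orthonormalized backward shifts. *)
have sep3 x : model_space Theta2 x -> (forall b : nat, dot x L3`_b = 0) -> dot x x = 0.
  move=> mx h; rewrite (span3 _ mx _ (model_space_L2 mx)).
  by apply: big1 => q _; rewrite h mul0r.
pose y (b : nat) (q : 'I_(size L3)) := dot L3`_q L3`_b.
have lL3 (b : nat) : L2mx L3`_b by apply: (ons_D sD).
apply: (orthonormal_size_le (y := y) sD (gram_schmidt_ons sD k lqs2) X2
  (@model_space_L2 _ _ Theta2) lL3 sep3).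
  move=> u uL; have mu := gram_schmidt_ind X2 mqs2 uL.
  split=> //; exists (fun q => dot u L3`_q) => b; rewrite (span3 _ mu) //.
Qed.

Lemma bshift_size_gt (Phi Theta1 A1 Theta2 A2 : C -> 'M[C]_n) (m : nat) :
  H2mx Phi -> left_coprime_factorization Phi A1 Theta1 ->
  left_coprime_factorization (tildeT Phi) A2 Theta2 ->
  (exists k, (m < size (gram_schmidt dot (bshift_seq Theta2) k))%N) ->
  exists k, (m < size (gram_schmidt dot (bshift_seq Theta1) k))%N.
Proof.
move=> hPhi h1 h2 [k mk]; apply: contrapT => nk.
move: mk; rewrite ltnNge => /negP; apply.
apply: (bshift_size_transfer hPhi h1 h2) => k'.
by rewrite leqNgt; apply/negP => mk'; apply: nk; exists k'.
Qed.

End Transfer.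

Theorem lemma4p31 (R : realType) (n : nat)
    (Phi Theta_r A_r Theta_l A_l : R[i] -> 'M[R[i]]_n)
    (hPhi : H2mx Phi)
    (hbt : bounded_type (adjT Phi))
    (hr : right_coprime_factorization Phi Theta_r A_r)
    (hl : left_coprime_factorization Phi A_l Theta_l) :
  same_dim (model_space Theta_r) (model_space Theta_l).
Proof.
have [hTr hAr er copr] := hr; have [hTl hAl el copl] := hl.
have hTr' := inner_tildeT hTr.
(* Applying [tildeT] reverses products; right coprimeness is by definition left coprimeness of the
   transforms. *)
have hr' : left_coprime_factorization (tildeT Phi) (tildeT A_r) (tildeT Theta_r).
  split=> //; first exact: H2mx_tildeT.
  have := aeT_refl er; apply: aeTS => t e.
  by rewrite /tildeT e adjM !adjK.
have sD := semi_inner_dotT R n.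
have [onB cardB] := orthonormal_basis_flip hTr (orthonormal_basis_gram_schmidt hTr').
have lq (Theta : R[i] -> 'M[R[i]]_n) : inner_fun Theta -> forall k, L2mx (bshift_seq Theta k).
  by move=> hT k; apply: model_space_L2; exact: bshift_seq_model_space.
exists (model_flip Theta_r @` gram_schmidt_set (@dotT R n) (bshift_seq (tildeT Theta_r))).
exists (gram_schmidt_set (@dotT R n) (bshift_seq Theta_l)).
split; [exact: onB|exact: orthonormal_basis_gram_schmidt|].
have c1 := card_eq_trans cardB (gram_schmidt_set_card sD (lq _ hTr')).
have c2 := gram_schmidt_set_card sD (lq _ hTl).
suff e : [set m | exists k, (m < size (gram_schmidt (@dotT R n) (bshift_seq Theta_l) k))%N] =
  [set m | exists k, (m < size (gram_schmidt (@dotT R n) (bshift_seq (tildeT Theta_r)) k))%N].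
  by rewrite e card_eq_sym in c2; exact: (card_eq_trans c1 c2).
have hl' : left_coprime_factorization (tildeT (tildeT Phi)) A_l Theta_l by rewrite tildeTK.
(* The transfer runs in both directions because [tildeT] is an involution. *)
apply/seteqP; split=> m.
- exact: bshift_size_gt (H2mx_tildeT hPhi) hr' hl'.
- exact: bshift_size_gt hPhi hl hr'.
Qed.
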